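(* Assume the existence of medial limits and the Axiom of choice for $\mathbb R$. Then Assumption (D) (stated in the context) holds for $(\mu,\nu)$.
   Context: **Medial limits.** A linear operator $\mathfrak m:\ell^\infty\to\mathbb R$ (on real bounded sequences) is a medial limit if: (i) $u\ge0$ implies $\mathfrak m(u)\ge0$; (ii) $\mathfrak m((u_{n+1})_n)=\mathfrak m((u_n)_n)$; (iii) $\mathfrak m((1)_n)=1$; (iv) $\mathfrak m$ is universally measurable on $[0,1]^{\mathbb N}$; (v) for any sequence of Borel functions $f_n:[0,1]\to[0,1]$, the pointwise defined $f=\mathfrak m((f_n)_n)$ is $\lambda$-measurable for every Borel measure $\lambda$ on $[0,1]$ and $\int f\,d\lambda=\mathfrak m\big((\int f_n\,d\lambda)_n\big)$. (Existence of medial limits is implied by Martin's axiom, and is undecidable in ZFC. The Axiom of choice for $\mathbb R$ implies that $\mathbb R$ can be well ordered.) **Setting.** $d\ge 1$; $\mu,\nu$ are probability measures on $\mathbb R^d$ with finite first moment and $\mu\preceq\nu$ in convex order ($\mu(f)\le\nu(f)$ for every finite convex $f$). $\Omega=\mathbb R^d\times\mathbb R^d$, $X(x,y)=x$, $Y(x,y)=y$. $\mathcal M(\mu,\nu)$ is the set of probability measures $\mathbb P$ on $\Omega$ with $\mathbb P\circ X^{-1}=\mu$, $\mathbb P\circ Y^{-1}=\nu$ and $\mathbb E^{\mathbb P}[Y|X]=X$. $\mathbb P_x$ is the conditional kernel: $\mathbb P(dx,dy)=\mu(dx)\mathbb P_x(dy)$. $\mathcal N_m$ is the collection of null sets of a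 measure $m$; $\mathcal N_{\mu,\nu}=\bigcap_{\mathbb P\in\mathcal M(\mu,\nu)}\mathcal N_{\mathbb P}$ (polar sets). Convention $\infty-\infty=\infty$. $\mathbb P[f]=\int f\,d\mathbb P$. For $A\subset\Omega$: $A^c_x=\{y:(x,y)\notin A\}$. $\operatorname{ri}$, $\operatorname{cl}$, $\operatorname{conv}$: relative interior, closure, convex hull; $\dim A$ is the dimension of the affine hull. $\mathbf T_pf(x,y)=f(y)-f(x)-p(x)\cdot(y-x)$. **Irreducible components.** $\overset{\frown}{\mathcal K}$ is the Polish space of closed convex subsets of $\mathbb R^d$ (Wijsman topology), identified with the set of their relative interiors. $I$ is the ($\mu$-a.s. unique) Borel map with relatively open convex values, $x\in I(x)$, $\{I(x):x\in\mathbb R^d\}$ a partition of $\mathbb R^d$, such that for some $\widehat{\mathbb P}\in\mathcal M(\mu,\nu)$: $\operatorname{ri}\operatorname{conv}\operatorname{supp}\widehat{\mathbb P}_X=I(X)\supset\operatorname{ri}\operatorname{conv}\operatorname{supp}\mathbb P_X$, $\mu$-a.s., for all $\mathbb P\in\mathcal M(\mu,\nu)$. (Existence is known.) **Martingale monotonicity.** $\mathbb P'$ is a competitor to $\mathbb P$ if they have the same $X$-marginal, the same $Y$-marginal and $\mathbb P[Y|X]=\mathbb P'[Y|X]$. $A\subset\Omega$ is $f$-martingale monotone if $\mathbb P[f]\ge\mathbb P'[f]$ for every $\mathbb P$ with finite support in $A$ and every competitor $\mathbb P'$ to $\mathbb P$. **Tangent convex functions.** Let $\theta:\Omega\to[0,\infty]$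 be universally measurable and $N\in\mathcal N_{\mu,\nu}$ Borel with $\{X=Y\}\subset N^c$. $\theta$ is $N$-tangent convex if: (1) $\theta(x,x)=0$ and $\theta(x,\cdot)$ is convex on $N^c_x$ (convexity inequalities among points of $N_x^c$); (2) $N^c$ is $\theta$-martingale monotone; (3) for every $\mathbb P$ with finite support in $N^c$ and competitor $\mathbb P'$ such that $\operatorname{supp}\mathbb P'\cap N$ is a singleton, $\mathbb P'[N]=0$; (4) for some $N_\mu\in\mathcal N_\mu$, $A:=\{X\notin N_\mu\}\cap\{Y\in I(X)\}\subset N^c$ and $\mathbf 1_A\theta$ is finite and Borel. $\Theta_{\mu,\nu}$ is the set of functions that are $N$-tangent convex for some such $N$. $(\theta_n)\subset\Theta_{\mu,\nu}$ generates $\theta\in\Theta_{\mu,\nu}$ ($\theta_n\rightsquigarrow\theta$) if $\liminf_n\theta_n\le\theta$ and $\mathbb P[\theta]\le\limsup_n\mathbb P[\theta_n]$ for every probability $\mathbb P$ on $\Omega$. $\mathcal T\subset\Theta_{\mu,\nu}$ is semi-closed if it contains every $\theta$ generated by a sequence in $\mathcal T$; the semi-closure of a set is the smallest semi-closed set containing it. $\mathfrak C$ = finite convex functions on $\mathbb R^d$; $\partial f$ = measurable selections of the subgradient; $\mathfrak C_a=\{f\in\mathfrak C:(\nu-\mu)(f)\le a\}$; $\widetilde{\mathcal T}_a$ is the semi-closure of $\{\mathbf T_pf:f\in\mathfrak C_a,p\in\partial f\}$. **Assumption (D).** (i) For every $(\theta_n)_{n\ge1}\subset\widetilde{\mathcal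 T}_1$ there is $\theta\in\widetilde{\mathcal T}_1$ with $\theta_n\rightsquigarrow\theta$. (ii) $I(X)\in\mathcal C\cup\mathcal D\cup\mathcal R$ $\mu$-a.s. for some subsets $\mathcal C,\mathcal D,\mathcal R\subset\overset{\frown}{\mathcal K}$ with $\mathcal C$ well ordered, $\dim K\in\{0,1\}$ for $K\in\mathcal D$, and $\bigcup_{K\ne K'\in\mathcal R}[K\times(\operatorname{cl}K\cap\operatorname{cl}K')]\in\mathcal N_{\mu,\nu}$. *)

(* Defs.v *)
From HB Require Import structures.
From mathcomp Require Import all_boot all_order all_algebra.
From mathcomp Require Import all_classical all_reals all_analysis.
From mathcomp Require Import measurable_realfun wochoice.

Set Implicit Arguments.
Unset Strict Implicit.
Unset Printing Implicit Defensive.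
Import Order.TTheory GRing.Theory Num.Theory.
Import numFieldNormedType.Exports.

Local Open Scope classical_set_scope.
Local Open Scope ring_scope.

(* Borel sigma-algebra on matrices, in particular on R^d = 'rV[R]_d; the
   product R^d * R^d carries the library's product sigma-algebra. *)
HB.instance Definition _ (R : realType) (m n : nat) :=
  Measurable.copy 'M[R]_(m, n) (g_sigma_algebraType (@open 'M[R]_(m, n))).

(* Integrals of completion-measurable functions need no completed measure:
   the library's integral of a nonnegative function is the supremum of the
   integrals of its measurable simple minorants, which for such functions is
   the integral against the completion. *)
Definition completion_measurable (disp : measure_display)
    (T : measurableType disp) (R : realType) (m : {measure set T -> \bar R})
    (A : set T) :=
  exists2 B, measurable B & m.-negligible (A `+` B).

Definition univ_measurable (disp : measure_display) (T : measurableType disp)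
    (R : realType) (A : set T) :=
  forall P : probability T R, completion_measurable P A.

Section MedialLimit.
Context (R : realType).

Local Notation I01 := (`[0%R, 1%R]%classic : set R).

Definition cylinders : set (set (nat -> R)) :=
  [set A | exists n (B : set R), measurable B /\ A = (fun u => u n) @^-1` B].

(* A medial limit is an operator on the bounded sequences: its values at
   unbounded sequences are never used. *)
Record medial_limit (m : (nat -> R) -> R) : Prop := MedialLimit {
  medial_linear : forall (a : R) (u v : nat -> R),
    bounded_fun u -> bounded_fun v ->
    m (fun n => a * u n + v n) = a * m u + m v ;
  medial_ge0 : forall u : nat -> R, bounded_fun u ->
    (forall n, 0 <= u n) -> 0 <= m u ;
  medial_shift : forall u : nat -> R, bounded_fun u ->
    m (fun n => u n.+1) = m u ;
  medial_cst1 : m (fun=> 1) = 1 ;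
  medial_univ_measurable : forall B : set R, measurable B ->
    @univ_measurable _ (g_sigma_algebraType cylinders) R
      [set u | (forall n, 0 <= u n <= 1) /\ B (m u)] ;
  medial_integral : forall (l : {finite_measure set R -> \bar R})
      (f : nat -> R -> R),
    (forall n, measurable_fun I01 (f n)) ->
    (forall n x, I01 x -> 0 <= f n x <= 1) ->
    (forall B : set R, measurable B ->
       completion_measurable l (I01 `&` [set x | B (m (f ^~ x))])) /\
    \int[l]_(x in I01) m (f ^~ x) =
      m (fun n => \int[l]_(x in I01) f n x) }.

Definition choice_on : Prop :=
  forall F : set (set R), (forall A, F A -> A !=set0) ->
    exists c : set R -> R, forall A, F A -> A (c A).

End MedialLimit.

(* The library's dual addition follows the convention oo - oo = oo, unlike
   its usual addition. *)
Definition sub_inf (R : realType) (x y : \bar R) : \bar R := (x - y)%dE.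

Section Geometry.
Context (R : realType) (d : nat).
Local Notation V := 'rV[R]_d.

Definition dotp (u v : V) : R := \sum_i u 0 i * v 0 i.

Definition enorm (u : V) : R := Num.sqrt (dotp u u).

Definition convex_hull (A : set V) : set V := smallest (@convex_set R V) A.

Definition aff (A : set V) : set V :=
  [set x | exists (n : nat) (a : 'I_n -> V) (t : 'I_n -> R),
    [/\ forall i, A (a i), \sum_i t i = 1 & x = \sum_i t i *: a i]].

Definition ri (A : set V) : set V :=
  [set x | A x /\ \forall y \near x, aff A y -> A y].

Definition has_dim (A : set V) (k : nat) :=
  exists (x : V) (U : {vspace V}),
    aff A = [set y | y - x \in U] /\ \dim U = k.

(* Relative interiors of the nonempty closed convex sets; K stands for cl K. *)
Definition Kri : set (set V) :=
  [set K | exists F, [/\ F !=set0, closed F, @convex_set R V F & K = ri F]].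

(* The Wijsman topology is the initial one for A |-> (dist(y, A))_y. It is put
   here on all sets; its trace on nonempty closed convex sets is the usual
   one. *)
Definition dist_to (A : set V) : {ptws V -> R} :=
  fun y => inf [set enorm (y - a) | a in A].

Definition wijsman := initial_topology dist_to.

Definition finite_convex (f : V -> R) := @convex_function R V [set: V] f.

Definition is_subgradient (f : V -> R) (p : V -> V) :=
  measurable_fun [set: V] p /\
  forall x y, f x + dotp (p x) (y - x) <= f y.

End Geometry.

(* Defined for a set function, since T is only required to be topological. *)
Definition supp (R : realType) (T : topologicalType) (m : set T -> \bar R) :
    set T :=
  \bigcap_(C in [set C | closed C /\ m (~` C) = 0%E]) C.

Section Martingale.
Context (R : realType) (d : nat).
Local Notation V := 'rV[R]_d.
Local Notation Omega := (V * V)%type.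

Definition finite_first_moment (mu : probability V R) :=
  mu.-integrable [set: V] (fun x => (enorm x)%:E).

Definition convex_order (mu nu : probability V R) :=
  forall f : V -> R, finite_convex f ->
    (\int[mu]_x (f x)%:E <= \int[nu]_x (f x)%:E)%E.

(* g(X) is a version of E^P[Y | X]. *)
Definition is_condexp (P : probability Omega R) (g : V -> V) :=
  measurable_fun [set: V] g /\
  forall i : 'I_d,
    [/\ P.-integrable [set: Omega] (fun w => (w.2 0 i)%:E),
        P.-integrable [set: Omega] (fun w => (g w.1 0 i)%:E) &
        forall A : set V, measurable A ->
          (\int[P]_(w in fst @^-1` A) (g w.1 0 i)%:E =
           \int[P]_(w in fst @^-1` A) (w.2 0 i)%:E)%E].

Definition has_marginals (P : probability Omega R) (mu nu : set V -> \bar R) :=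
  forall A : set V, measurable A ->
    P (fst @^-1` A) = mu A /\ P (snd @^-1` A) = nu A.

Definition mart_couplings (mu nu : probability V R) : set (probability Omega R) :=
  [set P | has_marginals P mu nu /\ is_condexp P id].

Definition disintegrates (P : probability Omega R) (mu : probability V R)
    (k : R.-pker V ~> V) :=
  forall A : set Omega, measurable A ->
    (P A = \int[mu]_x k x (xsection A x))%E.

Definition polar (mu nu : probability V R) (N : set Omega) :=
  forall P, mart_couplings mu nu P -> P.-negligible N.

(* I x is identified with its closure for Borel measurability. Disintegrations
   exist and are unique mu-a.e., so it is immaterial whether kernels are
   quantified existentially or universally. *)
Record irreducible_components (mu nu : probability V R) (I : V -> set V) :
    Prop := IrreducibleComponents {
  comp_borel : forall U : set (wijsman R d), open U ->
    measurable [set x : V | U (closure (I x))] ;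
  comp_convex : forall x, @convex_set R V (I x) ;
  comp_ri : forall x, ri (I x) = I x ;
  comp_refl : forall x, I x x ;
  comp_partition : forall x y, I x = I y \/ I x `&` I y = set0 ;
  comp_max : exists Phat, mart_couplings mu nu Phat /\
    (exists2 k : R.-pker V ~> V, disintegrates Phat mu k &
       {ae mu, forall x, ri (convex_hull (supp (k x))) = I x}) /\
    (forall P, mart_couplings mu nu P ->
       forall k : R.-pker V ~> V, disintegrates P mu k ->
       {ae mu, forall x, ri (convex_hull (supp (k x))) `<=` I x}) }.

Definition competitor (P' P : probability Omega R) :=
  has_marginals P' (pushforward P fst) (pushforward P snd) /\
  exists2 g : V -> V, is_condexp P g & is_condexp P' g.

Definition finitely_supported_in (P : probability Omega R) (A : set Omega) :=
  finite_set (supp P) /\ supp P `<=` A.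

Definition martingale_monotone (f : Omega -> \bar R) (A : set Omega) :=
  forall P P' : probability Omega R,
    finitely_supported_in P A -> competitor P' P ->
    (\int[P']_w f w <= \int[P]_w f w)%E.

(* N^c_x need not be convex, so convexity on it is Jensen's inequality for
   arbitrary finite convex combinations, not just for two points. *)
Definition convex_on (A : set V) (f : V -> \bar R) :=
  forall (n : nat) (y : 'I_n -> V) (t : 'I_n -> R),
    (forall i, A (y i)) -> (forall i, 0 <= t i) -> \sum_i t i = 1 ->
    A (\sum_i t i *: y i) ->
    (f (\sum_i t i *: y i)%R <= \sum_i (t i)%:E * f (y i))%E.

Section Components.
Context (mu nu : probability V R) (I : V -> set V).

Record tangent_convex (N : set Omega) (theta : Omega -> \bar R) : Prop :=
    TangentConvex {
  tc_ge0 : forall w, (0 <= theta w)%E ;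
  tc_univ_measurable : forall B : set (\bar R), measurable B ->
    univ_measurable R (theta @^-1` B) ;
  tc_borel : measurable N ;
  tc_polar : polar mu nu N ;
  tc_diag : [set w | w.1 = w.2] `<=` ~` N ;
  tc_diag0 : forall x, theta (x, x) = 0%E ;
  tc_convex : forall x,
    convex_on [set y | ~ N (x, y)] (fun y => theta (x, y)) ;
  tc_monotone : martingale_monotone theta (~` N) ;
  tc_singleton : forall P P' : probability Omega R,
    finitely_supported_in P (~` N) -> competitor P' P ->
    (exists w, supp P' `&` N = [set w]) -> P' N = 0%E ;
  tc_restriction : exists2 Nmu : set V, mu.-negligible Nmu &
    let A := [set w : Omega | ~ Nmu w.1 /\ I w.1 w.2] in
    [/\ A `<=` ~` N, forall w, A w -> theta w \is a fin_num &
        measurable_fun [set: Omega] (theta \_ A)] }.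

Definition Theta : set (Omega -> \bar R) :=
  [set theta | exists N, tangent_convex N theta].

Definition generates (thetas : nat -> Omega -> \bar R)
    (theta : Omega -> \bar R) :=
  [/\ forall n, Theta (thetas n), Theta theta,
      forall w, (limn_einf (thetas ^~ w) <= theta w)%E &
      forall P : probability Omega R,
        (\int[P]_w theta w <=
         limn_esup (fun n => \int[P]_w thetas n w))%E].

Definition semi_closed (S : set (Omega -> \bar R)) :=
  S `<=` Theta /\
  forall thetas theta, (forall n, S (thetas n)) ->
    generates thetas theta -> S theta.

Definition semi_closure (S : set (Omega -> \bar R)) :=
  smallest semi_closed S.

Definition tangent_Tp (f : V -> R) (p : V -> V) : Omega -> \bar R :=
  fun w => (f w.2 - f w.1 - dotp (p w.1) (w.2 - w.1))%:E.

Definition convex_fun (a : R) : set (V -> R) :=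
  [set f | finite_convex f /\
    (sub_inf (\int[nu]_x (f x)%:E) (\int[mu]_x (f x)%:E) <= a%:E)%E].

Definition T_tilde (a : R) : set (Omega -> \bar R) :=
  semi_closure [set theta | exists f p,
    [/\ convex_fun a f, is_subgradient f p & theta = tangent_Tp f p]].

Record assumption_D : Prop := AssumptionD {
  D_compact : forall thetas : nat -> Omega -> \bar R,
    (forall n, T_tilde 1 (thetas n)) ->
    exists2 theta, T_tilde 1 theta & generates thetas theta ;
  D_components : exists C D S : set (set V),
    [/\ C `<=` @Kri R d /\ D `<=` @Kri R d /\ S `<=` @Kri R d,
        {ae mu, forall x, (C `|` D `|` S) (I x)},
        exists le : rel (set V), wo_chain le (mem C),
        forall K, D K -> has_dim K 0 \/ has_dim K 1 &
        polar mu nu [set w | exists K K', [/\ S K, S K', K <> K', K w.1 &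
          closure K w.2 /\ closure K' w.2]]] }.

End Components.
End Martingale.

(* Main.v *)
Require Import Defs.
From HB Require Import structures.
From mathcomp Require Import all_boot all_order all_algebra.
From mathcomp Require Import all_classical all_reals all_analysis.
From mathcomp Require Import measurable_realfun wochoice lra.

Set Implicit Arguments.
Unset Strict Implicit.
Unset Printing Implicit Defensive.
Import Order.TTheory GRing.Theory Num.Theory.
Import numFieldNormedType.Exports.

Local Open Scope classical_set_scope.
Local Open Scope ring_scope.

(** The first half of the conclusion is a compactness statement, and the limit
    of a sequence [theta_n] is its pointwise medial limit, extended to sequences
    in [[0, oo]] as the supremum over [k] of the medial limits of the
    truncations [min(theta_n, k)]. On such sequences the extended limit [mhat]
    is monotone, additive and positively homogeneous, and lies between the
    lower and the upper limit. Everything that defines tangent convexity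
    through finite sums therefore passes to the limit on the complement of the
    union [N] of the polar sets [N_n]: Jensen inequalities, and martingale
    monotonicity because a competitor of a finitely supported measure is
    finitely supported ([limit_convex], [mhat_monotone]). The singleton
    condition passes to the union because the single charged point of [N]
    already lies in one [N_n] ([singleton_bigcup]).

    The lower half of generation is [liminf <= mhat]. The upper half is a
    reverse Fatou inequality ([integral_mhat_le]). The exchange of medial limit
    and integral is postulated on the unit interval only, but countably many
    Borel functions on any space factor through a single [[0, 1]]-valued one,
    their Marczewski function ([common_factor]), whose law carries the exchange
    over to every probability space.

    What remains is the fibrewise condition: off a [mu]-null set of [x], the
    limit must be finite on the component [I x] and jointly Borel there.
    For finiteness, every element [theta] of the semi-closure satisfies
    [P[theta] <= 1] for all martingale couplings [P]: tangent functions do by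
    the martingale property ([tangent_cost_le1]), and the bound is itself a
    semi-closed condition ([T_tilde_cost]). Hence the limit is almost surely
    finite under the coupling that realizes the components. The points where
    it is finite are dense in the support of almost every conditional law, their
    convex hull contains the relative interior [I x] of the hull of the
    support ([ri_hull_full_measure]), and Jensen's inequality bounds the limit
    on all of [I x]. For joint measurability, a medial limit is only
    universally measurable; but on a relatively open convex set a finite convex
    function is continuous, so it is determined by its values along countably
    many Borel selections of [I], and each of these one-variable functions is
    Borel off a [mu]-null set ([borel_restriction]).

    The second half holds with all relatively open convex sets in the class
    [C], well ordered by the axiom of choice, and no sets in the other two
    classes; the point is that a relatively open convex set is the relative
    interior of its closure ([ri_closure]). *)

(** * Medial limits of sequences with values in [0, oo] *)

Lemma ex_le_nat (R : realType) (x : R) : exists l : nat, x <= l%:R.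
Proof.
exists (Num.bound `|x|); apply: le_trans (ler_norm x) _.
by rewrite ltW// archi_boundP.
Qed.

Section MedialExtension.
Context (R : realType) (m : (nat -> R) -> R) (hm : medial_limit m).
Implicit Types (u v : nat -> R) (U V : nat -> \bar R).

Lemma bounded_itv u (a b : R) : (forall n, a <= u n <= b) -> bounded_fun u.
Proof.
move=> ub; exists (`|a| + `|b|); split; first exact: num_real.
move=> M hM n _; have /andP[au bu] := ub n.
apply: le_trans (ltW hM); rewrite ler_norml.
have := ler_norm a; have := ler_norm b; have := normr_ge0 a.
have := normr_ge0 b; have := ler_norm (- a); rewrite normrN.
by move=> *; apply/andP; split; lra.
Qed.

Lemma bounded_shift u k : bounded_fun u -> bounded_fun (fun n => u (n + k)%N).
Proof.
by move=> -[M [Mr bM]]; exists M; split => // x Mx n _; exact: (bM _ Mx).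
Qed.

Lemma medial_le u v : bounded_fun u -> bounded_fun v ->
  (forall n, u n <= v n) -> m u <= m v.
Proof.
move=> bu bv uv.
have := @medial_linear _ _ hm (-1) u v bu bv.
rewrite mulN1r addrC => e; rewrite -subr_ge0 -e.
have [M1 [_ B1]] := bu; have [M2 [_ B2]] := bv.
apply: (medial_ge0 hm) => [|n]; last by rewrite mulN1r addrC subr_ge0.
have h1 n : `|u n| <= `|M1| + 1.
  by apply: (B1 (`|M1| + 1)) => //; rewrite (le_lt_trans (ler_norm _))// ltrDl.
have h2 n : `|v n| <= `|M2| + 1.
  by apply: (B2 (`|M2| + 1)) => //; rewrite (le_lt_trans (ler_norm _))// ltrDl.
apply: (@bounded_itv _ (- (`|M1| + 1 + (`|M2| + 1))) (`|M1| + 1 + (`|M2| + 1))) => n.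
by have := h1 n; have := h2 n; rewrite !ler_norml => /andP[? ?] /andP[? ?]; apply/andP; split; lra.
Qed.

Lemma medial_cst c : m (fun=> c) = c.
Proof.
have b0 (a : R) : bounded_fun (fun _ : nat => a).
  by apply: (@bounded_itv _ a a) => _; rewrite lexx.
have m0 : m (fun=> 0) = 0.
  have := @medial_linear _ _ hm 1 _ _ (b0 0) (b0 0).
  by rewrite !mul1r addr0 => h; lra.
have := @medial_linear _ _ hm c _ _ (b0 1) (b0 0).
by rewrite m0 (medial_cst1 hm) mulr1 !addr0.
Qed.

Lemma medial_shiftn u k : bounded_fun u -> m (fun n => u (n + k)%N) = m u.
Proof.
move=> bu; elim: k => [|k IH]; first by under eq_fun do rewrite addn0.
rewrite -IH -(medial_shift hm (bounded_shift k bu)).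
by congr m; apply/funext => n; rewrite addSnnS.
Qed.

Definition trunc k U : nat -> R := fun n => fine (mine (U n) k%:R%:E).

Lemma truncE k U n : (0 <= U n)%E -> (trunc k U n)%:E = mine (U n) k%:R%:E.
Proof.
move=> U0; rewrite /trunc fineK// ge0_fin_numE ?le_min ?U0 ?lee_fin ?ler0n//.
by rewrite gt_min ltry orbT.
Qed.

Lemma trunc_itv k U n : (0 <= U n)%E -> 0 <= trunc k U n <= k%:R.
Proof.
by move=> U0; rewrite -!lee_fin truncE// le_min U0 lee_fin ler0n/= ge_min lexx orbT.
Qed.

Lemma bounded_trunc k U : (forall n, 0 <= U n)%E -> bounded_fun (trunc k U).
Proof. by move=> U0; apply: (@bounded_itv _ 0 k%:R) => n; exact: trunc_itv. Qed.

(** The truncations are bounded, so only values of the medial limit that its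
    axioms control enter the supremum. *)
Definition mhat U : \bar R := ereal_sup (range (fun k => (m (trunc k U))%:E)).

Lemma trunc_le k l U V n : (0 <= U n)%E -> (U n <= V n)%E -> (k <= l)%N ->
  trunc k U n <= trunc l V n.
Proof.
move=> U0 UV kl; have V0 := le_trans U0 UV.
by rewrite -lee_fin !truncE// le_min !ge_min UV lee_fin ler_nat kl orbT.
Qed.

Lemma medial_trunc_le k l U V : (forall n, 0 <= U n)%E ->
  (forall n, U n <= V n)%E -> (k <= l)%N -> m (trunc k U) <= m (trunc l V).
Proof.
move=> U0 UV kl; apply: medial_le => [||n]; last exact: trunc_le.
- exact: bounded_trunc.
- by apply: bounded_trunc => n; apply: le_trans (UV n).
Qed.

Lemma mhat_ub U k : ((m (trunc k U))%:E <= mhat U)%E.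
Proof. by apply: ereal_sup_ubound; exists k. Qed.

Lemma mhat_cvg U : (forall n, 0 <= U n)%E ->
  (fun k => (m (trunc k U))%:E) @ \oo --> mhat U.
Proof.
move=> U0; apply: ereal_nondecreasing_cvgn => k l kl.
by rewrite lee_fin medial_trunc_le.
Qed.

Lemma mhat_ge0 U : (forall n, 0 <= U n)%E -> (0 <= mhat U)%E.
Proof.
move=> U0; apply: le_trans (mhat_ub U 0); rewrite lee_fin.
by apply: (medial_ge0 hm) => [|n]; [exact: bounded_trunc|case/andP: (trunc_itv 0 (U0 n))].
Qed.

Lemma mhat_le U V : (forall n, 0 <= U n)%E -> (forall n, U n <= V n)%E ->
  (mhat U <= mhat V)%E.
Proof.
move=> U0 UV; apply: ge_ereal_sup => _ [k _ <-].
by apply: le_trans (mhat_ub V k); rewrite lee_fin medial_trunc_le.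
Qed.

Lemma mhat0 : mhat (fun=> 0%E) = 0%E.
Proof.
apply/eqP; rewrite eq_le mhat_ge0// andbT; apply: ge_ereal_sup => _ [k _ <-].
rewrite lee_fin (_ : trunc k _ = fun=> 0) ?medial_cst//.
by apply/funext => n; rewrite /trunc min_l// lee_fin.
Qed.

Lemma medialD u v : bounded_fun u -> bounded_fun v ->
  m (fun n => u n + v n) = m u + m v.
Proof.
move=> bu bv; have := @medial_linear _ _ hm 1 u v bu bv; rewrite mul1r => <-.
by congr m; apply/funext => n; rewrite mul1r.
Qed.

(** Truncation is subadditive, and conversely
    [min(u, k) + min(v, k) <= min(u + v, 2 k)]; the factor two is absorbed by
    the supremum over the level. *)
Lemma mhatD U V : (forall n, 0 <= U n)%E -> (forall n, 0 <= V n)%E ->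
  mhat (fun n => U n + V n)%E = (mhat U + mhat V)%E.
Proof.
move=> U0 V0.
have UV0 n : (0 <= U n + V n)%E by rewrite adde_ge0.
have bD k : bounded_fun (fun n => trunc k U n + trunc k V n).
  apply: (@bounded_itv _ 0 (k%:R + k%:R)) => n.
  by have := trunc_itv k (U0 n); have := trunc_itv k (V0 n); lra.
apply/eqP; rewrite eq_le; apply/andP; split.
  apply: ge_ereal_sup => _ [k _ <-].
  apply: le_trans (leeD (mhat_ub U k) (mhat_ub V k)).
  rewrite -EFinD lee_fin -medialD; [|exact: bounded_trunc..].
  apply: medial_le => [||n]; [exact: bounded_trunc|exact: bD|].
  rewrite -lee_fin EFinD !truncE//.
  have [Uk|kU] := leP (U n) (k%:R%:E); last first.
    by rewrite ge_min leeDl ?orbT// le_min V0 lee_fin ler0n.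
  have [Vk|kV] := leP (V n) (k%:R%:E); first by rewrite ge_min lexx.
  by rewrite ge_min leeDr ?orbT.
have := mhat_cvg U0; have := mhat_cvg V0 => cV cU.
have cUV : (fun k => (m (trunc k U))%:E + (m (trunc k V))%:E)%E @ \oo --> (mhat U + mhat V)%E.
  by apply: cvgeD => //; rewrite ge0_adde_def// inE mhat_ge0.
rewrite -(cvg_lim _ cUV)//; apply: lime_le; first by apply/cvg_ex; eexists; exact: cUV.
near=> k; rewrite -EFinD -medialD; [|exact: bounded_trunc..].
apply: le_trans (mhat_ub _ (k + k)); rewrite lee_fin.
apply: medial_le => [||n]; [exact: bD|exact: bounded_trunc|].
rewrite -lee_fin EFinD !truncE// le_min natrD EFinD.
by apply/andP; split; apply: leeD; rewrite ge_min lexx ?orbT.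
Unshelve. all: by end_near. Qed.

Lemma medialZ c u : bounded_fun u -> m (fun n => c * u n) = c * m u.
Proof.
move=> bu; have b0 : bounded_fun (fun _ : nat => 0 : R).
  by apply: (@bounded_itv _ 0 0) => _; rewrite lexx.
have := @medial_linear _ _ hm c u _ bu b0; rewrite medial_cst addr0 => <-.
by congr m; apply/funext => n; rewrite addr0.
Qed.

(** Levels are rescaled along with the sequence. For [c = 0] the convention
    [0 * oo = 0] agrees with the limit of the zero sequence. *)
Lemma mhatZ c U : 0 <= c -> (forall n, 0 <= U n)%E ->
  mhat (fun n => c%:E * U n)%E = (c%:E * mhat U)%E.
Proof.
move=> c0 U0; have [->|cneq0] := eqVneq c 0.
  by rewrite mul0e -[RHS]mhat0; congr mhat; apply/funext => n; rewrite mul0e.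
have le a V : 0 < a -> (forall n, 0 <= V n)%E ->
    (mhat (fun n => a%:E * V n)%E <= a%:E * mhat V)%E.
  move=> a0 V0; apply: ge_ereal_sup => _ [k _ <-].
  have [l kl] := ex_le_nat (k%:R / a).
  have aV0 n : (0 <= a%:E * V n)%E by rewrite mule_ge0// lee_fin ltW.
  apply: (@le_trans _ _ (a%:E * (m (trunc l V))%:E)%E); last first.
    by rewrite lee_pmul2l// ?mhat_ub// lte_fin.
  rewrite -EFinM lee_fin -medialZ; last exact: bounded_trunc.
  apply: medial_le => [||n]; first exact: bounded_trunc.
    apply: (@bounded_itv _ 0 (a * l%:R)) => n.
    have /andP[h1 h2] := trunc_itv l (V0 n).
    by rewrite mulr_ge0 ?(ltW a0)//= ler_wpM2l// ltW.
  rewrite -lee_fin EFinM !truncE//.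
  have [Vl|lV] := leP (V n) (l%:R%:E); first by rewrite ge_min lexx.
  by rewrite -EFinM ge_min; apply/orP; right; rewrite lee_fin mulrC -ler_pdivrMr.
have c_gt0 : 0 < c by rewrite lt_neqAle eq_sym cneq0.
have cU0 n : (0 <= c%:E * U n)%E by rewrite mule_ge0// lee_fin.
apply/eqP; rewrite eq_le le//=.
have := le c^-1 (fun n => c%:E * U n)%E.
rewrite invr_gt0 => /(_ c_gt0 cU0).
under eq_fun do rewrite muleA -EFinM mulVf// mul1e.
move=> /(@lee_wpmul2l _ c%:E); rewrite lee_fin => /(_ c0).
by rewrite muleA -EFinM divff// mul1e.
Qed.

Lemma mhat_sum (I : Type) (s : seq I) (c : I -> R) (F : I -> nat -> \bar R) :
  (forall i, 0 <= c i) -> (forall i n, 0 <= F i n)%E ->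
  mhat (fun n => \sum_(i <- s) (c i)%:E * F i n)%E =
  (\sum_(i <- s) (c i)%:E * mhat (F i))%E.
Proof.
move=> c0 F0; elim: s => [|i s IH].
  by rewrite big_nil -[RHS]mhat0; congr mhat; apply/funext => n; rewrite big_nil.
rewrite big_cons -IH -mhatZ// -mhatD.
- by congr mhat; apply/funext => n; rewrite big_cons.
- by move=> n; rewrite mule_ge0// lee_fin.
- by move=> n; apply: sume_ge0 => j _; rewrite mule_ge0// lee_fin.
Qed.

Lemma medial_le_eventually u c k : bounded_fun u ->
  (forall n, (k <= n)%N -> u n <= c) -> m u <= c.
Proof.
move=> bu h; rewrite -(medial_shiftn k bu) -[leRHS]medial_cst.
apply: medial_le => [||n]; first exact: bounded_shift.
  by apply: (@bounded_itv _ c c) => _; rewrite lexx.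
by apply: h; rewrite leq_addl.
Qed.

Lemma medial_ge_eventually u c k : bounded_fun u ->
  (forall n, (k <= n)%N -> c <= u n) -> c <= m u.
Proof.
move=> bu h; rewrite -(medial_shiftn k bu) -[leLHS]medial_cst.
apply: medial_le => [||n]; last by apply: h; rewrite leq_addl.
  by apply: (@bounded_itv _ c c) => _; rewrite lexx.
exact: bounded_shift.
Qed.

(** Shift invariance lets a bound that holds from some rank on pass to the
    medial limit. *)
Lemma limn_einf_mhat U : (forall n, 0 <= U n)%E -> (limn_einf U <= mhat U)%E.
Proof.
move=> U0; rewrite limn_einf_lim; apply: lime_le; first exact: is_cvg_einfs.
near=> k; rewrite /einfs.
have I0 : (0 <= ereal_inf (sdrop U k))%E by apply: le_ereal_inf_tmp => _ [n _ <-].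
have main (l : nat) : (mine (ereal_inf (sdrop U k)) l%:R%:E <= mhat U)%E.
  apply: le_trans (mhat_ub U l).
  have := truncE l (n := 0%N) (U := fun=> ereal_inf (sdrop U k)) I0 => <-.
  rewrite lee_fin; apply: (@medial_ge_eventually _ _ k); first exact: bounded_trunc.
  move=> n kn; rewrite -lee_fin !truncE// le_min !ge_min lexx orbT andbT.
  by apply/orP; left; apply: ereal_inf_lbound; exists n.
have [Ey|] := eqVneq (ereal_inf (sdrop U k)) +oo%E; last first.
  rewrite -ltey => Ilt.
  have If : ereal_inf (sdrop U k) \is a fin_num by rewrite ge0_fin_numE.
  have [l Il] := ex_le_nat (fine (ereal_inf (sdrop U k))).
  apply: le_trans (main l).
  by rewrite le_min lexx/= -[leLHS]fineK// lee_fin.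
have Mle (l : nat) : (l%:R%:E <= mhat U)%E by have := main l; rewrite Ey min_r// leey.
suff -> : mhat U = +oo%E by rewrite leey.
apply/eqyP => r r0.
by have [l rl] := ex_le_nat r; apply: le_trans (Mle l).
Unshelve. all: by end_near. Qed.

Lemma mhat_limn_esup U : (forall n, 0 <= U n)%E -> (mhat U <= limn_esup U)%E.
Proof.
move=> U0; rewrite limn_esup_lim; apply: lime_ge; first exact: is_cvg_esups.
near=> k; apply: ge_ereal_sup => _ [l _ <-].
have S0 : (0 <= esups U k)%E.
  by apply: le_trans (U0 k) _; apply: ereal_sup_ubound; exists k => /=.
have [->|] := eqVneq (esups U k) +oo%E; first exact: leey.
rewrite -ltey => Slt.
have Sf : esups U k \is a fin_num by rewrite ge0_fin_numE.
rewrite -[leRHS]fineK// lee_fin.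
apply: (@medial_le_eventually _ _ k); first exact: bounded_trunc.
move=> n kn; rewrite -lee_fin truncE// fineK// ge_min; apply/orP; left.
by apply: ereal_sup_ubound; exists n.
Unshelve. all: by end_near. Qed.

End MedialExtension.

(** * Functions that are Borel up to a null set *)

Section AlmostBorel.
Context (disp : measure_display) (T : measurableType disp) (R : realType).
Implicit Types (m : {measure set T -> \bar R}) (f g : T -> \bar R).

(** For nonnegative functions this amounts to measurability with respect to the
    completion, but a Borel version can be integrated and composed. *)
Definition almost_borel m f :=
  exists2 g, measurable_fun [set: T] g & m.-negligible [set x | f x <> g x].

Definition ratn (n : nat) : R := ratr (odflt 0 (unpickle n)).

Lemma ratn_dense (x y : R) : x < y -> exists n, x < ratn n < y.
Proof.
move=> xy; have [q] := rat_in_itvoo xy; rewrite in_itv/= => xqy.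
by exists (pickle q); rewrite /ratn pickleK.
Qed.

Lemma lte_ratn (x y : \bar R) : (0 <= x)%E -> (x < y)%E ->
  exists n, (x < (ratn n)%:E < y)%E.
Proof.
case: x y => [x||] [y||]// _ xy.
  by have [n nxy] := ratn_dense xy; exists n; rewrite !lte_fin.
have [n /andP[xn _]] : exists n, x < ratn n < x + 1 by apply: ratn_dense; rewrite ltrDl.
by exists n; rewrite lte_fin xn ltry.
Qed.

(** The function is rebuilt from Borel versions of its superlevel sets at
    rational heights, as the supremum of the heights whose version contains the
    point. *)
Lemma completion_almost_borel m f : (forall x, 0 <= f x)%E ->
  (forall B : set (\bar R), measurable B -> completion_measurable m (f @^-1` B)) ->
  almost_borel m f.
Proof.
move=> f0 fm.
have /choice[B hB] : forall k, exists B, measurable B /\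
    m.-negligible ((f @^-1` `](ratn k)%:E, +oo[) `+` B).
  by move=> k; have [B mB nB] := fm _ (emeasurable_itv `](ratn k)%:E, +oo[); exists B.
pose h k := cst ((Num.max 0 (ratn k))%:E : \bar R) \_ (B k).
exists (fun x => ereal_sup (range (h ^~ x))).
  have -> : (fun x => ereal_sup (range (h ^~ x))) = (fun x => esups (h ^~ x) 0%N).
    apply/funext => x; rewrite /esups /sdrop /=; congr ereal_sup.
    by apply/seteqP; split => _ [n _ <-]; exists n.
  apply: measurable_fun_esups => k; rewrite /h.
  by apply/(measurable_restrictT _ _).1; [have [] := hB k|exact: measurable_cst].
apply: (@negligibleS _ _ _ m (\bigcup_k ((f @^-1` `](ratn k)%:E, +oo[) `+` B k))); last first.
  by apply: negligible_bigcup => k; have [] := hB k.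
move=> x /=; apply: contra_notP => nx.
have iff k : B k x <-> ((ratn k)%:E < f x)%E.
  split=> [Bx|fx]; apply: contrapT => H; apply: nx; exists k => //.
    by right; split => //=; rewrite in_itv/= andbT.
  by left; split => //=; rewrite in_itv/= andbT.
apply/eqP; rewrite eq_le; apply/andP; split.
  rewrite leNgt; apply/negP => lt.
  have s0 : (0 <= ereal_sup (range (h ^~ x)))%E.
    apply: le_trans (ereal_sup_ubound (x := h 0%N x) _); last by exists 0%N.
    by rewrite /h patchE; case: ifP => //; rewrite lee_fin le_max lexx.
  have [n /andP[sn nf]] := lte_ratn s0 lt.
  have : (h n x <= ereal_sup (range (h ^~ x)))%E by apply: ereal_sup_ubound; exists n.
  rewrite /h patchE mem_set; last exact/iff.
  move/le_lt_trans => /(_ _ sn); rewrite lte_fin /cst gt_max.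
  by rewrite ltxx andbF.
apply: ge_ereal_sup => _ [k _ <-]; rewrite /h patchE; case: ifPn => //.
by rewrite inE => /iff fk; rewrite /cst EFin_max ge_max f0 ltW.
Qed.

Lemma almost_borel_completion m f : almost_borel m f ->
  forall B : set (\bar R), measurable B -> completion_measurable m (f @^-1` B).
Proof.
move=> [g mg nfg] B mB; exists (g @^-1` B).
  by rewrite -[X in measurable X]setTI; exact: mg.
apply: negligibleS nfg => x /= [] [h1 h2] e; apply: h2; [rewrite -e|rewrite e]; exact: h1.
Qed.

Lemma almost_borel_ge0 m f : (forall x, 0 <= f x)%E -> almost_borel m f ->
  exists g, [/\ measurable_fun [set: T] g, (forall x, 0 <= g x)%E &
    m.-negligible [set x | f x <> g x]].
Proof.
move=> f0 [g mg nfg]; exists (fun x => maxe 0 (g x))%E; split.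
- by apply: measurable_maxe => //; exact: measurable_cst.
- by move=> x; rewrite le_max lexx.
- by apply: negligibleS nfg => x /= h e; apply: h; rewrite -e max_r.
Qed.

Lemma almost_borel_sup m (F : nat -> T -> \bar R) :
  (forall k, almost_borel m (F k)) ->
  almost_borel m (fun x => ereal_sup (range (F ^~ x))).
Proof.
move=> hF; have /choice[G hG] : forall k, exists g, measurable_fun [set: T] g /\
    m.-negligible [set x | F k x <> g x].
  by move=> k; have [g mg ng] := hF k; exists g.
exists (fun x => ereal_sup (range (G ^~ x))).
  have -> : (fun x => ereal_sup (range (G ^~ x))) = (fun x => esups (G ^~ x) 0%N).
    apply/funext => x; rewrite /esups /sdrop /=; congr ereal_sup.
    by apply/seteqP; split => _ [n _ <-]; exists n.
  by apply: measurable_fun_esups => k; have [] := hG k.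
apply: (@negligibleS _ _ _ m (\bigcup_k [set x | F k x <> G k x])); last first.
  by apply: negligible_bigcup => k; have [_] := hG k; exact.
move=> x /=; apply: contra_notP => nx.
suff -> : F ^~ x = G ^~ x by [].
by apply/funext => k; apply: contrapT => h; apply: nx; exists k.
Qed.

Import HBNNSimple.

(** The integral of a nonnegative function, measurable or not, is a supremum
    over its simple minorants, and cutting those off on a null set does not
    change their integrals. *)
Lemma ge0_le_integral_negligible m f g : (forall x, 0 <= f x)%E ->
  (forall x, 0 <= g x)%E -> m.-negligible [set x | ~ (f x <= g x)%E] ->
  (\int[m]_x f x <= \int[m]_x g x)%E.
Proof.
move=> f0 g0 [Z [mZ Z0 hZ]]; rewrite [leLHS]ge0_integralTE//.
apply: ge_ereal_sup => _ [h hf <-].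
have mZC : measurable (~` Z) by exact: measurableC.
pose h' := proj_nnsfun h mZC.
have -> : sintegral m h = sintegral m h'.
  rewrite -!integralT_nnsfun; apply: ge0_ae_eq_integral => //.
  - exact/measurable_EFinP.
  - exact/measurable_EFinP.
  - by move=> x _; rewrite lee_fin.
  - by move=> x _; rewrite lee_fin.
  - exists Z; split => // x /= /not_implyP[_] ne.
    apply: contrapT => nZ; apply: ne; rewrite /h' /= mindicE mem_set//.
    by rewrite mulr1.
rewrite ge0_integralTE//; apply: ereal_sup_ubound; exists h' => //= x.
rewrite /= mindicE; case: (pselect (Z x)) => [Zx|nZ].
  by rewrite memNset ?mulr0//; apply/not_notP.
rewrite mem_set// mulr1; apply: le_trans (hf x) _.
by apply: contrapT => H; apply: nZ; apply: hZ.
Qed.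

Lemma ge0_eq_integral_negligible m f g : (forall x, 0 <= f x)%E ->
  (forall x, 0 <= g x)%E -> m.-negligible [set x | f x <> g x] ->
  (\int[m]_x f x = \int[m]_x g x)%E.
Proof.
move=> f0 g0 fg; apply/eqP; rewrite eq_le.
by rewrite !ge0_le_integral_negligible//; apply: negligibleS fg => x /= h e; apply: h; rewrite e.
Qed.

Lemma ge0_le_integralT m f g : (forall x, 0 <= f x)%E ->
  (forall x, f x <= g x)%E -> (\int[m]_x f x <= \int[m]_x g x)%E.
Proof.
move=> f0 fg; apply: ge0_le_integral_negligible => // [x|].
  exact: le_trans (f0 x) (fg x).
by apply: (negligibleS _ (negligible_set0 m)) => x /=; rewrite fg.
Qed.

End AlmostBorel.

(** * Integrals of medial limits *)

Section Marczewski.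
Context (disp : measure_display) (T : measurableType disp) (R : realType).
Variable E : nat -> set T.
Hypothesis mE : forall k, measurable (E k).

Fixpoint digit_sum (n k : nat) (w : T) : R :=
  if n is n'.+1 then 2 / 3 * \1_(E k) w + digit_sum n' k.+1 w / 3 else 0.

Lemma digit_sum_itv n k w : 0 <= digit_sum n k w <= 1.
Proof.
elim: n k => [|n IH] k /=; first by rewrite lexx ler01.
have /andP[h1 h2] := IH k.+1; rewrite indicE.
by case: (w \in E k); rewrite /= ?mulr1 ?mulr0; apply/andP; split; lra.
Qed.

Lemma digit_sum_nondecreasing k w :
  {homo (fun n => digit_sum n k w) : n p / (n <= p)%N >-> n <= p}.
Proof.
apply/nondecreasing_seqP => n; elim: n k => [|n IH] k.
  by have /andP[] := digit_sum_itv 1 k w.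
by have := IH k.+1; rewrite /=; lra.
Qed.

Lemma measurable_digit_sum n k : measurable_fun [set: T] (digit_sum n k).
Proof.
elim: n k => [|n IH] k /=; first exact: measurable_cst.
by apply: measurable_funD; apply: measurable_funM => //; exact: measurable_indic.
Qed.

Lemma is_cvg_digit_sum k w : cvgn (fun n => digit_sum n k w).
Proof.
apply: nondecreasing_is_cvgn; first exact: digit_sum_nondecreasing.
by exists 1 => _ [n _ <-]; have /andP[] := digit_sum_itv n k w.
Qed.

Definition marczewski k w := limn (fun n => digit_sum n k w).

Lemma marczewski_itv k w : 0 <= marczewski k w <= 1.
Proof.
apply/andP; split; [apply: limr_ge|apply: limr_le];
  try exact: is_cvg_digit_sum; apply: nearW => n;
  by have /andP[] := digit_sum_itv n k w.
Qed.

Lemma measurable_marczewski k : measurable_fun [set: T] (marczewski k).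
Proof.
apply: (@measurable_fun_cvg _ _ _ _ (fun n w => digit_sum n k w)) => [n|w _].
  exact: measurable_digit_sum.
exact: is_cvg_digit_sum.
Qed.

Lemma marczewskiS k w :
  marczewski k w = 2 / 3 * \1_(E k) w + marczewski k.+1 w / 3.
Proof.
apply/cvg_lim => //; rewrite -cvg_shiftS /=.
by apply: cvgD; [exact: cvg_cst|apply: cvgMl; exact: is_cvg_digit_sum].
Qed.

Definition next_digit (t : R) : R := 3 * t - (if 1 / 2 <= t then 2 else 0).

Lemma marczewskiP k w : E k w <-> 1 / 2 <= marczewski k w.
Proof.
rewrite marczewskiS indicE; have /andP[h1 h2] := marczewski_itv k.+1 w.
split=> [Ew|]; first by rewrite mem_set// mulr1; lra.
by apply: contraPP => Ew; rewrite memNset// mulr0 => ?; lra.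
Qed.

Lemma next_digitE k w : next_digit (marczewski k w) = marczewski k.+1 w.
Proof.
have [mp pm] := marczewskiP k w.
rewrite /next_digit; case: ifPn => [/pm Ew|].
  by rewrite marczewskiS indicE mem_set//= mulr1; lra.
move=> /negP nm; have nE : ~ E k w by move/mp.
by rewrite marczewskiS indicE memNset//= mulr0; lra.
Qed.

Lemma measurable_next_digit : measurable_fun [set: R] next_digit.
Proof.
apply: measurable_funB; first exact: measurable_funM.
apply: measurable_fun_if => //; [|exact: measurable_cst..].
by apply: measurable_fun_ler => //; exact: measurable_cst.
Qed.

(** The Marczewski function packs countably many sets into one real number:
    membership in the k-th set is the k-th ternary digit. *)
Lemma exists_marczewski : exists (phi : T -> R) (B : nat -> set R),
  [/\ measurable_fun [set: T] phi, forall w, 0 <= phi w <= 1,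
      forall k, measurable (B k) & forall k w, E k w <-> B k (phi w)].
Proof.
exists (marczewski 0), (fun k => [set t | 1 / 2 <= iter k next_digit t]).
split.
- exact: measurable_marczewski.
- exact: marczewski_itv.
- move=> k; have mi : measurable_fun [set: R] (iter k next_digit).
    elim: k => [|k IH]; first exact: measurable_id.
    exact: (measurableT_comp measurable_next_digit).
  rewrite -[X in measurable X]setTI.
  have := mi measurableT `[1 / 2, +oo[%classic (measurable_itv _).
  by congr (measurable (_ `&` _)); apply/seteqP; split => t /=; rewrite in_itv/= andbT.
- move=> k w; rewrite [X in _ <-> X]/mkset; have -> : iter k next_digit (marczewski 0 w) = marczewski k w.
    by elim: k => //= k ->; rewrite next_digitE.
  exact: marczewskiP.
Qed.

End Marczewski.

(** The superlevel sets of all the functions at all rational heights are packed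
    into one Marczewski function, from which each function is recovered as a
    supremum of heights. *)
Lemma common_factor (disp : measure_display) (T : measurableType disp)
    (R : realType) (F : nat -> T -> R) :
  (forall n, measurable_fun [set: T] (F n)) ->
  (forall n w, 0 <= F n w <= 1) ->
  exists (phi : T -> R) (h : nat -> R -> R),
    [/\ measurable_fun [set: T] phi, forall w, 0 <= phi w <= 1,
        forall n, measurable_fun [set: R] (h n),
        forall n t, 0 <= h n t <= 1 & forall n w, F n w = h n (phi w)].
Proof.
move=> mF F01.
(* Indices that encode no pair repeat the pair (0, 0), which is harmless. *)
pose dec k : nat * nat := odflt (0, 0)%N (unpickle k).
pose E k := [set w | ratn R (dec k).2 < F (dec k).1 w].
have mE k : measurable (E k).
  rewrite -[X in measurable X]setTI.
  have := mF (dec k).1 measurableT `](ratn R (dec k).2), +oo[%classic (measurable_itv _).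
  by congr (measurable (_ `&` _)); apply/seteqP; split => t /=; rewrite in_itv/= andbT.
have [phi [B [mphi phi01 mB EB]]] := @exists_marczewski _ _ R _ mE.
pose c j : R := Num.min 1 (Num.max 0 (ratn R j)).
have c01 j : 0 <= c j <= 1 by rewrite /c le_min ge_min le_max !lexx ler01.
pose H (n j : nat) : R -> R := cst (c j) \_ (B (pickle (n, j))).
have H01 n j t : 0 <= H n j t <= 1.
  by rewrite /H patchE; case: ifP => _; rewrite ?lexx ?ler01//; exact: c01.
have ubH n t : has_ubound (range (H n ^~ t)).
  by exists 1 => _ [j _ <-]; have /andP[] := H01 n j t.
have supH n t : has_sup (range (H n ^~ t)) by split => //; exists (H n 0%N t), 0%N.
have Eq n j w : B (pickle (n, j)) (phi w) <-> ratn R j < F n w.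
  by have := EB (pickle (n, j)) w; rewrite /E /dec /= pickleK/= => <-.
exists phi, (fun n t => sup (range (H n ^~ t))); split => //.
- move=> n; have -> : (fun t => sup (range (H n ^~ t))) = (fun t => sups (H n ^~ t) 0%N).
    apply/funext => t; rewrite /sups /sdrop /=; congr (sup _).
    by apply/seteqP; split => _ [j _ <-]; exists j.
  apply: measurable_fun_sups => [t _|j]; first exact: ubH.
  by apply/(measurable_restrictT _ _).1; [exact: mB|exact: measurable_cst].
- move=> n t; apply/andP; split.
    have : H n 0%N t <= sup (range (H n ^~ t)) by apply: ub_le_sup => //; exists 0%N.
    by apply: le_trans; have /andP[] := H01 n 0%N t.
  apply: ge_sup; first by exists (H n 0%N t), 0%N.
  by move=> _ [j _ <-]; have /andP[] := H01 n j t.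
- move=> n w; have /andP[F0 F1] := F01 n w.
  apply/eqP; rewrite eq_le; apply/andP; split.
    rewrite leNgt; apply/negP => lt.
    have [j /andP[sj jF]] := ratn_dense lt.
    have : H n j (phi w) <= sup (range (H n ^~ (phi w))).
      by apply: ub_le_sup => //; exists j.
    rewrite /H patchE mem_set; last exact/Eq.
    move/le_lt_trans => /(_ _ sj); rewrite /cst /c gt_min gt_max ltxx andbF orbF.
    by move=> ?; lra.
  apply: ge_sup; first by exists (H n 0%N (phi w)), 0%N.
  move=> _ [j _ <-]; rewrite /H patchE; case: ifPn => //.
  by rewrite inE => /Eq jF; rewrite /cst /c ge_min ge_max F0 (ltW jF) orbT.
Qed.

Section MedialIntegral.
Context (disp : measure_display) (T : measurableType disp) (R : realType).
Variables (P : probability T R) (m : (nat -> R) -> R) (hm : medial_limit m).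

Lemma completion_measurableU (d' : measure_display) (T' : measurableType d')
    (mu : {measure set T' -> \bar R}) (A B : set T') :
  completion_measurable mu A -> completion_measurable mu B ->
  completion_measurable mu (A `|` B).
Proof.
move=> [A' mA nA] [B' mB nB]; exists (A' `|` B'); first exact: measurableU.
apply: negligibleS (negligibleU nA nB) => x /= [].
  by move=> [[Ax|Bx] /not_orP[nA' nB']]; [left; left|right; left].
by move=> [[Ax|Bx] /not_orP[nA' nB']]; [left; right|right; right].
Qed.

Lemma completion_measurable_measurable (d' : measure_display) (T' : measurableType d')
    (mu : {measure set T' -> \bar R}) (A : set T') :
  measurable A -> completion_measurable mu A.
Proof. by move=> mA; exists A => //; rewrite setYK; exact: negligible_set0. Qed.

(** The law of a common factor is a measure on the unit interval, where the
    medial limit commutes with integration; a Borel version of the limit there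
    is pulled back along the factor. *)
Lemma medial_unit_integral (F : nat -> T -> R) :
  (forall n, measurable_fun [set: T] (F n)) ->
  (forall n w, 0 <= F n w <= 1) ->
  almost_borel P (fun w => (m (F ^~ w))%:E) /\
  (\int[P]_w (m (F ^~ w))%:E = (m (fun n => fine (\int[P]_w (F n w)%:E)))%:E)%E.
Proof.
move=> mF F01; have [phi [h [mphi phi01 mh h01 Fh]]] := common_factor mF F01.
pose X : {mfun T >-> R} := HB.pack phi (isMeasurableFun.Build _ _ _ _ phi mphi).
pose l : probability R R := distribution P X.
have mI : measurable (`[0, 1]%classic : set R) by exact: measurable_itv.
have bh t : bounded_fun (h ^~ t) by apply: (@bounded_itv _ _ 0 1) => n; exact: h01.
have mh01 t : 0 <= m (h ^~ t) <= 1.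
  apply/andP; split; first by apply: (medial_ge0 hm) => // n; have /andP[] := h01 n t.
  rewrite -(medial_cst hm 1); apply: (medial_le hm) => // [|n].
    by apply: (@bounded_itv _ _ 1 1) => _; rewrite lexx.
  by have /andP[] := h01 n t.
have [cm intm] := @medial_integral _ _ hm l h
  (fun n => measurable_funS measurableT (@subsetT _ _) (mh n)) (fun n t _ => h01 n t).
pose g0 := (fun t => (m (h ^~ t))%:E) \_ (`[0, 1]%classic : set R).
have g0ge0 t : (0 <= g0 t)%E.
  by rewrite /g0 patchE; case: ifP => // _; rewrite lee_fin; have /andP[] := mh01 t.
have [G [mG G0 nG]] : exists G, [/\ measurable_fun [set: R] G,
    (forall x, 0 <= G x)%E & l.-negligible [set x | g0 x <> G x]].
  apply: almost_borel_ge0 => //; apply: completion_almost_borel => // B mB.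
  have -> : g0 @^-1` B = (`[0, 1]%classic `&` [set x | (EFin @^-1` B) (m (h ^~ x))])
      `|` ((~` `[0, 1]%classic) `&` [set _ | B 0%E]).
    apply/seteqP; split => t /=; rewrite /g0 patchE.
      by case: ifPn; rewrite ?inE ?notin_setE => It Bt; [left|right].
    by case=> -[It Bt]; [rewrite mem_set|rewrite memNset].
  apply: completion_measurableU.
    by apply: cm; rewrite -[X in measurable X]setTI; apply: EFin_measurable.
  apply: completion_measurable_measurable; apply: measurableI; first exact: measurableC.
  have [B0|nB0] := pselect (B 0%E).
    by rewrite (_ : mkset _ = setT)//; apply/seteqP; split.
  by rewrite (_ : mkset _ = set0)//; apply/seteqP; split.
have negl : P.-negligible [set w | (m (F ^~ w))%:E <> (G \o phi) w].
  have [Z [mZ Z0 hZ]] := nG; exists (phi @^-1` Z); split => //.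
    by rewrite -[X in measurable X]setTI; exact: (mphi measurableT).
  move=> w /= ne; apply: hZ => /= e; apply: ne; rewrite -e /g0 patchE mem_set/=.
    by congr ((m _)%:E); apply/funext => n; rewrite Fh.
  by rewrite in_itv/= phi01.
have mGphi : measurable_fun [set: T] (G \o phi) by exact: measurableT_comp.
split; first by exists (G \o phi).
have mF0 w : (0 <= (m (F ^~ w))%:E)%E.
  rewrite (_ : F ^~ w = h ^~ (phi w)); last by apply/funext => n; rewrite Fh.
  by rewrite lee_fin; have /andP[] := mh01 (phi w).
rewrite (@ge0_eq_integral_negligible _ _ _ P _ (G \o phi))//; last first.
  by move=> w; exact: G0.
have -> : (\int[P]_w (G \o phi) w = \int[l]_t G t)%E.
  by rewrite /l /distribution ge0_integral_pushforward.
rewrite -(@ge0_eq_integral_negligible _ _ _ l g0 G)// /g0 -integral_mkcond.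
have fin : (\int[l]_(x in `[0%R, 1%R]) (m (h^~ x))%:E \is a fin_num)%E.
  rewrite ge0_fin_numE; last first.
    by apply: integral_ge0 => t _; rewrite lee_fin; have /andP[] := mh01 t.
  rewrite integral_mkcond.
  apply: (@le_lt_trans _ _ (\int[l]_t (cst 1%E t))%E).
    apply: ge0_le_integralT => // t; rewrite patchE; case: ifP => _ //.
    by rewrite lee_fin; have /andP[] := mh01 t.
  rewrite integral_cst// mul1e (_ : _ setT = 1%E) ?ltry//.
  exact: (@probability_setT _ _ _ l).
rewrite -(fineK fin); congr (_%:E).
rewrite -[LHS]/(\int[l]_(x in `[0%R, 1%R]) m (h^~ x)) intm; congr m.
apply/funext => n; rewrite /Rintegral; congr fine.
rewrite (ge0_integral_pushforward mphi)//.
- rewrite (_ : phi @^-1` _ = setT).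
    by apply: eq_integral => w _ /=; rewrite Fh.
  by apply/seteqP; split => w //= _; rewrite in_itv/= phi01.
- by apply/measurable_EFinP; apply: measurable_funS (mh n).
- by move=> t _; rewrite lee_fin; have /andP[] := h01 n t.
Qed.

(** Almost Borel functions are replaced by Borel versions outside one null set
    common to the whole sequence, which does not change the medial limit. *)
Lemma medial_bounded_integral (F : nat -> T -> R) (c : R) : 0 < c ->
  (forall n, almost_borel P (fun w => (F n w)%:E)) ->
  (forall n w, 0 <= F n w <= c) ->
  almost_borel P (fun w => (m (F ^~ w))%:E) /\
  (\int[P]_w (m (F ^~ w))%:E = (m (fun n => fine (\int[P]_w (F n w)%:E)))%:E)%E.
Proof.
move=> c0 bF F0c.
have F0 n w : (0 <= (F n w)%:E)%E by rewrite lee_fin; have /andP[] := F0c n w.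
have /choice[g hg] n := almost_borel_ge0 (F0 n) (bF n).
pose G n w := Num.min 1 (fine (g n w) / c).
have mG n : measurable_fun [set: T] (G n).
  have [mg _ _] := hg n.
  apply: measurable_minr; first exact: measurable_cst.
  by apply: measurable_funM => //; apply: measurableT_comp => //; exact: fine_measurable.
have G01 n w : 0 <= G n w <= 1.
  have [_ g0 _] := hg n.
  by rewrite /G le_min ge_min lexx ler01 /= andbT divr_ge0 ?fine_ge0 ?g0// ltW.
have [bm im] := medial_unit_integral mG G01.
pose Z := \bigcup_n [set w | (F n w)%:E <> g n w].
have nZ : P.-negligible Z by apply: negligible_bigcup => n; have [_ _] := hg n; exact.
have FG w : ~ Z w -> forall n, F n w = c * G n w.
  move=> nZw n; have e : (F n w)%:E = g n w.
    by apply: contrapT => ne; apply: nZw; exists n.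
  rewrite /G -e /= min_r; first by rewrite mulrCA divff ?mulr1// gt_eqF.
  by rewrite ler_pdivrMr// mul1r; have /andP[] := F0c n w.
have bG w : bounded_fun (G ^~ w) by apply: (@bounded_itv _ _ 0 1) => n; exact: G01.
have mFG w : ~ Z w -> m (F ^~ w) = c * m (G ^~ w).
  by move=> nZw; rewrite -(medialZ hm)//; congr m; apply/funext => n; exact: FG.
have [G' mG' nG'] := bm.
have neglF : P.-negligible [set w | (m (F ^~ w))%:E <> (c * m (G ^~ w))%:E].
  by apply: negligibleS nZ => w /= ne; apply: contrapT => /mFG e; apply: ne; rewrite e.
split.
  exists (fun w => c%:E * G' w)%E; first exact: measurable_funeM.
  apply: negligibleS (negligibleU nZ nG') => w /= ne.
  apply: contrapT => /not_orP[nZw /contrapT nGw]; apply: ne.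
  by rewrite mFG// EFinM nGw.
have m0 (u : nat -> R) a : (forall n, 0 <= u n <= a) -> (0 <= (m u)%:E)%E.
  move=> u0; rewrite lee_fin; apply: (medial_ge0 hm) => [|n].
    exact: (@bounded_itv _ _ 0 a).
  by have /andP[] := u0 n.
have mG0 w : (0 <= (m (G ^~ w))%:E)%E by apply: (m0 _ 1) => n; exact: G01.
have mF0 w : (0 <= (m (F ^~ w))%:E)%E by apply: (m0 _ c) => n; exact: F0c.
rewrite (ge0_eq_integral_negligible _ _ neglF)//; last first.
  by move=> w; rewrite EFinM mule_ge0// lee_fin ltW.
have cint (f : T -> R) : (forall w, 0 <= f w)%R -> almost_borel P (fun w => (f w)%:E) ->
    (\int[P]_w (c * f w)%:E = c%:E * \int[P]_w (f w)%:E)%E.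
  move=> f0 bf; have f0' w : (0 <= (f w)%:E)%E by rewrite lee_fin.
  have [f' [mf' f'0 nf']] := almost_borel_ge0 f0' bf.
  rewrite (ge0_eq_integral_negligible f0' f'0 nf') -ge0_integralZl//; last by rewrite lee_fin ltW.
  apply: ge0_eq_integral_negligible.
  - by move=> w; rewrite EFinM mule_ge0// lee_fin ltW.
  - by move=> w; rewrite mule_ge0// lee_fin ltW.
  - by apply: negligibleS nf' => w /= ne e; apply: ne; rewrite EFinM e.
rewrite cint//.
have Gle1 n : (0 <= \int[P]_w (G n w)%:E <= 1)%E.
  apply/andP; split; first by apply: integral_ge0 => w _; rewrite lee_fin; have /andP[] := G01 n w.
  apply: (@le_trans _ _ (\int[P]_t (cst 1%E t))%E).
    by apply: ge0_le_integralT => w; rewrite lee_fin; have /andP[] := G01 n w.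
  by rewrite integral_cst// mul1e probability_le1.
have Gfin n : (\int[P]_w (G n w)%:E)%E \is a fin_num.
  have /andP[h0 h1] := Gle1 n; rewrite ge0_fin_numE//.
  exact: le_lt_trans h1 (ltry _).
rewrite im -EFinM -(medialZ hm); last first.
  by apply: (@bounded_itv _ _ 0 1) => n; rewrite -!lee_fin fineK.
congr ((m _)%:E); apply/funext => n.
rewrite -[c in LHS]/(fine c%:E) -fineM// -cint.
- congr fine; apply: ge0_eq_integral_negligible => //.
    by move=> w; rewrite EFinM mule_ge0// lee_fin ?(ltW c0)//; have /andP[] := G01 n w.
  by apply: negligibleS nZ => w /= ne; apply: contrapT => /FG e; apply: ne; rewrite e.
- by move=> w; have /andP[] := G01 n w.
- exists (fun w => (G n w)%:E); first exact/measurable_EFinP.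
  by apply: (negligibleS _ (negligible_set0 P)) => w /=.
Qed.

End MedialIntegral.

Section MedialFatou.
Context (disp : measure_display) (T : measurableType disp) (R : realType).
Variables (P : probability T R) (m : (nat -> R) -> R) (hm : medial_limit m).
Variable theta : nat -> T -> \bar R.
Hypothesis theta0 : forall n w, (0 <= theta n w)%E.
Hypothesis btheta : forall n, almost_borel P (theta n).

Lemma almost_borel_trunc k n :
  almost_borel P (fun w => (trunc k (theta ^~ w) n)%:E).
Proof.
have [g mg ng] := btheta n; exists (fun w => mine (g w) k%:R%:E).
  by apply: measurable_mine => //; exact: measurable_cst.
apply: negligibleS ng => w /= ne e; apply: ne.
by rewrite truncE// e.
Qed.

Lemma almost_borel_mhat : almost_borel P (fun w => mhat m (theta ^~ w)).
Proof.
apply: almost_borel_sup => k.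
apply: (medial_bounded_integral hm (c := k.+1%:R) _ (almost_borel_trunc k) _).1 => // n w.
have /andP[-> h] := @trunc_itv R k (theta ^~ w) n (theta0 n w).
by rewrite (le_trans h)// ler_nat.
Qed.

(** The limits of the truncations increase to the extended limit. Their Borel
    versions do so off a null set; once cut off there, monotone convergence
    applies. The inequality comes from
    [int min(theta_n, k) <= min(int theta_n, k)]. *)
Lemma integral_mhat_le :
  (\int[P]_w mhat m (theta ^~ w) <= mhat m (fun n => \int[P]_w theta n w))%E.
Proof.
pose tk k w := (m (trunc k (theta ^~ w)))%:E : \bar R.
have tk01 k n w : 0 <= trunc k (theta ^~ w) n <= k.+1%:R.
  have /andP[-> h] := @trunc_itv R k (theta ^~ w) n (theta0 n w).
  by rewrite (le_trans h)// ler_nat.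
have htk k := medial_bounded_integral hm (ltr0Sn R k) (almost_borel_trunc k) (tk01 k).
have tk0 k w : (0 <= tk k w)%E.
  rewrite lee_fin; apply: (medial_ge0 hm) => [|n]; first exact: bounded_trunc.
  by have /andP[] := @trunc_itv R k (theta ^~ w) n (theta0 n w).
have /choice[g hg] k := almost_borel_ge0 (tk0 k) (htk k).1.
have [Z [mZ Z0 hZ]] : P.-negligible (\bigcup_k [set w | tk k w <> g k w]).
  by apply: negligible_bigcup => k; have [_ _] := hg k; exact.
have tkg k w : ~ Z w -> tk k w = g k w.
  by move=> nZ; apply: contrapT => ne; apply: nZ; apply: hZ; exists k.
pose G k := g k \_ (~` Z).
have mG k : measurable_fun [set: T] (G k).
  have [mg _ _] := hg k.
  apply/(measurable_restrictT _ _).1; first exact: measurableC.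
  exact: measurable_funS mg.
have G0 k w : (0 <= G k w)%E.
  by have [_ g0 _] := hg k; rewrite /G patchE; case: ifP.
have Gnd w : nondecreasing_seq (G ^~ w).
  move=> k l kl; rewrite /G !patchE; case: ifPn => //; rewrite inE => nZ.
  by rewrite -!tkg// lee_fin; apply: medial_trunc_le.
have Glim w : ~ Z w -> limn (G ^~ w) = mhat m (theta ^~ w).
  move=> nZ; apply/cvg_lim => //.
  have := @mhat_cvg _ _ hm (theta ^~ w) (fun n => theta0 n w).
  apply: cvg_trans; apply: near_eq_cvg; apply: nearW => k.
  by rewrite /G patchE mem_set// -tkg.
have limG0 w : (0 <= limn (G ^~ w))%E.
  by apply: lime_ge; [exact: ereal_nondecreasing_is_cvgn|apply: nearW => k; exact: G0].
have nZZ : P.-negligible Z by exists Z; split.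
have -> : (\int[P]_w mhat m (theta ^~ w) = \int[P]_w limn (G ^~ w))%E.
  apply: ge0_eq_integral_negligible => // [w|]; first exact: mhat_ge0.
  by apply: negligibleS nZZ => w /= ne; apply: contrapT => /Glim e; apply: ne.
rewrite monotone_convergence//.
apply: lime_le.
  apply: ereal_nondecreasing_is_cvgn => k l kl; apply: ge0_le_integralT => // w.
  exact: Gnd.
apply: nearW => k.
have -> : (\int[P]_w G k w = \int[P]_w tk k w)%E.
  apply: ge0_eq_integral_negligible => //.
  apply: negligibleS nZZ => w /= ne; apply: contrapT => nZ; apply: ne.
  by rewrite /G patchE mem_set// tkg.
rewrite (htk k).2; apply: le_trans (mhat_ub _ _ k); rewrite lee_fin.
have int0 n : (0 <= \int[P]_w theta n w)%E by exact: integral_ge0.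
have itr0 n : (0 <= \int[P]_w (trunc k (theta^~ w) n)%:E)%E.
  by apply: integral_ge0 => w _; rewrite lee_fin; have /andP[] := @trunc_itv R k (theta ^~ w) n (theta0 n w).
have itrk n : (\int[P]_w (trunc k (theta^~ w) n)%:E <= k%:R%:E)%E.
  apply: (@le_trans _ _ (\int[P]_t (cst k%:R%:E t))%E).
    by apply: ge0_le_integralT => w; rewrite lee_fin; have /andP[] := @trunc_itv R k (theta ^~ w) n (theta0 n w).
  rewrite integral_cst//.
  by rewrite -[leRHS]mule1 lee_wpmul2l ?lee_fin ?ler0n// probability_le1.
have itrf n : (\int[P]_w (trunc k (theta^~ w) n)%:E \is a fin_num)%E.
  by rewrite ge0_fin_numE//; exact: le_lt_trans (itrk n) (ltry _).
apply: (medial_le hm) => [||n].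
- by apply: (@bounded_itv _ _ 0 k%:R) => n; rewrite -!lee_fin fineK// itr0 itrk.
- exact: bounded_trunc.
rewrite -lee_fin fineK// truncE// le_min itrk andbT.
apply: ge0_le_integralT => w.
  by rewrite lee_fin; have /andP[] := @trunc_itv R k (theta ^~ w) n (theta0 n w).
by rewrite truncE// ge_min lexx.
Qed.

End MedialFatou.

(** * Convex sets and their relative interiors *)

Section RowVectors.
Context (R : realType) (d : nat).
Local Notation V := 'rV[R]_d.

Lemma le_coord_norm (v : V) i : `|v 0 i| <= `|v|.
Proof.
have /mapP[j Hj ->] : `|v ord0 i| \in [seq `|v x.1 x.2| | x : 'I_1 * 'I_d].
  by apply/mapP; exists (ord0, i) => //=; rewrite mem_enum.
by rewrite [leRHS]/Num.norm /= mx_normrE; apply/bigmax_geP; right => /=; exists j.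
Qed.

Lemma linear_bound (W : normedModType R) (f : V -> W) :
  (forall a u v, f (a *: u + v) = a *: f u + f v) ->
  exists2 C : R, 0 < C & forall v, `|f v| <= C * `|v|.
Proof.
move=> lin; have f0 : f 0 = 0.
  by have /eqP := lin 1 0 0; rewrite !scale1r add0r -subr_eq0 opprD addrA subrr sub0r oppr_eq0 => /eqP.
have fS (s : seq 'I_d) (c : 'I_d -> R) (e : 'I_d -> V) :
    f (\sum_(j <- s) c j *: e j) = \sum_(j <- s) c j *: f (e j).
  by elim: s => [|j s IH]; rewrite ?big_nil// !big_cons lin IH.
exists (1 + \sum_j `|f (delta_mx 0 j)|).
  by apply: ltr_pwDl => //; apply: sumr_ge0.
move=> v; rewrite [in leLHS](row_sum_delta v) fS.
apply: le_trans (ler_norm_sum _ _ _) _.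
rewrite mulrDl mul1r mulr_suml -[leLHS]add0r; apply: lerD => //.
by apply: ler_sum => j _; rewrite normrZ mulrC ler_wpM2l// le_coord_norm.
Qed.

Lemma closure_ballP (A : set V) x :
  closure A x <-> forall e, 0 < e -> exists2 y, A y & `|x - y| < e.
Proof.
split=> [clA e e0|h B /nbhs_ballP[e /= e0 eB]].
  have [y [Ay xy]] := clA _ (nbhsx_ballx x e e0).
  by exists y => //; move: xy; rewrite -ball_normE.
have [y Ay xy] := h e e0; exists y; split => //; apply: eB.
by rewrite -ball_normE.
Qed.

Lemma near_ballP (Q : V -> Prop) x :
  (\forall y \near x, Q y) <-> exists2 e, 0 < e & forall y, `|x - y| < e -> Q y.
Proof.
split=> [/nbhs_ballP[e /= e0 eB]|[e e0 eB]].
  by exists e => // y xy; apply: eB; rewrite -ball_normE.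
by apply/nbhs_ballP; exists e => //= y; rewrite -ball_normE => /eB.
Qed.

(** The residual of the projection is linear, hence Lipschitz, and vanishes on
    the subspace. *)
Lemma vspace_closed (U : {vspace V}) x :
  (forall e, 0 < e -> exists2 y, y \in U & `|x - y| < e) -> x \in U.
Proof.
move=> h; pose f v : V := v - projv U v.
have lin a u v : f (a *: u + v) = a *: f u + f v.
  by rewrite /f linearP scalerBr opprD addrACA.
have [C C0 fC] := linear_bound lin.
suff : f x = 0 by move/eqP; rewrite subr_eq0 => /eqP ->; exact: memv_proj.
apply/eqP; rewrite -normr_le0; apply/ler_addgt0Pl => e e0; rewrite addr0.
have [y yU xy] := h (e / C) (divr_gt0 e0 C0).
have -> : f x = f (x - y).
  by have := lin (-1) y x; rewrite !scaleN1r addrC => ->; rewrite {2}/f projv_id// subrr oppr0 add0r.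
by apply: le_trans (fC _) _; rewrite mulrC -ler_pdivlMr// ltW.
Qed.

Section ConvexSets.
Implicit Type A : set V.

Lemma convex_set2 A x y (t : R) : @convex_set R V A -> A x -> A y ->
  0 <= t <= 1 -> A (t *: x + (1 - t) *: y).
Proof.
move=> cA Ax Ay /andP[t0 t1].
by have := cA x y (Itv01 t0 t1) (mem_set Ax) (mem_set Ay); rewrite inE.
Qed.

Lemma mk_convex_set A :
  (forall x y (t : R), A x -> A y -> 0 <= t <= 1 -> A (t *: x + (1 - t) *: y)) ->
  @convex_set R V A.
Proof.
move=> h x y l; rewrite !inE => Ax Ay; apply: h => //.
by apply/andP; split.
Qed.

(** By induction on the number of points, for positive combinations divided by
    their total weight: the weights of a sub-family do not sum to one. *)
Lemma convex_comb A (n : nat) (a : 'I_n -> V) (t : 'I_n -> R) :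
  @convex_set R V A -> (forall i, A (a i)) -> (forall i, 0 <= t i) ->
  \sum_i t i = 1 -> A (\sum_i t i *: a i).
Proof.
move=> cA; suff main : forall n (a : 'I_n -> V) (t : 'I_n -> R),
    (forall i, A (a i)) -> (forall i, 0 <= t i) -> 0 < \sum_i t i ->
    A ((\sum_i t i)^-1 *: \sum_i t i *: a i).
  by move=> Aa t0 t1; have := main _ _ _ Aa t0; rewrite t1 invr1 scale1r; exact.
elim=> {n a t} [|n IH] a t Aa t0; first by rewrite big_ord0 ltxx.
rewrite !big_ord_recr /=; set s := \sum_(i < n) _ => s_gt0; set v := \sum_(i < n) _ *: _.
have s0 : 0 <= s by apply: sumr_ge0.
have [sE|sn] := eqVneq s 0.
  rewrite /v big1 ?add0r; last first.
    move=> i _; have := psumr_eq0P (fun i _ => t0 (widen_ord (leqnSn n) i)) sE.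
    by move=> /(_ i isT) ->; rewrite scale0r.
  move: s_gt0; rewrite sE add0r => tn.
  by rewrite scalerA mulVf ?scale1r// gt_eqF.
have {}sn : 0 < s by rewrite lt_neqAle eq_sym sn.
have As : A (s^-1 *: v) by apply: IH.
have tn := t0 ord_max.
have -> : (s + t ord_max)^-1 *: (v + t ord_max *: a ord_max) =
    (s / (s + t ord_max)) *: (s^-1 *: v) + (1 - s / (s + t ord_max)) *: a ord_max.
  have -> : 1 - s / (s + t ord_max) = (s + t ord_max)^-1 * t ord_max.
    by rewrite [_^-1 * _]mulrC; apply/eqP; rewrite subr_eq -mulrDl addrC divff// gt_eqF.
  by rewrite scalerDr !scalerA mulrAC divff ?gt_eqF// mul1r.
apply: convex_set2 => //; apply/andP; split.
  by apply: divr_ge0 => //; exact: ltW.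
by rewrite ler_pdivrMr// mul1r; lra.
Qed.

Definition convex_combinations A : set V := [set x |
  exists (n : nat) (a : 'I_n -> V) (t : 'I_n -> R),
    [/\ forall i, A (a i), forall i, 0 <= t i, \sum_i t i = 1 & x = \sum_i t i *: a i]].

Lemma convex_hull_combinations A : convex_hull A `<=` convex_combinations A.
Proof.
apply: smallest_sub; last first.
  move=> x Ax; exists 1%N, (fun=> x), (fun=> 1); split => //; first by rewrite big_ord1.
  by rewrite big_ord1 scale1r.
apply: mk_convex_set => _ _ t [n [a [s [Aa s0 s1 ->]]]] [p [b [r [Ab r0 r1 ->]]]] /andP[t0 t1].
pose f X (u : 'I_n -> X) (v : 'I_p -> X) (i : 'I_(n + p)) : X :=
  match fintype.split i with inl j => u j | inr j => v j end.
have fl X u v j : @f X u v (lshift p j) = u j.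
  by rewrite /f -[lshift p j]/(unsplit (inl j)) unsplitK.
have fr X u v j : @f X u v (rshift n j) = v j.
  by rewrite /f -[rshift n j]/(unsplit (inr j)) unsplitK.
exists (n + p)%N, (f _ a b), (f _ (fun i => t * s i) (fun j => (1 - t) * r j)); split.
- by move=> i; rewrite /f; case: (fintype.split i).
- by move=> i; rewrite /f; case: (fintype.split i) => j; apply: mulr_ge0 => //; lra.
- rewrite big_split_ord /=; under eq_bigr do rewrite fl.
  under [X in _ + X]eq_bigr do rewrite fr.
  by rewrite -!mulr_sumr s1 r1; lra.
- rewrite big_split_ord /= !scaler_sumr; congr (_ + _).
    by apply: eq_bigr => i _; rewrite !fl scalerA.
  by apply: eq_bigr => i _; rewrite !fr scalerA.
Qed.

Lemma sub_convex_hull A : A `<=` convex_hull A.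
Proof. exact: sub_smallest. Qed.

Lemma convex_hull_convex A : @convex_set R V (convex_hull A).
Proof.
apply: mk_convex_set => x y t Ax Ay t01 C [cC AC].
by apply: convex_set2 => //; [exact: Ax|exact: Ay].
Qed.

Lemma closure_convex A : @convex_set R V A -> @convex_set R V (closure A).
Proof.
move=> cA; apply: mk_convex_set => x y t /closure_ballP clx /closure_ballP cly t01.
apply/closure_ballP => e e0; have [x' Ax' xx'] := clx e e0; have [y' Ay' yy'] := cly e e0.
exists (t *: x' + (1 - t) *: y'); first exact: convex_set2.
rewrite opprD addrACA -!scalerBr; have /andP[t0 t1] := t01.
apply: le_lt_trans (ler_normD _ _) _; rewrite !normrZ (ger0_norm t0) ger0_norm ?subr_ge0//.
have [->|tn] := eqVneq t 0; first by rewrite mul0r subr0 add0r mul1r.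
have tp : 0 < t by rewrite lt_neqAle eq_sym tn.
have h1 : t * `|x - x'| < t * e by rewrite ltr_pM2l.
have h2 : (1 - t) * `|y - y'| <= (1 - t) * e by rewrite ler_wpM2l ?subr_ge0// ltW.
lra.
Qed.

End ConvexSets.
End RowVectors.

Section RelativeInterior.
Context (R : realType) (d : nat).
Local Notation V := 'rV[R]_d.
Implicit Types A B : set V.

Lemma sub_aff A : A `<=` aff A.
Proof.
move=> x Ax; exists 1%N, (fun=> x), (fun=> 1); split => //; first by rewrite big_ord1.
by rewrite big_ord1 scale1r.
Qed.

Lemma aff_subset A B : A `<=` B -> aff A `<=` aff B.
Proof. by move=> AB x [n [a [t [Aa t1 ->]]]]; exists n, a, t; split => // i; exact: AB. Qed.

(** A free family of directions of maximal length spans all of them, since a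
    direction outside its span could be added. *)
Lemma direction_basis A a0 : A a0 -> exists (k : nat) (b : k.-tuple V),
  [/\ free b, forall i : 'I_k, A (a0 + b`_i) & forall y, A y -> y - a0 \in <<b>>%VS].
Proof.
move=> Aa0.
pose P k := `[< exists b : k.-tuple V, free b /\ forall i : 'I_k, A (a0 + b`_i) >].
have P0 : exists k, P k.
  by exists 0%N; apply/asboolP; exists [tuple]; split; [rewrite nil_free|case].
have Pd k : P k -> (k <= d)%N.
  move=> /asboolP[b [fb _]].
  have : (\dim <<b>>%VS <= \dim {:V})%N by apply/dimvS/subvf.
  by rewrite (eqP fb) dimvf /dim /= mul1n size_tuple.
have [k /asboolP[b [fb Ab]] kmax] := ex_maxnP P0 Pd.
exists k, b; split => // y Ay; apply: contrapT => /negP ny.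
suff /kmax : P k.+1 by rewrite ltnn.
apply/asboolP; exists [tuple of (y - a0) :: b]; split; first by rewrite /= free_cons ny.
by case=> -[|i] ik /=; [rewrite addrC subrK|exact: (Ab (Ordinal (ik : (i < k)%N)))].
Qed.

Lemma aff_directions A a0 (U : {vspace V}) :
  (forall y, A y -> y - a0 \in U) -> forall y, aff A y -> y - a0 \in U.
Proof.
move=> AU y [n [a [t [Aa t1 ->]]]].
have -> : \sum_i t i *: a i - a0 = \sum_i t i *: (a i - a0).
  under [RHS]eq_bigr do rewrite scalerBr.
  by rewrite sumrB -scaler_suml t1 scale1r.
by apply: rpred_sum => i _; apply: rpredZ; exact: AU.
Qed.

Lemma coord_bound k (b : k.-tuple V) :
  exists2 C : R, 0 < C & forall i v, `|coord b i v| <= C * `|v|.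
Proof.
have /choice[C hC] (i : 'I_k) : exists C : R, 0 < C /\ forall v, `|coord b i v| <= C * `|v|.
  have [a u v|C C0 hC] := @linear_bound _ _ R^o (coord b i); first by rewrite linearP.
  by exists C.
have C0 i : 0 <= C i by have [/ltW] := hC i.
exists (1 + \sum_i C i); first by apply: ltr_pwDl => //; apply: sumr_ge0.
move=> i v; have [_ /(_ v) h] := hC i; apply: le_trans h _; rewrite ler_wpM2r//.
rewrite (bigD1 i)//= addrCA lerDl addr_ge0//; exact: sumr_ge0.
Qed.

(** The base point takes the weight left over by the displacements. The clause
    on sets and the one on signs serve convexity, the last one Jensen's
    inequality. *)
Lemma pointed_combination a0 k (a : 'I_k -> V) (c : 'I_k -> R) :
  exists (b : 'I_k.+1 -> V) (t : 'I_k.+1 -> R),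
    [/\ forall A, A a0 -> (forall i, A (a0 + a i)) -> forall i, A (b i),
        \sum_i t i = 1,
        a0 + \sum_i c i *: a i = \sum_i t i *: b i,
        (forall i, 0 <= c i) -> \sum_i c i <= 1 -> forall i, 0 <= t i &
        forall F : V -> R, \sum_i t i * F (b i) =
          F a0 + \sum_i c i * (F (a0 + a i) - F a0)].
Proof.
pose b (i : 'I_k.+1) := if unlift ord0 i is Some j then a0 + a j else a0.
pose t (i : 'I_k.+1) := if unlift ord0 i is Some j then c j else 1 - \sum_i c i.
exists b, t; split.
- by move=> A A0 Aa i; rewrite /b; case: unliftP.
- rewrite big_ord_recl (eq_bigr c) => [|i _]; last by rewrite /t liftK.
  by rewrite /t unlift_none subrK.
- have E i : t (lift ord0 i) *: b (lift ord0 i) = c i *: a0 + c i *: a i.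
    by rewrite /t /b liftK scalerDr.
  rewrite [RHS]big_ord_recl (eq_bigr _ (fun i _ => E i)) /t /b unlift_none.
  by rewrite big_split/= -scaler_suml addrA -scalerDl subrK scale1r.
- by move=> c0 c1 i; rewrite /t; case: unliftP => // _; rewrite subr_ge0.
- move=> F; have E i : t (lift ord0 i) * F (b (lift ord0 i)) = c i * F (a0 + a i).
    by rewrite /t /b liftK.
  rewrite big_ord_recl (eq_bigr _ (fun i _ => E i)) /t /b unlift_none.
  have E' i : c i * (F (a0 + a i) - F a0) = c i * F (a0 + a i) - c i * F a0.
    by rewrite mulrBr.
  rewrite [in RHS](eq_bigr _ (fun i _ => E' i)).
  by rewrite sumrB -mulr_suml mulrBl mul1r addrA addrAC.
Qed.

Lemma convex_star A a0 k (a : 'I_k -> V) (c : 'I_k -> R) :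
  @convex_set R V A -> A a0 -> (forall i, A (a0 + a i)) ->
  (forall i, 0 <= c i) -> \sum_i c i <= 1 -> A (a0 + \sum_i c i *: a i).
Proof.
move=> cA A0 Aa c0 c1; have [b [t [Ab t1 -> t0 _]]] := pointed_combination a0 a c.
by apply: convex_comb => //; [exact: Ab|exact: t0].
Qed.

(** In the coordinates of a direction basis, the barycentre of the simplex
    spanned inside the set is relatively interior. *)
Lemma convex_chart A a0 : @convex_set R V A -> A a0 ->
  exists (U : {vspace V}) (c : V) (e : R),
    [/\ forall y, aff A y <-> y - a0 \in U, A c, 0 < e &
        forall y, aff A y -> `|c - y| < e -> A y].
Proof.
move=> cA Aa0; have [k [b [fb Ab AU]]] := direction_basis Aa0.
have Uaff y : aff A y <-> y - a0 \in <<b>>%VS.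
  split; first exact: aff_directions.
  move=> /coord_span yE.
  have [a' [t [Aa' t1 aE _ _]]] :=
    pointed_combination a0 (fun i : 'I_k => b`_i) (fun i => coord b i (y - a0)).
  exists k.+1, a', t; split => //; first exact: Aa'.
  by rewrite -aE -yE addrC subrK.
(* The barycentre has all coordinates equal to [q]; moving each of them by at
   most [q * q] keeps them nonnegative and their sum at most [1 - q * q]. *)
pose q : R := k.+1%:R^-1.
have q0 : 0 < q by rewrite invr_gt0 ltr0n.
pose c := a0 + \sum_(i < k) q *: b`_i.
have kq : k%:R * q = 1 - q.
  by apply/eqP; rewrite eq_sym subr_eq -{2}[q]mul1r -mulrDl natr1 divff// pnatr_eq0.
have qk : \sum_(i < k) q <= 1 by rewrite sumr_const card_ord -mulr_natl kq; lra.
have Ac : A c by apply: convex_star => // i; exact: ltW.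
have [C C0 hC] := coord_bound b.
exists <<b>>%VS, c, (q * q / C); split => //; first by rewrite divr_gt0// mulr_gt0.
move=> y affy cy; have yU := (Uaff y).1 affy.
have -> : y = a0 + \sum_(i < k) coord b i (y - a0) *: b`_i.
  by rewrite -coord_span// addrC subrK.
have ci i : `|q - coord b i (y - a0)| <= q * q.
  have -> : q - coord b i (y - a0) = coord b i (c - y).
    have -> : c - y = \sum_(j < k) q *: b`_j - (y - a0).
      by rewrite /c opprB addrA [RHS]addrAC [in RHS]addrC addrA.
    by rewrite [RHS]raddfB /= coord_sum_free.
  apply: le_trans (hC _ _) _; rewrite mulrC -ler_pdivlMr//; exact: ltW.
have q1 : q <= 1 by rewrite invf_le1 ?ltr0n// ler1n.
have qq1 : q * q <= q by apply: ler_piMr => //; exact: ltW.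
apply: convex_star => // [i|].
  by have := ci i; rewrite ler_norml => /andP[_ ?]; lra.
apply: (@le_trans _ _ (\sum_(i < k) (q + q * q))).
  by apply: ler_sum => i _; have := ci i; rewrite ler_norml => /andP[? _]; lra.
rewrite sumr_const card_ord -mulr_natl mulrDr mulrA kq.
have := mulr_gt0 q0 q0; lra.
Qed.

Lemma closure_sub_aff A : @convex_set R V A -> closure A `<=` aff A.
Proof.
move=> cA x /closure_ballP clx.
have [a0 Aa0 _] := clx 1 ltr01.
have [U [_ [_ [Uaff _ _ _]]]] := convex_chart cA Aa0.
apply/Uaff/vspace_closed => e e0; have [y Ay xy] := clx e e0.
exists (y - a0); first exact/Uaff/sub_aff.
by rewrite opprB addrA subrK.
Qed.

(** The affine hull is a translate of a finite-dimensional subspace, so it is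
    closed and passing to the closure does not enlarge it. *)
Lemma aff_closure_sub A : @convex_set R V A -> aff (closure A) `<=` aff A.
Proof.
move=> cA x [n [a [t [Aa t1 xE]]]].
case: n => [|n] in a t Aa t1 xE *.
  by move: t1; rewrite big_ord0 => /eqP; rewrite eq_sym oner_eq0.
have /closure_ballP/(_ 1 ltr01)[a0 Aa0 _] := Aa ord0.
have [U [_ [_ [Uaff _ _ _]]]] := convex_chart cA Aa0.
apply/Uaff; apply: (@aff_directions (closure A)).
  by move=> y /closure_sub_aff => /(_ cA)/Uaff.
by exists n.+1, a, t.
Qed.

Lemma aff_line A x y z (s : R) : @convex_set R V A ->
  aff A x -> aff A y -> aff A z -> aff A (x + s *: (y - z)).
Proof.
move=> cA; have [[a0 Aa0]|nA] := pselect (A !=set0); last first.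
  move=> [n [a [t [Aa t1 xE]]]]; case: n => [|n] in a t Aa t1 xE *.
    by move: t1; rewrite big_ord0 => /eqP; rewrite eq_sym oner_eq0.
  by exfalso; apply: nA; exists (a ord0).
have [U [_ [_ [Uaff _ _ _]]]] := convex_chart cA Aa0.
move=> /Uaff xU /Uaff yU /Uaff zU; apply/Uaff.
have -> : x + s *: (y - z) - a0 = x - a0 + s *: ((y - a0) - (z - a0)).
  by rewrite opprB addrA subrK addrAC.
by rewrite rpredD// rpredZ// rpredB.
Qed.

Lemma convex_segment A z e w (t : R) : @convex_set R V A -> A z -> 0 < e ->
  (forall y, aff A y -> `|z - y| < e -> A y) -> closure A w ->
  0 < t <= 1 -> A (t *: z + (1 - t) *: w).
Proof.
move=> cA Az e0 ez clw /andP[t0 t1].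
have affw := closure_sub_aff cA clw.
(* Moving [w] to a nearby point [w'] of the set is compensated by moving [z]
   by [s] times the displacement, within the ball around [z]. *)
pose s := (1 - t) / t.
have s0 : 0 <= s by rewrite divr_ge0 ?subr_ge0// ltW.
have /closure_ballP/(_ (e / (1 + s))) [|w' Aw' ww'] := clw.
  by rewrite divr_gt0// ltr_pwDl.
pose z' := z + s *: (w - w').
have Az' : A z'.
  apply: ez; first by apply: aff_line => //; exact: sub_aff.
  rewrite /z' opprD addNKr normrN normrZ ger0_norm//.
  apply: (@le_lt_trans _ _ (s * (e / (1 + s)))).
    by rewrite ler_wpM2l// ltW.
  by rewrite mulrA ltr_pdivrMr ?ltr_pwDl// mulrDr mulr1 mulrC ltrDr.
have -> : t *: z + (1 - t) *: w = t *: z' + (1 - t) *: w'.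
  rewrite /z' scalerDr scalerA /s mulrCA divff ?gt_eqF// mulr1 scalerBr.
  by rewrite -!addrA addNr addr0.
by apply: convex_set2 => //; rewrite ltW.
Qed.

Lemma riP A x : ri A x <->
  A x /\ exists2 e, 0 < e & forall y, aff A y -> `|x - y| < e -> A y.
Proof.
split=> -[Ax].
  move=> /near_ballP[e e0 he]; split => //; exists e => // y ay xy.
  exact: he.
by move=> [e e0 he]; split => //; apply/near_ballP; exists e => // y xy ay; exact: he.
Qed.

(** The ray from a relatively interior point of the smaller set through the
    given point can be prolonged a little inside the larger set. Its end is in
    the closure of the smaller set, so the given point is on a half-open
    segment to which [convex_segment] applies. *)
Lemma ri_sub_dense A B : @convex_set R V A -> A `<=` B -> B `<=` closure A ->
  ri B `<=` A.
Proof.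
move=> cA AB BA y /riP[By [e e0 he]].
have clAy := BA _ By.
have /closure_ballP/(_ 1 ltr01)[a0 Aa0 _] := clAy.
have [_ [c [r [_ Ac r0 hr]]]] := convex_chart cA Aa0.
(* [w] lies slightly beyond [y] on the ray from [c]. *)
pose s := e / (2 * (1 + `|y - c|)).
have N0 : 0 < 1 + `|y - c| by rewrite ltr_pwDl.
have s0 : 0 < s by rewrite divr_gt0// mulr_gt0.
pose w := y + s *: (y - c).
have clw : closure A w.
  apply/BA/he.
    apply: (aff_subset AB); apply: aff_line => //; last exact: sub_aff.
      exact: closure_sub_aff.
    exact: closure_sub_aff.
  rewrite /w opprD addNKr normrN normrZ gtr0_norm// /s.
  rewrite mulrAC ltr_pdivrMr ?mulr_gt0// ltr_pM2l//.
  by have := normr_ge0 (y - c); lra.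
have s1 : 0 < 1 + s by rewrite addr_gt0.
have -> : y = (s / (1 + s)) *: c + (1 - s / (1 + s)) *: w.
  have -> : 1 - s / (1 + s) = (1 + s)^-1.
    by apply/eqP; rewrite subr_eq -{1}[(1 + s)^-1]mul1r -mulrDl divff// gt_eqF.
  have -> : w = (1 + s) *: y - s *: c by rewrite /w scalerBr addrA scalerDl scale1r.
  rewrite scalerBr !scalerA mulVf ?gt_eqF// scale1r [_^-1 * s]mulrC.
  by rewrite addrC subrK.
apply: (convex_segment cA Ac r0 hr clw).
by rewrite divr_gt0//= ler_pdivrMr// mul1r lerDr.
Qed.

Lemma ri_closure A : @convex_set R V A -> ri A = A -> ri (closure A) = A.
Proof.
move=> cA riA; apply/seteqP; split.
  by apply: ri_sub_dense => //; exact: subset_closure.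
move=> x; rewrite -{1}riA => /riP[Ax [e e0 he]].
apply/riP; split; first exact: subset_closure.
by exists e => // y ay xy; apply: subset_closure; apply: he => //; exact: aff_closure_sub.
Qed.

(** A segment inside a relatively open set can be prolonged, and a prolongation
    ending in the closure puts the point on a half-open segment. The interest
    is that only the closure is accessible through the Wijsman topology. *)
Lemma ri_memP A x y : @convex_set R V A -> ri A = A -> A x ->
  A y <-> exists n : nat, closure A (y + n.+1%:R^-1 *: (y - x)).
Proof.
move=> cA riA Ax; split.
  rewrite -{1}riA => /riP[Ay [e e0 he]].
  have [n hn] : exists n : nat, `|y - x| / e < n.+1%:R.
    exists (Num.bound (`|y - x| / e)).
    apply: lt_trans (archi_boundP _) _; first by rewrite divr_ge0// ltW.
    by rewrite ltr_nat.
  exists n; apply: subset_closure; apply: he.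
    by apply: aff_line => //; exact: sub_aff.
  rewrite opprD addNKr normrN normrZ gtr0_norm ?invr_gt0// mulrC.
  by rewrite ltr_pdivrMr ?ltr0n// mulrC -ltr_pdivrMr.
move=> [n]; set s := _^-1; have s0 : 0 < s by rewrite invr_gt0 ltr0n.
move=> clw; have := Ax; rewrite -{1}riA => /riP[_ [e e0 he]].
have s1 : 0 < 1 + s by rewrite addr_gt0.
have -> : y = (s / (1 + s)) *: x + (1 - s / (1 + s)) *: (y + s *: (y - x)).
  have -> : 1 - s / (1 + s) = (1 + s)^-1.
    by apply/eqP; rewrite subr_eq -{1}[(1 + s)^-1]mul1r -mulrDl divff// gt_eqF.
  have -> : y + s *: (y - x) = (1 + s) *: y - s *: x by rewrite scalerBr addrA scalerDl scale1r.
  rewrite scalerBr !scalerA mulVf ?gt_eqF// scale1r [_^-1 * s]mulrC.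
  by rewrite addrC subrK.
apply: (convex_segment cA Ax e0 he clw).
by rewrite divr_gt0//= ler_pdivrMr// mul1r lerDr.
Qed.

End RelativeInterior.

Section ConvexContinuity.
Context (R : realType) (d : nat).
Local Notation V := 'rV[R]_d.
Variables (A : set V) (f : V -> R).
Hypothesis cA : @convex_set R V A.
Hypothesis riA : ri A = A.
Hypothesis jensen : forall (n : nat) (a : 'I_n -> V) (t : 'I_n -> R),
  (forall i, A (a i)) -> (forall i, 0 <= t i) -> \sum_i t i = 1 ->
  f (\sum_i t i *: a i) <= \sum_i t i * f (a i).

Lemma jensen_star a0 k (a : 'I_k -> V) (c : 'I_k -> R) :
  A a0 -> (forall i, A (a0 + a i)) -> (forall i, 0 <= c i) -> \sum_i c i <= 1 ->
  f (a0 + \sum_i c i *: a i) <= f a0 + \sum_i c i * (f (a0 + a i) - f a0).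
Proof.
move=> A0 Aa c0 c1; have [b [t [Ab t1 -> t0 <-]]] := pointed_combination a0 a c.
by apply: jensen => //; [exact: Ab|exact: t0].
Qed.

(** Upwards the function is controlled by its values at the vertices of a
    small cross-polytope around the point; reflection in the point turns the
    upper bound into a lower one. *)
Lemma convex_locally_lipschitz y : A y ->
  exists L r : R, [/\ 0 <= L, 0 < r & forall z, A z -> `|y - z| < r ->
    `|f z - f y| <= L * `|y - z|].
Proof.
move=> Ay; have [k [b [fb Ab AU]]] := direction_basis Ay.
have := Ay; rewrite -{1}riA => /riP[_ [e e0 he]].
have [C C0 hC] := coord_bound b.
(* Displacements [r *: b`_i] are shorter than [e], so that the vertices lie in
   the set. *)
pose S := 1 + \sum_(i < k) `|b`_i|.
have S0 : 0 < S by apply: ltr_pwDl => //; apply: sumr_ge0.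
pose r := e / (2 * S).
have r0 : 0 < r by rewrite divr_gt0// mulr_gt0.
have bS (i : 'I_k) : `|b`_i| <= S.
  by rewrite /S (bigD1 i)//= addrCA lerDl addr_ge0//; exact: sumr_ge0.
have Apm (s : R) (i : 'I_k) : `|s| <= r -> A (y + s *: b`_i).
  move=> sr; apply: he.
    have -> : b`_i = (y + b`_i) - y by rewrite addrC addKr.
    by apply: aff_line => //; apply: sub_aff.
  rewrite opprD addNKr normrN normrZ.
  apply: (@le_lt_trans _ _ (r * S)); first by apply: ler_pM.
  by rewrite /r invfM mulrA mulfVK ?gt_eqF//; lra.
pose M := \sum_(i < k) (`|f (y + r *: b`_i) - f y| + `|f (y + (- r) *: b`_i) - f y|).
have M0 : 0 <= M by apply: sumr_ge0 => i _; rewrite addr_ge0.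
have Mi (i : 'I_k) (s : R) : s = r \/ s = - r -> f (y + s *: b`_i) - f y <= M.
  move=> sE; rewrite /M (bigD1 i)//=; set T := \sum_(j < k | _) _.
  have T0 : 0 <= T by apply: sumr_ge0 => j _; rewrite addr_ge0.
  have h1 := normr_ge0 (f (y + r *: b`_i) - f y).
  have h2 := normr_ge0 (f (y + - r *: b`_i) - f y).
  case: sE => ->.
    have := ler_norm (f (y + r *: b`_i) - f y); lra.
  have := ler_norm (f (y + - r *: b`_i) - f y); lra.
(* [Q * `|y - z|] bounds the total weight that a point [z] of the set puts on
   the vertices; [rho] makes it at most one. *)
pose Q := k%:R * C / r.
have Q0 : 0 <= Q by rewrite divr_ge0 ?(ltW r0)// mulr_ge0 ?ler0n// ltW.
pose L := Q * M.
pose rho := Num.min e (1 + Q)^-1.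
have Q1 : 0 < 1 + Q by rewrite ltr_pwDl.
have rho0 : 0 < rho by rewrite lt_min e0 invr_gt0.
have upper z : A z -> `|y - z| < rho -> f z <= f y + L * `|y - z|.
  move=> Az; rewrite lt_min => /andP[yze yzQ].
  pose c i := coord b i (z - y).
  have cC i : `|c i| <= C * `|y - z| by rewrite distrC; exact: hC.
  pose sg i : R := if 0 <= c i then r else - r.
  have sgr i : `|sg i| <= r.
    by rewrite /sg; case: ifP => _; rewrite ?normrN gtr0_norm.
  have cE i : `|c i| / r * sg i = c i.
    rewrite /sg; case: ifPn => ci; first by rewrite ger0_norm// mulfVK// gt_eqF.
    by rewrite mulrN mulfVK ?gt_eqF// ltr0_norm ?opprK// ltNge.
  have sumQ : \sum_i `|c i| / r <= Q * `|y - z|.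
    apply: (@le_trans _ _ (\sum_(i < k) (C * `|y - z|) / r)).
      by apply: ler_sum => i _; rewrite ler_wpM2r// invr_ge0 ltW.
    by rewrite sumr_const card_ord -mulr_natl /Q !mulrA mulrAC.
  have zE : z = y + \sum_i (`|c i| / r) *: (sg i *: b`_i).
    rewrite (eq_bigr (fun i => c i *: b`_i)) => [|i _]; last by rewrite scalerA cE.
    by rewrite -coord_span ?AU// addrC subrK.
  rewrite {1}zE; apply: le_trans (jensen_star _ _ _ _) _ => //.
  - by move=> i; exact: Apm.
  - by move=> i; rewrite divr_ge0// ltW.
  - apply: le_trans sumQ _; apply: (@le_trans _ _ ((1 + Q) * `|y - z|)).
      by rewrite ler_wpM2r// lerDr.
    by rewrite -ler_pdivlMl// mulr1 ltW.
  rewrite lerD2l; apply: (@le_trans _ _ (\sum_i `|c i| / r * M)).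
    apply: ler_sum => i _; apply: ler_wpM2l; first by apply: divr_ge0 => //; exact: ltW.
    by apply: Mi; rewrite /sg; case: ifP; [left|right].
  by rewrite -mulr_suml /L mulrAC ler_wpM2r.
exists L, rho; split => //; first by rewrite mulr_ge0.
move=> z Az yz; rewrite ler_distl; apply/andP; split; last exact: upper.
pose z' := y + (y - z).
have Az' : A z'.
  apply: he; first by rewrite /z' -[y - z]scale1r; apply: aff_line => //; exact: sub_aff.
  rewrite /z' opprD addNKr normrN.
  by apply: lt_le_trans yz _; rewrite ge_min lexx.
have yz' : `|y - z'| = `|y - z| by rewrite /z' opprD addNKr normrN.
have := upper z' Az'; rewrite yz' => /(_ yz) hz'.
have zz : z + (z' - z) = z' by rewrite addrC subrK.
have yE : z + 2^-1 *: (z' - z) = y.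
  have -> : z' - z = 2 *: (y - z).
    by rewrite /z' scaler_nat mulr2n addrA [RHS]addrA; congr (_ - z); rewrite addrAC.
  by rewrite scalerA mulVf ?pnatr_eq0// scale1r addrC subrK.
have h : f y <= f z + 2^-1 * (f z' - f z).
  have := @jensen_star z 1%N (fun=> z' - z) (fun=> 2^-1) Az.
  rewrite !big_ord1 zz yE; apply; first by move=> _.
    by move=> _; rewrite invr_ge0.
  lra.
lra.
Qed.

End ConvexContinuity.

(** * The Borel structure of row vectors *)

Section BorelRowVectors.
Context (R : realType) (d : nat).
Local Notation V := 'rV[R]_d.

Lemma open_measurable_rV (U : set V) : open U -> measurable U.
Proof. exact: sub_sigma_algebra. Qed.

Lemma closed_measurable_rV (F : set V) : closed F -> measurable F.
Proof.
move=> cF; rewrite -[F]setCK; apply: measurableC; apply: open_measurable_rV.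
exact: closed_openC.
Qed.

Lemma measurable_rV_set1 (x : V) : measurable [set x].
Proof.
apply: closed_measurable_rV; apply: accessible_closed_set1.
by apply: hausdorff_accessible; exact: norm_hausdorff.
Qed.

Lemma measurable_coord i : measurable_fun [set: V] (fun v : V => v 0 i : R).
Proof.
apply: (measurability _ (RGenOInfty.measurableE R)) => _ [_ [x ->] <-].
rewrite setTI; apply: open_measurable_rV.
by apply: open_comp; [move=> v _; exact: coord_continuous|exact: interval_open].
Qed.

Definition rat_rV (n : nat) : V :=
  if unpickle n is Some q then \row_i ratr ((q : 'rV[rat]_d) 0 i) else 0.

Lemma rV_norm_lt (v : V) e : 0 < e -> (forall i, `|v 0 i| < e) -> `|v| < e.
Proof.
move=> e0 h; rewrite [ltLHS]/Num.norm /= mx_normrE; apply/bigmax_ltP; split => //.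
by move=> [i j] _ /=; rewrite (ord1 i).
Qed.

Lemma rat_rV_dense (x : V) e : 0 < e -> exists n, `|x - rat_rV n| < e.
Proof.
move=> e0; have /choice[q hq] (i : 'I_d) : exists q : rat, `|x 0 i - ratr q| < e.
  have [q] := @rat_in_itvoo _ (x 0 i - e) (x 0 i + e) ltac:(lra).
  rewrite in_itv/= => /andP[h1 h2]; exists q.
  by rewrite ltr_norml; apply/andP; split; lra.
exists (pickle (\row_i q i)); rewrite /rat_rV pickleK.
by apply: rV_norm_lt => // i; rewrite !mxE.
Qed.

Section MeasurableMaps.
Context (disp : measure_display) (T : measurableType disp).

Lemma measurable_norm_lt (f : T -> V) e :
  (forall i, measurable_fun [set: T] (fun t => f t 0 i)) ->
  measurable [set t | `|f t| < e].
Proof.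
move=> mf; have [e0|e0] := ltP 0 e; last first.
  rewrite (_ : mkset _ = set0)//; apply/seteqP; split => t //= h.
  by have := le_lt_trans (normr_ge0 _) h; rewrite ltNge e0.
rewrite (_ : mkset _ = \bigcap_(i in [set: 'I_d]) [set t | `|f t 0 i| < e]); last first.
  apply/seteqP; split => t /=.
    by move=> h i _ /=; apply: le_lt_trans h; exact: le_coord_norm.
  by move=> h; apply: rV_norm_lt => // i; exact: h.
apply: fin_bigcap_measurable => // i _.
have m : measurable_fun [set: T] (fun t => `|f t 0 i|) by exact: measurableT_comp.
have := m measurableT `]-oo, e[%classic (measurable_itv _).
by rewrite setTI; congr measurable; apply/seteqP; split => t /=; rewrite in_itv.
Qed.

Lemma measurable_fun_rV (f : T -> V) :
  (forall i, measurable_fun [set: T] (fun t => f t 0 i)) ->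
  measurable_fun [set: T] f.
Proof.
move=> mf; apply: (@measurability _ _ T V setT f open) => // _ [U oU <-]; rewrite setTI.
pose J n := [set k | forall y : V, `|rat_rV n - y| < k.+1%:R^-1 -> U y].
have -> : f @^-1` U = \bigcup_n \bigcup_(k in J n) [set t | `|f t - rat_rV n| < k.+1%:R^-1].
  apply/seteqP; split => t /=; last first.
    by move=> [n _ [k /= h]]; rewrite distrC; exact: h.
  move=> Uft; have /nbhs_ballP[e /= e0 eU] := open_nbhs_nbhs (conj oU Uft).
  have [k hk] : exists k : nat, k.+1%:R^-1 < e / 2.
    have [k _ h] := (near_infty_natSinv_lt (PosNum (divr_gt0 e0 (ltr0Sn _ 1)))).
    by exists k; exact: (h k (leqnn k)).
  have [n hn] := rat_rV_dense (f t) (e := k.+1%:R^-1) ltac:(by rewrite invr_gt0 ltr0n).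
  exists n => //; exists k => //= y hy; apply: eU; rewrite -ball_normE /=.
  have -> : f t - y = (f t - rat_rV n) + (rat_rV n - y) by rewrite addrA subrK.
  apply: le_lt_trans (ler_normD _ _) (lt_trans (ltrD hn hy) _).
  by rewrite [ltRHS]splitr; exact: ltrD.
apply: bigcup_measurable => n _; apply: bigcup_measurable => k _; apply: measurable_norm_lt => i /=.
under eq_fun do rewrite !mxE.
by apply: measurable_funB => //; exact: measurable_cst.
Qed.

Lemma measurable_coord_comp (f : T -> V) i :
  measurable_fun [set: T] f -> measurable_fun [set: T] (fun t => f t 0 i).
Proof. by move=> mf; exact: (measurableT_comp (measurable_coord i)). Qed.

Lemma measurable_rVD (f g : T -> V) : measurable_fun [set: T] f ->
  measurable_fun [set: T] g -> measurable_fun [set: T] (fun t => f t + g t).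
Proof.
move=> mf mg; apply: measurable_fun_rV => i; under eq_fun do rewrite !mxE.
by apply: measurable_funD; exact: measurable_coord_comp.
Qed.

Lemma measurable_rVZ (c : R) (f : T -> V) : measurable_fun [set: T] f ->
  measurable_fun [set: T] (fun t => c *: f t).
Proof.
move=> mf; apply: measurable_fun_rV => i; under eq_fun do rewrite !mxE.
by apply: measurable_funM => //; exact: measurable_coord_comp.
Qed.

Lemma measurable_rVB (f g : T -> V) : measurable_fun [set: T] f ->
  measurable_fun [set: T] g -> measurable_fun [set: T] (fun t => f t - g t).
Proof.
move=> mf mg; under eq_fun do rewrite -scaleN1r.
by apply: measurable_rVD => //; exact: measurable_rVZ.
Qed.

Lemma measurable_dist_lt (f g : T -> V) e : measurable_fun [set: T] f ->
  measurable_fun [set: T] g -> measurable [set t | `|f t - g t| < e].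
Proof.
move=> mf mg; apply: measurable_norm_lt => i; apply: measurable_coord_comp.
exact: measurable_rVB.
Qed.

End MeasurableMaps.

Lemma le_norm_enorm (v : V) : `|v| <= enorm v.
Proof.
have e0 : 0 <= enorm v by exact: sqrtr_ge0.
rewrite [leLHS]/Num.norm /= mx_normrE; apply/bigmax_leP; split => // -[i j] _ /=.
rewrite (ord1 i) -sqrtr_sqr /enorm ler_sqrt; last first.
  by apply: sumr_ge0 => l _; rewrite -expr2 sqr_ge0.
rewrite /dotp (bigD1 j)//= expr2 lerDl; apply: sumr_ge0 => l _.
by rewrite -expr2 sqr_ge0.
Qed.

Lemma enorm_le_norm (v : V) : enorm v <= d%:R * `|v|.
Proof.
rewrite /enorm -[leRHS]ger0_norm ?mulr_ge0 ?ler0n// -sqrtr_sqr ler_sqrt ?sqr_ge0//.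
apply: (@le_trans _ _ (\sum_(i < d) `|v| ^+ 2)).
  apply: ler_sum => i _; rewrite -expr2 -real_normK ?num_real//.
  by rewrite lerXn2r ?nnegrE//; exact: le_coord_norm.
rewrite sumr_const card_ord exprMn -[leLHS]mulr_natl ler_wpM2r ?sqr_ge0//.
by case: (d) => [|n]; rewrite ?expr0n//= -natrX ler_nat -{1}[n.+1]expn1 leq_pexp2l.
Qed.

Lemma dotp_bound (u v : V) (e : R) : `|u| <= e -> dotp u v <= e * \sum_i `|v 0 i|.
Proof.
move=> ue; rewrite /dotp mulr_sumr; apply: ler_sum => i _.
apply: le_trans (ler_norm _) _; rewrite normrM ler_wpM2r//.
exact: le_trans (le_coord_norm u i) ue.
Qed.

Lemma dotpBl (u v w : V) : dotp (u - v) w = dotp u w - dotp v w.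
Proof. by rewrite /dotp -sumrB; apply: eq_bigr => i _; rewrite !mxE mulrBl. Qed.

Lemma dotpNl (u w : V) : dotp (- u) w = - dotp u w.
Proof. by rewrite /dotp -sumrN; apply: eq_bigr => i _; rewrite !mxE mulNr. Qed.

Lemma dotp_sumr (u : V) n (a : 'I_n -> V) (t : 'I_n -> R) :
  dotp u (\sum_i t i *: a i) = \sum_i t i * dotp u (a i).
Proof.
rewrite /dotp; under [RHS]eq_bigr do rewrite mulr_sumr.
rewrite exchange_big; apply: eq_bigr => j _.
rewrite summxE mulr_sumr; apply: eq_bigr => i _; rewrite mxE.
by rewrite mulrCA.
Qed.

Lemma dotpBr (u v w : V) : dotp u (v - w) = dotp u v - dotp u w.
Proof. by rewrite /dotp -sumrB; apply: eq_bigr => i _; rewrite !mxE mulrBr. Qed.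

End BorelRowVectors.

(** * Measurable selections *)

Section GeometricLimit.
Context (R : realType).

Lemma exists_half_pow (e : R) : 0 < e -> exists k, 2^-1 ^+ k < e.
Proof.
move=> e0; have c2 : (GRing.exp (2^-1 : R)) @ \oo --> 0.
  by apply: cvg_expr; rewrite ger0_norm// invf_lt1// ltr1n.
have /cvgrPdist_lt/(_ e e0)[k _ /(_ k (leqnn k))] /= := c2.
by rewrite sub0r normrN ger0_norm ?exprn_ge0// => ?; exists k.
Qed.

Lemma geometric_limit (u : nat -> R) (c : R) :
  (forall n, `|u n.+1 - u n| <= c * 2^-1 ^+ n) ->
  cvgn u /\ forall n, `|limn u - u n| <= 2 * c * 2^-1 ^+ n.
Proof.
move=> hu; pose r n : R := 2 * c * 2^-1 ^+ n.
have rS n : r n.+1 = c * 2^-1 ^+ n by rewrite /r exprS; set y := 2^-1 ^+ n; lra.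
have rD n : r n = r n.+1 + r n.+1 by rewrite rS /r -mulrDl; congr (_ * _); lra.
have c0 : 0 <= c by have := le_trans (normr_ge0 _) (hu 0%N); rewrite expr0 mulr1.
have r0 n : 0 <= r n by rewrite /r mulr_ge0 ?mulr_ge0 ?exprn_ge0.
(* The sequence is squeezed between a nondecreasing and a nonincreasing one. *)
pose v n := u n - r n; pose w n := u n + r n.
have vnd : nondecreasing_seq v.
  apply/nondecreasing_seqP => n; have := hu n; rewrite -rS ler_norml => /andP[h _].
  by rewrite /v; have := rD n; lra.
have wni : nonincreasing_seq w.
  apply/nonincreasing_seqP => n; have := hu n; rewrite -rS ler_norml => /andP[_ h].
  by rewrite /w; have := rD n; lra.
have vw n k : v n <= w k.
  apply: (@le_trans _ _ (v (maxn n k))); first by apply: vnd; exact: leq_maxl.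
  apply: (@le_trans _ _ (w (maxn n k))); last by apply: wni; exact: leq_maxr.
  by rewrite /v /w; have := r0 (maxn n k); lra.
have cv : cvgn v.
  by apply: nondecreasing_is_cvgn => //; exists (w 0%N) => _ [n _ <-].
have rcv : r @ \oo --> 0.
  rewrite -(mulr0 (2 * c)); apply: cvgMl_tmp; apply: cvg_expr.
  by rewrite ger0_norm// invf_lt1// ltr1n.
have uv : u = v \+ r by apply/funext => n; rewrite /v /= subrK.
have cu : u @ \oo --> limn v.
  by rewrite uv -[limn v]addr0; apply: cvgD.
split; first by apply/cvg_ex; exists (limn v).
move=> n; rewrite (cvg_lim _ cu)// ler_distl; apply/andP; split.
  apply: limr_ge => //; exists n => // k /= nk; apply: le_trans (vnd _ _ nk).
  by rewrite /v.
apply: limr_le => //; apply: nearW => k; exact: vw.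
Qed.

End GeometricLimit.

Section LeastIndex.

Definition least (Q : nat -> Prop) : nat :=
  if pselect (exists n, `[< Q n >]) is left h then ex_minn h else 0%N.

Lemma leastP Q : (exists n, Q n) -> Q (least Q) /\ forall i, (i < least Q)%N -> ~ Q i.
Proof.
move=> [n Qn]; rewrite /least; case: pselect => [h|[]]; last by exists n; exact/asboolP.
case: ex_minnP => k /asboolP Qk kmin; split => // i ik Qi.
by have /asboolP/kmin := Qi; rewrite leqNgt ik.
Qed.

Lemma least_eqP Q j : least Q = j <->
  (Q j /\ forall i, (i < j)%N -> ~ Q i) \/ (j = 0%N /\ forall i, ~ Q i).
Proof.
have [exQ|nQ] := pselect (exists n, Q n).
  have [Ql lmin] := leastP exQ; split=> [<-|]; first by left.
  case=> [[Qj jmin]|[_ nQ]]; last by have [n /nQ] := exQ.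
  apply/eqP; rewrite eqn_leq; apply/andP; split; rewrite leqNgt; apply/negP.
    by move=> jl; exact: (lmin _ jl Qj).
  by move=> lj; exact: (jmin _ lj Ql).
have l0 : least Q = 0%N.
  rewrite /least; case: pselect => // h; exfalso; apply: nQ.
  by have [n Qn] := h; exists n; exact/asboolP.
split=> [<-|]; first by right; split => // i Qi; apply: nQ; exists i.
by case=> [[Qj _]|[-> _]]//; exfalso; apply: nQ; exists j.
Qed.

Lemma measurable_least (disp : measure_display) (X : measurableType disp)
    (Q : nat -> X -> Prop) j :
  (forall n, measurable [set x | Q n x]) -> measurable [set x | least (Q ^~ x) = j].
Proof.
move=> mQ.
have -> : [set x | least (Q ^~ x) = j] =
    ([set x | Q j x] `&` \bigcap_(i in [set i | (i < j)%N]) ~` [set x | Q i x]) `|`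
    ([set x | j = 0%N] `&` \bigcap_i ~` [set x | Q i x]).
  apply/seteqP; split => x /=.
    move/least_eqP => -[[Qj jmin]|[j0 nQ]].
      by left; split => // i ij; exact: jmin.
    by right; split => // i _; exact: nQ.
  case=> -[h1 h2]; apply/least_eqP.
    by left; split.
  by right; split=> [|i]; [|exact: (h2 i Logic.I)].
apply: measurableU; apply: measurableI => //.
- by apply: bigcap_measurableType => i _; exact: measurableC.
- have [->|j0] := eqVneq j 0%N; first by rewrite (_ : mkset _ = setT)//; apply/seteqP; split.
  by rewrite (_ : mkset _ = set0)//; apply/seteqP; split => x //= /eqP; rewrite (negPf j0).
- by apply: bigcap_measurableType => i _; exact: measurableC.
Qed.

End LeastIndex.

(** The Kuratowski--Ryll-Nardzewski construction: successive least indices of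
    rational points, each close to the set and to its predecessor. The set may
    be approximated only through the predicates [hit]. *)
Section MeasurableSelection.
Context (R : realType) (d : nat).
Local Notation V := 'rV[R]_d.
Local Notation c := (@rat_rV R d).
Context (disp : measure_display) (X : measurableType disp).
Variables (K : X -> set V) (hit : nat -> nat -> X -> Prop) (s0 : X -> V).
Hypothesis mhit : forall j k, measurable [set x | hit j k x].
Hypothesis hit_near : forall j k x, hit j k x ->
  exists2 a, K x a & `|c j - a| < 2^-1 ^+ k.
Hypothesis hit_dense : forall x a k e, K x a -> 0 < e ->
  exists2 j, hit j k x & `|c j - a| < e.
Hypothesis ms0 : measurable_fun [set: X] s0.
Hypothesis Ks0 : forall x, closure (K x) (s0 x).

Fixpoint sel_index (j0 k0 n : nat) (x : X) : nat :=
  if n is n'.+1 then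
    least (fun j => hit j (k0 + n) x /\
      `|c j - c (sel_index j0 k0 n' x)| < 2 * 2^-1 ^+ (k0 + n'))
  else j0.

Lemma measurable_sel_index j0 k0 n j : measurable [set x | sel_index j0 k0 n x = j].
Proof.
elim: n j => [|n IH] j /=.
  have [<-|ne] := eqVneq j0 j; first by rewrite (_ : mkset _ = setT)//; apply/seteqP; split.
  by rewrite (_ : mkset _ = set0)//; apply/seteqP; split => x //= /eqP; rewrite (negPf ne).
pose Q i j x := hit j (k0 + n.+1) x /\ `|c j - c i| < 2 * 2^-1 ^+ (k0 + n).
rewrite (_ : mkset _ = \bigcup_i ([set x | sel_index j0 k0 n x = i] `&`
    [set x | least (Q i ^~ x) = j])); last first.
  apply/seteqP; split => x /=; first by move=> h; exists (sel_index j0 k0 n x).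
  by move=> [i _ [/= -> h]].
apply: bigcup_measurable => i _; apply: measurableI => //.
apply: measurable_least => l; rewrite /Q.
have [h|h] := pselect (`|c l - c i| < 2 * 2^-1 ^+ (k0 + n)).
  rewrite (_ : mkset _ = [set x | hit l (k0 + n.+1) x])//.
  by apply/seteqP; split => x /=; [case|].
by rewrite (_ : mkset _ = set0)//; apply/seteqP; split => x //= -[].
Qed.

Lemma sel_index_hit j0 k0 x n : hit j0 k0 x ->
  hit (sel_index j0 k0 n x) (k0 + n) x /\
  `|c (sel_index j0 k0 n.+1 x) - c (sel_index j0 k0 n x)| < 2 * 2^-1 ^+ (k0 + n).
Proof.
move=> h0.
have step p : hit (sel_index j0 k0 p x) (k0 + p) x ->
    hit (sel_index j0 k0 p.+1 x) (k0 + p.+1) x /\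
    `|c (sel_index j0 k0 p.+1 x) - c (sel_index j0 k0 p x)| < 2 * 2^-1 ^+ (k0 + p).
  move=> hp; pose Q j := hit j (k0 + p.+1) x /\
    `|c j - c (sel_index j0 k0 p x)| < 2 * 2^-1 ^+ (k0 + p).
  suff exQ : exists j, Q j by exact: (leastP exQ).1.
  have [a Ka ca] := hit_near hp.
  have e0 : 0 < 2^-1 ^+ (k0 + p) :> R by rewrite exprn_gt0.
  have [j hj cj] := hit_dense (k0 + p.+1) Ka e0.
  exists j; split => //.
  have -> : c j - c (sel_index j0 k0 p x) = (c j - a) - (c (sel_index j0 k0 p x) - a).
    by rewrite opprB addrA subrK.
  by apply: le_lt_trans (ler_normB _ _) _; lra.
elim: n => [|n [IH _]].
  have h0' : hit (sel_index j0 k0 0 x) (k0 + 0) x by rewrite addn0.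
  by split => //; exact: (step _ h0').2.
by have [h _] := step n IH; split => //; exact: (step _ h).2.
Qed.

Definition selection j0 k0 x : V :=
  if `[< hit j0 k0 x >] then \row_i limn (fun n => c (sel_index j0 k0 n x) 0 i)
  else s0 x.

Lemma selection_cvg j0 k0 x i : hit j0 k0 x ->
  let u n := c (sel_index j0 k0 n x) 0 i in
  cvgn u /\ forall n, `|limn u - u n| <= 4 * 2^-1 ^+ (k0 + n).
Proof.
move=> h u.
have hu n : `|u n.+1 - u n| <= 2 * 2^-1 ^+ k0 * 2^-1 ^+ n.
  have [_ /ltW hn] := sel_index_hit n h.
  rewrite -mulrA -exprD; apply: le_trans hn.
  by have := le_coord_norm (c (sel_index j0 k0 n.+1 x) - c (sel_index j0 k0 n x)) i; rewrite !mxE.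
have [cu lu] := geometric_limit hu; split => // n.
by apply: le_trans (lu n) _; rewrite exprD; lra.
Qed.

Lemma selection_near j0 k0 x n : hit j0 k0 x ->
  `|selection j0 k0 x - c (sel_index j0 k0 n x)| <= 4 * 2^-1 ^+ (k0 + n).
Proof.
move=> h; rewrite [leLHS]/Num.norm /= mx_normrE; apply/bigmax_leP; split.
  by rewrite mulr_ge0// exprn_ge0.
move=> [i j] _ /=; rewrite (ord1 i) /selection asboolT// !mxE.
by have [_] := selection_cvg j h; exact.
Qed.

Lemma selection_closure j0 k0 x : closure (K x) (selection j0 k0 x).
Proof.
have [h|nh] := pselect (hit j0 k0 x); last by rewrite /selection asboolF.
apply/closure_ballP => e e0.
have [n hn] := exists_half_pow (divr_gt0 e0 (ltr0Sn R 4)).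
have [hitn _] := sel_index_hit n h.
have [a Ka ca] := hit_near hitn; exists a => //.
have -> : selection j0 k0 x - a = (selection j0 k0 x - c (sel_index j0 k0 n x)) +
   (c (sel_index j0 k0 n x) - a) by rewrite addrA subrK.
apply: le_lt_trans (ler_normD _ _) _.
have le2 : 2^-1 ^+ (k0 + n) <= 2^-1 ^+ n :> R.
  by rewrite exprD ler_piMl ?exprn_ge0// exprn_ile1// invf_le1// ler1n.
by have := selection_near n h; lra.
Qed.

Lemma measurable_selection j0 k0 : measurable_fun [set: X] (selection j0 k0).
Proof.
apply: measurable_fun_rV => i.
pose F n x := if `[< hit j0 k0 x >] then c (sel_index j0 k0 n x) 0 i else s0 x 0 i.
apply: (@measurable_fun_cvg _ _ _ _ F) => [n|x _]; last first.
  rewrite /F /selection; case: asboolP => h; last exact: cvg_cst.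
  by rewrite mxE; have [] := selection_cvg i h.
have mb : measurable_fun [set: X] (fun x => `[< hit j0 k0 x >]).
  apply: (@measurable_fun_bool _ _ _ _ true).
  rewrite setTI (_ : _ @^-1` _ = [set x | hit j0 k0 x])//.
  by apply/seteqP; split => x /= /asboolP.
apply: measurable_fun_if => //; last first.
  by apply: measurable_funTS; exact: measurable_coord_comp.
apply: measurable_funTS => _ B mB; rewrite setTI.
rewrite (_ : _ @^-1` B = \bigcup_j ([set x | sel_index j0 k0 n x = j] `&` [set _ | B (c j 0 i)])); last first.
  apply/seteqP; split => x /=; first by move=> h; exists (sel_index j0 k0 n x).
  by move=> [j _ [/= -> h]].
apply: bigcup_measurable => j _; apply: measurableI; first exact: measurable_sel_index.
have [h|h] := pselect (B (c j 0 i)).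
  by rewrite (_ : mkset _ = setT)//; apply/seteqP; split.
by rewrite (_ : mkset _ = set0)//; apply/seteqP; split.
Qed.

Lemma selection_dense x a e : K x a -> 0 < e ->
  exists j k, `|selection j k x - a| < e.
Proof.
move=> Ka e0.
have [k hk] := exists_half_pow (divr_gt0 e0 (ltr0Sn R 4)).
have p0 : 0 < 2^-1 ^+ k :> R by rewrite exprn_gt0.
have [j hj cj] := hit_dense k Ka p0.
exists j, k; have := selection_near 0 hj; rewrite /= addn0 => h.
have -> : selection j k x - a = (selection j k x - c j) + (c j - a) by rewrite addrA subrK.
by apply: le_lt_trans (ler_normD _ _) _; lra.
Qed.

End MeasurableSelection.

Section BorelComponents.
Context (R : realType) (d : nat).
Local Notation V := 'rV[R]_d.
Variable I : V -> set V.
Hypothesis I_borel : forall U : set (wijsman R d), open U ->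
  measurable [set x : V | U (closure (I x))].
Hypothesis I_refl : forall x, I x x.

(** Proximity is measured in the Euclidean norm because the Wijsman topology is
    the initial one for Euclidean distances; every other estimate uses the
    maximum norm. *)
Definition hits j k x :=
  exists2 a, closure (I x) a & enorm (rat_rV R d j - a) < 2^-1 ^+ k.

Lemma dist_to_lt (A : set V) y r : A !=set0 ->
  dist_to A y < r <-> exists2 a, A a & enorm (y - a) < r.
Proof.
move=> [a0 Aa0]; rewrite /dist_to.
have hi : has_inf [set enorm (y - a) | a in A].
  split; first by exists (enorm (y - a0)), a0.
  by exists 0 => _ [a _ <-]; exact: sqrtr_ge0.
split=> [h|[a Aa h]].
  have [_ [a Aa <-]] := inf_lt hi.1 h; by exists a.
by apply: le_lt_trans h; apply: (ge_inf hi.2); exists a.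
Qed.

Lemma measurable_hits j k : measurable [set x | hits j k x].
Proof.
have oU : open ([set A | dist_to A (rat_rV R d j) < 2^-1 ^+ k] : set (wijsman R d)).
  have -> : [set A | dist_to A (rat_rV R d j) < 2^-1 ^+ k] =
      (@dist_to R d : wijsman R d -> {ptws V -> R}) @^-1`
      ((fun g : {ptws V -> R} => g (rat_rV R d j)) @^-1` `]-oo, 2^-1 ^+ k[%classic).
    by apply/seteqP; split => A /=; rewrite in_itv.
  apply: open_comp; first by move=> A _; exact: initial_continuous.
  apply: open_comp; last exact: interval_open.
  by move=> g _; exact: (@proj_continuous V (fun=> R) (rat_rV R d j) g).
have := I_borel oU; congr measurable; apply/seteqP; split => x /=.
  by move/dist_to_lt; apply; exists x; exact: subset_closure.
by move=> h; apply/dist_to_lt => //; exists x; exact: subset_closure.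
Qed.

Lemma hits_near j k x : hits j k x ->
  exists2 a, closure (I x) a & `|rat_rV R d j - a| < 2^-1 ^+ k.
Proof. by move=> [a ca h]; exists a => //; apply: le_lt_trans h; exact: le_norm_enorm. Qed.

Lemma hits_dense x a k e : closure (I x) a -> 0 < e ->
  exists2 j, hits j k x & `|rat_rV R d j - a| < e.
Proof.
move=> ca e0; pose r := Num.min e (2^-1 ^+ k / (1 + d%:R)).
have d0 : 0 < 1 + d%:R :> R by rewrite ltr_pwDl.
have r0 : 0 < r by rewrite lt_min e0 divr_gt0// exprn_gt0.
have [j] := rat_rV_dense a r0; rewrite distrC lt_min => /andP[h1 h2].
exists j => //; exists a => //; apply: le_lt_trans (enorm_le_norm _) _.
apply: (@le_lt_trans _ _ ((1 + d%:R) * `|rat_rV R d j - a|)).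
  by rewrite ler_wpM2r// lerDr.
by rewrite mulrC -ltr_pdivlMr.
Qed.

(** This turns the closure into countably many conditions that are measurable
    in the base point. *)
Lemma closure_hitsP x z : closure (I x) z <->
  forall k, exists j, `|z - rat_rV R d j| < 2^-1 ^+ k /\ hits j k x.
Proof.
split=> [cz k|h].
  have [|j hj zj] := hits_dense k cz (e := 2^-1 ^+ k); first by rewrite exprn_gt0.
  by exists j; rewrite distrC.
have -> : closure (I x) = closure (closure (I x)) by apply/closure_id/closed_closure.
apply/closure_ballP => e e0.
have [k hk] := exists_half_pow (divr_gt0 e0 (ltr0Sn R 1)).
have [j [zj /hits_near[a Ia ja]]] := h k; exists a => //.
have -> : z - a = (z - rat_rV R d j) + (rat_rV R d j - a) by rewrite addrA subrK.
by apply: le_lt_trans (ler_normD _ _) _; lra.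
Qed.

Hypothesis I_convex : forall x, @convex_set R V (I x).
Hypothesis I_ri : forall x, ri (I x) = I x.

(** By [ri_memP] the component is described by its closure, and the closure by
    rational approximation, which is Borel in both variables. *)
Lemma measurable_graph : measurable [set w : V * V | I w.1 w.2].
Proof.
have -> : [set w : V * V | I w.1 w.2] = \bigcup_n \bigcap_k \bigcup_j
    ([set w | `|(w.2 + n.+1%:R^-1 *: (w.2 - w.1)) - rat_rV R d j| < 2^-1 ^+ k] `&`
     fst @^-1` [set x | hits j k x]).
  apply/seteqP; split => -[x y] /=.
    move=> /(ri_memP y (@I_convex x) (I_ri x) (I_refl x))[n /closure_hitsP h].
    by exists n => // k _; have [j [h1 h2]] := h k; exists j.
  move=> [n _ h]; apply/(ri_memP y (@I_convex x) (I_ri x) (I_refl x)).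
  exists n; apply/closure_hitsP => k; have [j _ [h1 h2]] := h k Logic.I.
  by exists j.
apply: bigcup_measurable => n _; apply: bigcap_measurableType => k _.
apply: bigcup_measurable => j _; apply: measurableI.
  apply: measurable_dist_lt; last exact: measurable_cst.
  apply: measurable_rVD; first exact: measurable_snd.
  apply: measurable_rVZ; apply: measurable_rVB; [exact: measurable_snd|exact: measurable_fst].
rewrite -[X in measurable X]setTI; apply: measurable_fst => //.
exact: measurable_hits.
Qed.

(** Measurable selections of the closures, contracted towards the base point
    so as to land in the relatively open sets themselves. *)
Lemma dense_selections : exists s : nat -> V -> V,
  [/\ forall n, measurable_fun [set: V] (s n), forall n x, I x (s n x) &
      forall x y e, I x y -> 0 < e -> exists n, `|y - s n x| < e].
Proof.
have hn j k x : hits j k x ->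
    exists2 a, closure (I x) a & `|rat_rV R d j - a| < 2^-1 ^+ k by exact: hits_near.
have hs0 x : closure (closure (I x)) (id x).
  by apply: subset_closure; apply: subset_closure.
pose sel := selection hits id.
have clsel j k x : closure (I x) (sel j k x).
  have : closure (closure (I x)) (sel j k x).
    exact: (selection_closure (K := fun x => closure (I x)) hn hits_dense hs0).
  by rewrite (_ : closure (closure (I x)) = closure (I x))//; apply/esym/closure_id/closed_closure.
(* A selection is indexed by its starting point, its starting precision and
   the amount by which it is contracted. *)
pose dec n : nat * (nat * nat) := odflt (0, (0, 0))%N (unpickle n).
pose s n x := (dec n).2.2.+1%:R^-1 *: x +
  (1 - (dec n).2.2.+1%:R^-1) *: sel (dec n).1 (dec n).2.1 x.
exists s; split.
- move=> n; apply: measurable_rVD; apply: measurable_rVZ; first exact: measurable_id.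
  exact: (measurable_selection measurable_hits hn hits_dense (@measurable_id _ _ _)).
- move=> n x; have := I_refl x; rewrite -{1}I_ri => /riP[Ix [e e0 he]].
  apply: (convex_segment (@I_convex x) Ix e0 he (clsel _ _ _)).
  by rewrite invr_gt0 ltr0n/= invf_le1 ?ltr0n// ler1n.
- move=> x y e Ixy e0.
  have cy : closure (I x) y by exact: subset_closure.
  have e2 : 0 < e / 2 by rewrite divr_gt0.
  have [j [k hjk]] := selection_dense id hn hits_dense cy e2.
  have [m hm] : exists m : nat, `|x - sel j k x| / (e / 2) < m.+1%:R.
    have [l hl] : exists l : nat, `|x - sel j k x| / (e / 2) <= l%:R.
      exists (Num.bound (`|x - sel j k x| / (e / 2))); apply: ltW.
      by apply: archi_boundP; rewrite divr_ge0// ltW.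
    by exists l; apply: le_lt_trans hl _; rewrite ltr_nat.
  exists (pickle (j, (k, m))); rewrite /s /dec pickleK /=.
  have -> : y - (m.+1%:R^-1 *: x + (1 - m.+1%:R^-1) *: sel j k x) =
     (y - sel j k x) - m.+1%:R^-1 *: (x - sel j k x).
    rewrite scalerBr scalerBl scale1r !opprD !opprK !addrA; congr (_ + _).
    exact: addrAC.
  apply: le_lt_trans (ler_normB _ _) _; rewrite normrZ gtr0_norm ?invr_gt0 ?ltr0n//.
  have h2 : m.+1%:R^-1 * `|x - sel j k x| < e / 2.
    by rewrite mulrC ltr_pdivrMr ?ltr0n// mulrC -ltr_pdivrMr.
  by rewrite [ltRHS]splitr; apply: ltrD => //; rewrite distrC.
Qed.

End BorelComponents.

(** * Borel versions on the components *)

Section BorelRestriction.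
Context (R : realType) (d : nat).
Local Notation V := 'rV[R]_d.
Variables (mu : probability V R) (I : V -> set V).
Hypothesis I_borel : forall U : set (wijsman R d), open U ->
  measurable [set x : V | U (closure (I x))].
Hypothesis I_refl : forall x, I x x.
Hypothesis I_convex : forall x, @convex_set R V (I x).
Hypothesis I_ri : forall x, ri (I x) = I x.
Variables (theta : V * V -> \bar R) (N0 : set V).
Hypothesis mN0 : measurable N0.
Hypothesis N00 : mu N0 = 0%E.
Hypothesis btheta : forall P : probability (V * V)%type R, almost_borel P theta.
Hypothesis theta_fin : forall x y, ~ N0 x -> I x y -> theta (x, y) \is a fin_num.
Hypothesis theta_jensen : forall x, ~ N0 x ->
  forall (n : nat) (a : 'I_n -> V) (t : 'I_n -> R),
  (forall i, I x (a i)) -> (forall i, 0 <= t i) -> \sum_i t i = 1 ->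
  (theta (x, (\sum_i t i *: a i)%R) <= \sum_i (t i)%:E * theta (x, a i))%E.

Lemma theta_continuous x y e : ~ N0 x -> I x y -> 0 < e ->
  exists2 r, 0 < r & forall z, I x z -> `|y - z| < r ->
    `|fine (theta (x, z)) - fine (theta (x, y))| < e.
Proof.
move=> nx Ixy e0.
have [|L [r [L0 r0 hL]]] := @convex_locally_lipschitz _ _ (I x)
  (fun z => fine (theta (x, z))) (@I_convex x) (I_ri x) _ y Ixy.
  move=> n a t Ia t0 t1.
  have Isum : I x (\sum_i t i *: a i) by exact: convex_comb.
  have sE : (\sum_i (t i)%:E * theta (x, a i) = (\sum_i t i * fine (theta (x, a i)))%:E)%E.
    rewrite -sumEFin; apply: eq_bigr => i _.
    by rewrite EFinM fineK//; exact: theta_fin.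
  by rewrite -lee_fin -sE fineK; [exact: theta_jensen|exact: theta_fin].
exists (Num.min r (e / (1 + L))); first by rewrite lt_min r0 divr_gt0// ltr_pwDl.
move=> z Iz; rewrite lt_min => /andP[yr ye]; apply: le_lt_trans (hL z Iz yr) _.
apply: (@le_lt_trans _ _ ((1 + L) * `|y - z|)); first by rewrite ler_wpM2r// lerDr.
by rewrite mulrC -ltr_pdivlMr// ltr_pwDl.
Qed.

(** On each fibre the function is determined by its values along countably
    many measurable selections; those values are Borel in the base point off a
    null set. *)
Lemma borel_restriction : exists Nmu : set V,
  [/\ measurable Nmu, mu Nmu = 0%E, N0 `<=` Nmu &
      measurable_fun [set: V * V] (theta \_ [set w | ~ Nmu w.1 /\ I w.1 w.2])].
Proof.
have [s [ms Is sdense]] := dense_selections I_borel I_refl I_convex I_ri.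
pose graph n (x : V) : V * V := (x, s n x).
have mgraph n : measurable_fun [set: V] (graph n) by exact: measurable_fun_pair.
have /choice[g hg] n : exists g : V -> \bar R, measurable_fun [set: V] g /\
    mu.-negligible [set x | theta (graph n x) <> g x].
  pose X : {mfun V >-> (V * V)%type} := HB.pack (graph n) (isMeasurableFun.Build _ _ _ _ (graph n) (mgraph n)).
  have [h mh [Z [mZ Z0 hZ]]] := btheta (distribution mu X).
  exists (h \o graph n); split; first exact: measurableT_comp.
  exists (graph n @^-1` Z); split => //.
    by rewrite -[X in measurable X]setTI; exact: (mgraph n measurableT).
  by move=> x /= ne; apply: hZ.
have [Z [mZ Z0 hZ]] : mu.-negligible (\bigcup_n [set x | theta (graph n x) <> g n x]).
  by apply: negligible_bigcup => n; have [_] := hg n; exact.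
pose Nmu := N0 `|` Z.
have gE n x : ~ Nmu x -> theta (x, s n x) = g n x.
  move=> nx; apply: contrapT => ne; apply: nx; right; apply: hZ; by exists n.
exists Nmu; split.
- exact: measurableU.
- by apply: null_set_setU.
- by move=> x; left.
(* The value at a point is approached along the first selection found within
   the k-th precision. *)
pose near_sel k n (w : V * V) := `|w.2 - s n w.1| < 2^-1 ^+ k.
have mnear k n : measurable [set w | near_sel k n w].
  apply: measurable_dist_lt; first exact: measurable_snd.
  exact: (measurableT_comp (ms n) measurable_fst).
pose idx k w := least (near_sel k ^~ w).
pose G k w := g (idx k w) w.1.
have mG k : measurable_fun [set: V * V] (G k).
  move=> _ B mB; rewrite setTI.
  rewrite (_ : _ @^-1` B = \bigcup_n ([set w | idx k w = n] `&` fst @^-1` (g n @^-1` B))); last first.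
    apply/seteqP; split => w /=; first by move=> h; exists (idx k w).
    by move=> [n _ [/= + h]]; rewrite /G => ->.
  apply: bigcup_measurable => n _; apply: measurableI; first exact: measurable_least.
  have [mg _] := hg n.
  rewrite -[X in measurable X]setTI; apply: measurable_fst => //.
  by rewrite -[X in measurable X]setTI; exact: mg.
set A := [set w | _].
have mA : measurable A.
  apply: measurableI; last exact: measurable_graph.
  rewrite -[X in measurable X]setTI.
  by apply: (@measurable_fst _ _ V V measurableT (~` Nmu)); apply: measurableC; exact: measurableU.
apply: (@emeasurable_fun_cvg _ _ _ _ (fun k => G k \_ A)) => [k|[x y] _].
  by apply/(measurable_restrictT _ _).1 => //; exact: measurable_funTS.
have [Aw|nA] := pselect (A (x, y)); last first.
  rewrite patchE memNset//; under eq_fun do rewrite patchE memNset//.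
  exact: cvg_cst.
rewrite patchE mem_set//; under eq_fun do rewrite patchE mem_set//.
have [/= nx Ixy] := Aw; have n0x : ~ N0 x by move=> h; apply: nx; left.
rewrite -(fineK (theta_fin n0x Ixy)).
have Gfin k : G k (x, y) = (fine (theta (x, s (idx k (x, y)) x)))%:E.
  by rewrite /G /= -gE// fineK//; exact: theta_fin.
rewrite (_ : (fun k => G k (x, y)) = EFin \o (fun k => fine (theta (x, s (idx k (x, y)) x)))); last first.
  by apply/funext => k /=; exact: Gfin.
apply: cvg_EFin; first by apply: nearW.
apply/cvgrPdist_lt => e e0.
have [r r0 hr] := theta_continuous n0x Ixy e0.
have [p hp] := exists_half_pow r0.
exists p => // k /= pk; rewrite distrC; apply: hr => //.
have /leastP[h _] : exists n, near_sel k n (x, y).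
  by apply: sdense => //; rewrite exprn_gt0.
apply: lt_le_trans h _; apply: ltW; apply: le_lt_trans hp.
by rewrite ler_wiXn2l// invf_le1// ler1n.
Qed.

End BorelRestriction.

(** * Supports and finitely supported measures *)

Section Support.
Context (R : realType).

(** With an abstract notion of null set, one covering argument serves the space
    and its square, on which the sigma-algebra is a product and the open sets
    come with their own basis of boxes. *)
Lemma negligible_supp (T : topologicalType) (m : set T -> \bar R)
    (neg : set T -> Prop) (B : nat -> set T) :
  (forall A A', A `<=` A' -> neg A' -> neg A) ->
  (forall F : nat -> set T, (forall k, neg (F k)) -> neg (\bigcup_k F k)) ->
  neg set0 ->
  (forall C, closed C -> m (~` C) = 0%E -> neg (~` C)) ->
  (forall U x, open U -> U x -> exists2 n, B n x & B n `<=` U) ->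
  neg (~` supp m).
Proof.
move=> negS negU neg0 mneg base.
pose F n := if `[< neg (B n) >] then B n else set0.
apply: (negS _ (\bigcup_n F n)); last first.
  by apply: negU => n; rewrite /F; case: asboolP.
move=> x /=; rewrite /supp => nx.
have [C [cC [mC nCx]]] : exists C, closed C /\ m (~` C) = 0%E /\ ~ C x.
  apply: contrapT => h; apply: nx => C [cC mC]; apply: contrapT => nCx.
  by apply: h; exists C.
have [n Bnx BC] := base _ x (closed_openC cC) nCx.
exists n => //; rewrite /F asboolT//.
by apply: negS BC _; exact: mneg.
Qed.

Section RowVectors.
Context (d : nat).
Local Notation V := 'rV[R]_d.

Definition rat_ball (n : nat) : set V :=
  let nk := odflt (0, 0)%N (unpickle n) in
  [set y | `|y - rat_rV R d nk.1| < 2^-1 ^+ nk.2].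

Lemma rat_ball_base (U : set V) x : nbhs x U ->
  exists2 n, rat_ball n x & rat_ball n `<=` U.
Proof.
move=> /nbhs_ballP[e /= e0 eU].
have [k hk] := exists_half_pow (divr_gt0 e0 (ltr0Sn R 1)).
have [j hj] := rat_rV_dense x (exprn_gt0 k (ltac:(by rewrite invr_gt0) : 0 < 2^-1 :> R)).
exists (pickle (j, k)); rewrite /rat_ball pickleK//= => y /= hy.
apply: eU; rewrite -ball_normE /=.
have -> : x - y = (x - rat_rV R d j) - (y - rat_rV R d j) by rewrite opprB addrA subrK.
by apply: le_lt_trans (ler_normB _ _) _; lra.
Qed.

Lemma negligible_supp_rV (m : {measure set V -> \bar R}) : m.-negligible (~` supp m).
Proof.
apply: (@negligible_supp V m m.-negligible rat_ball).
- by move=> A A'; exact: negligibleS.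
- by move=> F; exact: negligible_bigcup.
- exact: negligible_set0.
- move=> C cC mC; exists (~` C); split => //.
  by apply: open_measurable_rV; exact: closed_openC.
- by move=> U x oU Ux; apply: rat_ball_base; exact: open_nbhs_nbhs.
Qed.

Definition rat_box (n : nat) : set (V * V) :=
  let kl := odflt (0, 0)%N (unpickle n) in rat_ball kl.1 `*` rat_ball kl.2.

Lemma rat_box_base (U : set (V * V)%type) w : open U -> U w ->
  exists2 n, rat_box n w & rat_box n `<=` U.
Proof.
case: w => x y oU Uxy; have [[A B] /= [nA nB] AB] := open_nbhs_nbhs (conj oU Uxy).
have [k Bkx kA] := rat_ball_base nA; have [l Bly lB] := rat_ball_base nB.
exists (pickle (k, l)); rewrite /rat_box pickleK//= => -[x' y'] [/= h1 h2].
by apply: AB; split; [exact: kA|exact: lB].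
Qed.

Lemma measurable_rat_ball n : measurable (rat_ball n).
Proof.
by apply: measurable_dist_lt; [exact: measurable_id|exact: measurable_cst].
Qed.

Lemma open_measurable_prod (U : set (V * V)%type) : open U -> measurable U.
Proof.
move=> oU; have -> : U = \bigcup_(n in [set n | rat_box n `<=` U]) rat_box n.
  apply/seteqP; split => w; first by move=> Uw; have [n] := rat_box_base oU Uw; exists n.
  by move=> [n /= nU]; exact: nU.
apply: bigcup_measurable => n _; apply: measurableX; exact: measurable_rat_ball.
Qed.

Lemma negligible_supp_prod (m : {measure set (V * V) -> \bar R}) :
  m.-negligible (~` supp m).
Proof.
apply: (@negligible_supp (V * V)%type m m.-negligible rat_box).
- by move=> A A'; exact: negligibleS.
- by move=> F; exact: negligible_bigcup.
- exact: negligible_set0.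
- move=> C cC mC; exists (~` C); split => //.
  by apply: open_measurable_prod; exact: closed_openC.
- by move=> U x oU Ux; exact: rat_box_base.
Qed.

Lemma measurable_prod_set1 (w : V * V) : measurable [set w].
Proof.
have -> : [set w] = [set w.1] `*` [set w.2].
  by apply/seteqP; split => [_ -> //|[x y] [/= -> ->]]; case: w.
by apply: measurableX; exact: measurable_rV_set1.
Qed.

End RowVectors.
End Support.

Section FiniteSupport.
Context (R : realType) (disp : measure_display) (T : measurableType disp).
Variables (P : probability T R) (s : seq T).
Hypothesis us : uniq s.
Hypothesis m1 : forall x : T, measurable [set x].
Hypothesis Ps : P.-negligible (~` [set` s]).

Definition mass (x : T) : R := fine (P [set x]).

Lemma mass_ge0 x : 0 <= mass x.
Proof. by rewrite fine_ge0. Qed.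

Lemma massE x : (mass x)%:E = P [set x].
Proof. by rewrite fineK//; exact: fin_num_measure. Qed.

Lemma ge0_integral_finite (f : T -> \bar R) : (forall x, 0 <= f x)%E ->
  (\int[P]_x f x = \sum_(a <- s) (mass a)%:E * f a)%E.
Proof.
move=> f0; pose h a : T -> \bar R := cst (f a) \_ [set a].
have h0 a x : (0 <= h a x)%E by rewrite /h patchE; case: ifP => _ //; exact: f0.
have mh a : measurable_fun [set: T] (h a).
  by apply/(measurable_restrictT _ _).1; [exact: m1|exact: measurable_cst].
rewrite (@ge0_eq_integral_negligible _ _ _ P _ (fun x => \sum_(a <- s) h a x)%E)//.
- rewrite ge0_integral_sum//; apply: eq_bigr => a _.
  rewrite /h -integral_mkcond integral_cst// muleC; congr (_ * _)%E.
  exact/esym/massE.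
- by move=> x; apply: sume_ge0.
- apply: negligibleS Ps => x /= ne; apply: contra_not ne => xs.
  rewrite (bigD1_seq x)//= big1 ?adde0; first by rewrite /h patchE mem_set.
  move=> a ax; rewrite /h patchE memNset//= => xa.
  by move: ax; rewrite xa eqxx.
Qed.

Lemma integral_finite (f : T -> R) :
  (\int[P]_x (f x)%:E = (\sum_(a <- s) mass a * f a)%:E)%E.
Proof.
rewrite integralE !ge0_integral_finite//.
have fp a : ((EFin \o f)^\+ a)%E = (Num.max (f a) 0)%:E by rewrite funeposE EFin_max.
have fn a : ((EFin \o f)^\- a)%E = (Num.max (- f a) 0)%:E by rewrite funenegE EFin_max.
rewrite (eq_bigr (fun a => (mass a * Num.max (f a) 0)%:E)) => [|a _]; last by rewrite EFinM -fp.
rewrite [X in (_ - X)%E](eq_bigr (fun a => (mass a * Num.max (- f a) 0)%:E)) => [|a _]; last first.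
  by rewrite EFinM -fn.
rewrite !sumEFin -EFinB -sumrB; congr (_%:E); apply: eq_bigr => a _.
rewrite -mulrBr; congr (_ * _); have /orP[fa|fa] := le_total 0 (f a).
  by rewrite max_l// max_r ?oppr_le0// subr0.
by rewrite max_r// max_l ?oppr_ge0// sub0r opprK.
Qed.

Lemma prob_finite (A : set T) : measurable A ->
  P A = (\sum_(a <- s) mass a * \1_A a)%:E.
Proof. by move=> mA; rewrite -integral_finite integral_indic// setIT. Qed.

End FiniteSupport.

Section Competitors.
Context (R : realType) (d : nat).
Local Notation V := 'rV[R]_d.
Local Notation Omega := (V * V)%type.
Implicit Types P Q : probability Omega R.

Lemma measurable_fst_preimage (A : set V) : measurable A ->
  measurable (fst @^-1` A : set Omega).
Proof. by move=> mA; rewrite -[X in measurable X]setTI; exact: measurable_fst. Qed.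

Lemma measurable_snd_preimage (A : set V) : measurable A ->
  measurable (snd @^-1` A : set Omega).
Proof. by move=> mA; rewrite -[X in measurable X]setTI; exact: measurable_snd. Qed.

(** Both measures live on the grid spanned by the two projections of the
    support of the first. *)
Lemma competitor_support P Q (A : set Omega) :
  finitely_supported_in P A -> competitor Q P ->
  exists s : seq Omega, [/\ uniq s, P.-negligible (~` [set` s]) &
    Q.-negligible (~` [set` s])].
Proof.
move=> [/finite_seqP[s0 sE] _] [marg _].
pose s := undup [seq (a, b) | a <- map fst s0, b <- map snd s0].
have Ps0 : P.-negligible (~` [set` s0]) by rewrite -sE; exact: negligible_supp_prod.
have s0s : [set` s0] `<=` [set` s].
  move=> [a b] /= ab; rewrite mem_undup; apply/allpairsP; exists (a, b) => /=.
  by split => //; apply/mapP; exists (a, b).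
exists s; split; first exact: undup_uniq.
  by apply: negligibleS Ps0; exact: subsetC.
have mfin (l : seq V) : measurable (~` [set` l]).
  apply: measurableC; rewrite (_ : [set` l] = \bigcup_(x in [set` l]) [set x]).
    by apply: fin_bigcup_measurable => [|x _]; [exact: finite_seq|exact: measurable_rV_set1].
  by apply/seteqP; split => [x xl|x [y yl ->]]; [exists x|].
have h (phi : Omega -> V) :
    (forall B, measurable B -> measurable (phi @^-1` B)) ->
    (forall B, measurable B -> Q (phi @^-1` B) = P (phi @^-1` B)) ->
    Q.-negligible (phi @^-1` (~` [set` map phi s0])).
  move=> mphi PQ; have mB := mphi _ (mfin (map phi s0)).
  exists (phi @^-1` (~` [set` map phi s0])); split => //.
  rewrite PQ//; apply: measure_negligible => //.
  by apply: negligibleS Ps0 => w /= nw ws; apply: nw; apply/mapP; exists w.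
have h1 := h fst measurable_fst_preimage (fun B mB => (marg B mB).1).
have h2 := h snd measurable_snd_preimage (fun B mB => (marg B mB).2).
apply: negligibleS (negligibleU h1 h2) => -[a b] /= nab.
apply: contrapT => /not_orP[/contrapT /= na /contrapT /= nb]; apply: nab.
rewrite mem_undup; apply/allpairsP; by exists (a, b); split.
Qed.

Section Sums.
Variables (P Q : probability Omega R) (s : seq Omega).
Hypothesis us : uniq s.
Hypothesis Ps : P.-negligible (~` [set` s]).
Hypothesis Qs : Q.-negligible (~` [set` s]).

Variable phi : Omega -> V.
Hypothesis mphi : forall B, measurable B -> measurable (phi @^-1` B).

Lemma sum_group (p : Omega -> R) (h : V -> R) (k : Omega -> R) :
  \sum_(w <- s) p w * (h (phi w) * k w) =
  \sum_(a <- undup (map phi s)) h a *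
    (\sum_(w <- s) p w * (\1_(phi @^-1` [set a]) w * k w)).
Proof.
under [RHS]eq_bigr do rewrite mulr_sumr; rewrite exchange_big /=.
apply: eq_big_seq => w ws; rewrite (bigD1_seq (phi w)) ?undup_uniq//=; last first.
  by rewrite mem_undup; apply/mapP; exists w.
rewrite big1 ?addr0 => [|a aw].
  by rewrite indicE mem_set// mul1r mulrCA.
rewrite indicE memNset ?mul0r ?mulr0//= => wa.
by move: aw; rewrite wa eqxx.
Qed.

Hypothesis PQ : forall B, measurable B -> Q (phi @^-1` B) = P (phi @^-1` B).

Lemma sum_marginal (h : V -> R) :
  \sum_(w <- s) mass P w * h (phi w) = \sum_(w <- s) mass Q w * h (phi w).
Proof.
have E p : \sum_(w <- s) p w * h (phi w) = \sum_(w <- s) p w * (h (phi w) * 1).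
  by apply: eq_bigr => w _; rewrite mulr1.
rewrite !E !sum_group; apply: eq_bigr => a _; congr (_ * _).
under eq_bigr do rewrite mulr1; under [RHS]eq_bigr do rewrite mulr1.
have m1 := @measurable_prod_set1 R d.
have ma := mphi (measurable_rV_set1 a).
apply: EFin_inj; rewrite -(prob_finite us m1 Ps ma) -(prob_finite us m1 Qs ma).
by rewrite PQ//; exact: measurable_rV_set1.
Qed.

End Sums.

(** Grouping by the first coordinate reduces the conditional expectation to its
    defining equations on the finitely many atoms of the first marginal. *)
Lemma sum_condexp P (s : seq Omega) (g q : V -> V) : uniq s ->
  P.-negligible (~` [set` s]) -> is_condexp P g ->
  \sum_(w <- s) mass P w * dotp (q w.1) w.2 =
  \sum_(w <- s) mass P w * dotp (q w.1) (g w.1).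
Proof.
move=> us Ps [_ ce].
have E (k : Omega -> V) : \sum_(w <- s) mass P w * dotp (q w.1) (k w) =
    \sum_i \sum_(w <- s) mass P w * (q w.1 0 i * k w 0 i).
  rewrite exchange_big; apply: eq_bigr => w _.
  by rewrite /dotp mulr_sumr.
rewrite (E snd) (E (g \o fst)); apply: eq_bigr => i _.
rewrite !(sum_group s fst _ (fun v => q v 0 i)); apply: eq_bigr => a _; congr (_ * _).
have [_ _ /(_ [set a] (measurable_rV_set1 a))] := ce i.
have m1 := @measurable_prod_set1 R d.
have F (k : Omega -> R) : (\int[P]_(w in fst @^-1` [set a]) (k w)%:E =
    (\sum_(w <- s) mass P w * (\1_(fst @^-1` [set a]) w * k w))%:E)%E.
  rewrite integral_mkcond -(integral_finite us m1 Ps); apply: eq_integral => w _.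
  by rewrite patchE indicE; case: ifP => _; rewrite ?mul1r ?mul0r.
by rewrite !F => -[].
Qed.

(** The two variables separate, up to a term that is linear in the second one
    and that the conditional expectation turns into a function of the first. *)
Lemma tangent_Tp_competitor P Q (A : set Omega) (f : V -> R) (p : V -> V) :
  (forall w, 0 <= tangent_Tp f p w)%E ->
  finitely_supported_in P A -> competitor Q P ->
  (\int[Q]_w tangent_Tp f p w = \int[P]_w tangent_Tp f p w)%E.
Proof.
move=> T0 fP cQ; have [s [us Ps Qs]] := competitor_support fP cQ.
have [marg [g ceP ceQ]] := cQ.
have m1 := @measurable_prod_set1 R d.
have E (P' : probability Omega R) : P'.-negligible (~` [set` s]) -> is_condexp P' g ->
    (\int[P']_w tangent_Tp f p w = (\sum_(w <- s) mass P' w * f w.2 -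
      \sum_(w <- s) mass P' w * (f w.1 - dotp (p w.1) w.1) -
      \sum_(w <- s) mass P' w * dotp (p w.1) (g w.1))%:E)%E.
  move=> P's ce; rewrite (integral_finite us m1 P's); congr (_%:E).
  rewrite -(sum_condexp p us P's ce) -!sumrB; apply: eq_bigr => w _.
  by rewrite -!mulrBr; congr (_ * _); rewrite dotpBr; lra.
have PQ1 B (mB : measurable B) := (marg B mB).1.
have PQ2 B (mB : measurable B) := (marg B mB).2.
have mar1 := sum_marginal us Ps Qs measurable_fst_preimage PQ1.
have mar2 := sum_marginal us Ps Qs measurable_snd_preimage PQ2.
rewrite (E P Ps ceP) (E Q Qs ceQ) (mar2 f).
by rewrite (mar1 (fun v => f v - dotp (p v) v)) (mar1 (fun v => dotp (p v) (g v))).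
Qed.

(** Integrals against finitely supported measures are finite positive
    combinations of values, with which the extended medial limit commutes. *)
Lemma mhat_monotone (m : (nat -> R) -> R) (theta : nat -> Omega -> \bar R)
    (N : nat -> set Omega) : medial_limit m ->
  (forall n w, 0 <= theta n w)%E ->
  (forall n, martingale_monotone (theta n) (~` N n)) ->
  martingale_monotone (fun w => mhat m (theta ^~ w)) (~` (\bigcup_n N n)).
Proof.
move=> hm theta0 mono P Q fP cQ; have [s [us Ps Qs]] := competitor_support fP cQ.
have m1 := @measurable_prod_set1 R d.
have mh0 w : (0 <= mhat m (theta ^~ w))%E by apply: mhat_ge0.
have E (P' : probability Omega R) : P'.-negligible (~` [set` s]) ->
    (\int[P']_w mhat m (theta ^~ w) = mhat m (fun n => \int[P']_w theta n w))%E.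
  move=> P's; rewrite (ge0_integral_finite us m1 P's)//.
  rewrite -(mhat_sum hm _ (c := mass P') (F := fun w n => theta n w))//; last exact: mass_ge0.
  congr mhat; apply/funext => n.
  by rewrite (ge0_integral_finite us m1 P's).
rewrite (E P Ps) (E Q Qs); apply: mhat_le => // n; first exact: integral_ge0.
apply: mono => //; have [fin sub] := fP; split => // w /sub nw Nw.
by apply: nw; exists n.
Qed.

(** The single point of the union met by the support belongs to one of the
    sets, and it is then the single point met there as well. *)
Lemma singleton_bigcup (N : nat -> set Omega) :
  (forall n, measurable (N n)) ->
  (forall n P Q, finitely_supported_in P (~` N n) -> competitor Q P ->
    (exists w, supp Q `&` N n = [set w]) -> Q (N n) = 0%E) ->
  forall P Q, finitely_supported_in P (~` (\bigcup_n N n)) -> competitor Q P ->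
    (exists w, supp Q `&` (\bigcup_n N n) = [set w]) -> Q (\bigcup_n N n) = 0%E.
Proof.
move=> mN sing P Q [finP subP] cQ [w wE].
have [ws [n _ Nnw]] : (supp Q `&` (\bigcup_n N n)) w by rewrite wE.
have Qn : Q (N n) = 0%E.
  apply: (sing n P) => //.
    by split => // v /subP nv Nv; apply: nv; exists n.
  exists w; apply/seteqP; split=> [v [sv Nv]|_ ->//].
  by rewrite -wE; split => //; exists n.
apply: measure_negligible; first exact: bigcupT_measurable.
apply: negligibleS (negligibleU (negligible_supp_prod Q) _); last first.
  by apply/negligibleP; [exact: (mN n)|exact: Qn].
move=> v Nv; have [sv|nsv] := pselect (supp Q v); last by left.
by right; have -> : v = w by have : (supp Q `&` (\bigcup_n N n)) v by []; rewrite wE.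
Qed.

End Competitors.

(** * Tangent functions of convex functions *)

Section TangentPlanes.
Context (R : realType) (d : nat).
Local Notation V := 'rV[R]_d.
Local Notation Omega := (V * V)%type.
Variables (f : V -> R) (p : V -> V).
Hypothesis fp : is_subgradient f p.

(** Supporting affine functions make the function lower semicontinuous. *)
Lemma subgradient_measurable : measurable_fun [set: V] f.
Proof.
apply: (measurability _ (RGenOInfty.measurableE R)) => _ [_ [r ->] <-].
suff oU : open [set x : V | r < f x].
  rewrite setTI; apply: open_measurable_rV; congr (open _): oU.
  by apply/seteqP; split => x /=; rewrite in_itv/= andbT.
rewrite openE => x /= rx; apply/near_ballP.
pose C := 1 + d%:R * `|p x|.
have C0 : 0 < C by rewrite ltr_pwDl// mulr_ge0.
exists ((f x - r) / C); first by rewrite divr_gt0// subr_gt0.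
move=> y xy /=.
have [_ /(_ x y) sub] := fp; apply: lt_le_trans sub.
have : dotp (- p x) (y - x) <= `|p x| * \sum_i `|(y - x) 0 i| by apply: dotp_bound; rewrite normrN.
have : \sum_i `|(y - x) 0 i| <= d%:R * `|x - y|.
  apply: (@le_trans _ _ (\sum_(i < d) `|x - y|)).
    by apply: ler_sum => i _; rewrite distrC; exact: le_coord_norm.
  by rewrite sumr_const card_ord mulr_natl.
move=> h1 h2; rewrite dotpNl in h2.
have h3 : `|p x| * (\sum_i `|(y - x) 0 i|) <= C * `|x - y|.
  apply: (@le_trans _ _ (`|p x| * (d%:R * `|x - y|))); first by rewrite ler_wpM2l.
  by rewrite mulrA ler_wpM2r// /C mulrC; lra.
have h4 : C * `|x - y| < f x - r by rewrite mulrC -ltr_pdivlMr.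
lra.
Qed.

Lemma measurable_dotp (disp : measure_display) (T : measurableType disp) (u v : T -> V) :
  measurable_fun [set: T] u -> measurable_fun [set: T] v ->
  measurable_fun [set: T] (fun t => dotp (u t) (v t)).
Proof.
move=> mu mv; apply: measurable_sum => i.
by apply: measurable_funM; exact: measurable_coord_comp.
Qed.

Lemma measurable_tangent_Tp : measurable_fun [set: Omega] (tangent_Tp f p).
Proof.
apply/measurable_EFinP; apply: measurable_funB.
  apply: measurable_funB.
    by apply: (measurableT_comp subgradient_measurable); exact: measurable_snd.
  by apply: (measurableT_comp subgradient_measurable); exact: measurable_fst.
apply: measurable_dotp.
  by apply: (measurableT_comp fp.1); exact: measurable_fst.
by apply: measurable_rVB; [exact: measurable_snd|exact: measurable_fst].
Qed.

Lemma tangent_Tp_ge0 w : (0 <= tangent_Tp f p w)%E.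
Proof. by rewrite lee_fin; have [_ /(_ w.1 w.2)] := fp; lra. Qed.

Lemma tangent_Tp_convex x (A : set V) : convex_on A (fun y => tangent_Tp f p (x, y)).
Proof.
move=> n y t _ t0 t1 _; rewrite /tangent_Tp /=.
rewrite [leRHS](eq_bigr (fun i => (t i * (f (y i) - f x - dotp (p x) (y i - x)))%:E))//.
rewrite sumEFin lee_fin; set z := \sum_i _ *: _.
have fz : f z <= \sum_i t i * f (y i).
  apply: (@le_trans _ _ (\sum_i t i * (f z + dotp (p z) (y i - z)))); last first.
    by apply: ler_sum => i _; rewrite ler_wpM2l//; have [_] := fp; exact.
  under eq_bigr do rewrite mulrDr dotpBr mulrBr.
  rewrite big_split /= sumrB -!mulr_suml t1 !mul1r -dotp_sumr.
  by rewrite -/z subrr addr0.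
under eq_bigr do rewrite !mulrBr dotpBr mulrBr.
rewrite !sumrB -!mulr_suml t1 !mul1r -dotp_sumr -/z dotpBr; lra.
Qed.

Lemma tangent_Tp_diag x : tangent_Tp f p (x, x) = 0%E.
Proof.
rewrite /tangent_Tp /= !subrr sub0r /dotp big1 ?oppr0// => i _.
by rewrite mxE mulr0.
Qed.

(** The polar set can be taken empty: the function is finite, convex in the
    second variable everywhere, and its integral is the same for competitors. *)
Lemma tangent_Tp_Theta (mu nu : probability V R) (I : V -> set V) :
  measurable [set w : Omega | I w.1 w.2] -> Theta mu nu I (tangent_Tp f p).
Proof.
move=> mI; exists set0; split => //.
- exact: tangent_Tp_ge0.
- move=> B mB P; apply: completion_measurable_measurable.
  by rewrite -[X in measurable X]setTI; exact: measurable_tangent_Tp.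
- by move=> P _; exact: negligible_set0.
- by move=> w _ [].
- exact: tangent_Tp_diag.
- by move=> x; exact: tangent_Tp_convex.
- move=> P Q fP cQ; rewrite (tangent_Tp_competitor _ fP cQ)//.
  exact: tangent_Tp_ge0.
- exists set0; first exact: negligible_set0.
  split => //; first by move=> w _ [].
  apply/(measurable_restrictT _ _).1; last by apply: measurable_funTS; exact: measurable_tangent_Tp.
  rewrite (_ : [set w | _] = [set w : Omega | I w.1 w.2])//.
  by apply/seteqP; split => [w [_ Iw]|w Iw] //; split.
Qed.

End TangentPlanes.

Section TangentCost.
Context (R : realType) (d : nat).
Local Notation V := 'rV[R]_d.
Local Notation Omega := (V * V)%type.

(** An affine minorant and a finite first moment control the negative part; a
    finite upper integral then controls the positive one. *)
Lemma integrable_affine_minorant (l : probability V R) (f : V -> R) (a : R) (q : V) :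
  finite_first_moment l -> measurable_fun [set: V] f ->
  (forall y, a + dotp q y <= f y) ->
  (\int[l]_x (f x)%:E < +oo)%E -> l.-integrable [set: V] (EFin \o f).
Proof.
move=> hl mf hf fin; pose C := d%:R * `|q|.
have C0 : 0 <= C by rewrite mulr_ge0.
pose h (y : V) : \bar R := (`|a|%:E + C%:E * (enorm y)%:E)%E.
have h0 y : (0 <= h y)%E by rewrite adde_ge0// mule_ge0// lee_fin// sqrtr_ge0.
have ih : l.-integrable [set: V] h.
  apply: integrableD => //; last exact: integrableZl.
  exact: finite_measure_integrable_cst.
have mfE : measurable_fun [set: V] (EFin \o f) by exact/measurable_EFinP.
have le_neg y : ((EFin \o f)^\- y <= h y)%E.
  rewrite funenegE /= -EFin_max /h -EFinM -EFinD lee_fin ge_max; apply/andP; split; last first.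
    by rewrite addr_ge0// mulr_ge0// sqrtr_ge0.
  have : dotp (- q) y <= `|q| * \sum_i `|y 0 i| by apply: dotp_bound; rewrite normrN.
  have : \sum_i `|y 0 i| <= d%:R * enorm y.
    apply: (@le_trans _ _ (\sum_(i < d) enorm y)).
      by apply: ler_sum => i _; apply: le_trans (le_norm_enorm y); exact: le_coord_norm.
    by rewrite sumr_const card_ord mulr_natl.
  move=> h1 h2; rewrite dotpNl in h2.
  have h3 : `|q| * (\sum_i `|y 0 i|) <= C * enorm y.
    by apply: (le_trans (ler_wpM2l (normr_ge0 q) h1)); rewrite /C mulrA [d%:R * _]mulrC.
  by have := hf y; have := ler_norm (- a); rewrite normrN; lra.
have neg_fin : (\int[l]_x (EFin \o f)^\- x < +oo)%E.
  apply: le_lt_trans (ge0_le_integralT l _ le_neg) _ => //.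
  by rewrite ltey_eq (integrable_fin_num _ ih).
have pos_fin : (\int[l]_x (EFin \o f)^\+ x < +oo)%E.
  move: fin; rewrite integralE ltNge leye_eq => /negP fin.
  rewrite ltNge leye_eq; apply/negP => /eqP pos; apply: fin; rewrite pos.
  by rewrite -(@fineK _ (\int[l]_x _^\- x)%E)// ge0_fin_numE//; exact: integral_ge0.
apply/integrableP; split => //.
rewrite (eq_integral (fun x => (EFin \o f)^\+ x + (EFin \o f)^\- x)%E) => [|x _]; last first.
  by have := fune_abse (EFin \o f) => /(congr1 (fun g => g x)).
rewrite ge0_integralD//; [|exact: measurable_funepos|exact: measurable_funeneg].
exact: lte_add_pinfty.
Qed.

Lemma marginal_integral (P : probability Omega R) (l : probability V R)
    (phi : Omega -> V) (f : V -> R) : measurable_fun [set: Omega] phi ->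
  (forall A, measurable A -> P (phi @^-1` A) = l A) ->
  l.-integrable [set: V] (EFin \o f) ->
  P.-integrable [set: Omega] (fun w => (f (phi w))%:E) /\
  (\int[P]_w (f (phi w))%:E = \int[l]_x (f x)%:E)%E.
Proof.
move=> mphi marg fi; have [mf finf] := integrableP _ _ _ fi.
have E (g : V -> \bar R) : (\int[pushforward P phi]_x g x = \int[l]_x g x)%E.
  by apply: eq_measure_integral => A mA _; exact: marg.
have iP : P.-integrable [set: Omega] (fun w => (f (phi w))%:E).
  apply/integrableP; split; first exact: (measurableT_comp mf mphi).
  have := @ge0_integral_pushforward _ _ _ _ R phi mphi P setT (fun x => `|(EFin \o f) x|)%E measurableT.
  rewrite E preimage_setT => <-//.
  exact: measurableT_comp.
split => //; rewrite -[RHS]E.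
by rewrite (integral_pushforward mphi)// preimage_setT.
Qed.

Section Coupling.
Variables (mu nu : probability V R) (P : probability Omega R).
Hypothesis PM : mart_couplings mu nu P.

Lemma coupling_fst (f : V -> R) : mu.-integrable [set: V] (EFin \o f) ->
  P.-integrable [set: Omega] (fun w => (f w.1)%:E) /\
  (\int[P]_w (f w.1)%:E = \int[mu]_x (f x)%:E)%E.
Proof.
by apply: (marginal_integral measurable_fst) => A mA; have [marg _] := PM; have [] := marg A mA.
Qed.

Lemma coupling_snd (f : V -> R) : nu.-integrable [set: V] (EFin \o f) ->
  P.-integrable [set: Omega] (fun w => (f w.2)%:E) /\
  (\int[P]_w (f w.2)%:E = \int[nu]_x (f x)%:E)%E.
Proof.
by apply: (marginal_integral measurable_snd) => A mA; have [marg _] := PM; have [] := marg A mA.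
Qed.

Lemma coupling_increment (A : set V) (c : V) : measurable A ->
  P.-integrable [set: Omega] (fun w => (dotp c (w.2 - w.1))%:E) /\
  (\int[P]_(w in fst @^-1` A) (dotp c (w.2 - w.1))%:E = 0)%E.
Proof.
move=> mA; have [_ [_ ce]] := PM.
have mA1 := measurable_fst_preimage mA.
have E w : (dotp c (w.2 - w.1))%:E =
    (\sum_i (c 0 i)%:E * ((w.2 0 i)%:E - (w.1 0 i)%:E))%E.
  rewrite /dotp -sumEFin; apply: eq_bigr => i _.
  by rewrite !mxE EFinM.
have ii i : P.-integrable [set: Omega] (fun w => (w.2 0 i)%:E - (w.1 0 i)%:E)%E.
  by have [i2 i1 _] := ce i; exact: integrableB.
have ci i : P.-integrable [set: Omega] (fun w => (c 0 i)%:E * ((w.2 0 i)%:E - (w.1 0 i)%:E))%E.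
  exact: integrableZl.
split.
  under eq_fun do rewrite E.
  by apply: integrable_sum => // i _; exact: ci.
under eq_integral do rewrite E.
have sub g : P.-integrable [set: Omega] g -> P.-integrable (fst @^-1` A) g.
  by apply: integrableS.
rewrite integral_sum//; last by move=> i; apply: sub.
rewrite big1// => i _; rewrite integralZl//; last exact: sub.
have [i2 i1 /(_ A mA) /= e] := ce i.
rewrite (integralB mA1 (sub _ i2) (sub _ i1)).
by rewrite -e subee ?mule0// (integrable_fin_num mA1 (sub _ i1)).
Qed.

Lemma coupling_displacement :
  P.-integrable [set: Omega] (fun w => (\sum_i `|(w.2 - w.1) 0 i|)%:E).
Proof.
have [_ [_ ce]] := PM.
under eq_fun do rewrite -sumEFin.
apply: integrable_sum => // i _; have [i2 i1 _] := ce i.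
have := integrable_abse (integrableB measurableT i2 i1).
by apply: eq_integrable => // w _; rewrite !mxE.
Qed.

(** Nothing is known about the integrability of the slope, so the linear term
    cannot be integrated at once. On a cell where the slope stays within [e] of
    a fixed rational vector, the martingale property annihilates that vector
    times the displacement, and the error is at most [e] times the
    displacement. *)
Lemma tangent_cost (f : V -> R) (p : V -> V) (e : R) : 0 < e ->
  is_subgradient f p -> mu.-integrable [set: V] (EFin \o f) ->
  nu.-integrable [set: V] (EFin \o f) ->
  (\int[P]_w tangent_Tp f p w <= \int[nu]_x (f x)%:E - \int[mu]_x (f x)%:E +
    e%:E * \int[P]_w (\sum_i `|(w.2 - w.1) 0 i|)%:E)%E.
Proof.
move=> e0 fp fmu fnu.
have [i1 e1] := coupling_fst fmu; have [i2 e2] := coupling_snd fnu.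
pose cell n := [set x | least (fun n => `|p x - rat_rV R d n| < e) = n].
have mcell n : measurable (cell n).
  apply: measurable_least => k; apply: measurable_dist_lt; last exact: measurable_cst.
  by have [] := fp.
have cellP n x : cell n x -> `|p x - rat_rV R d n| < e.
  by move=> <-; exact: (leastP (rat_rV_dense (p x) e0)).1.
pose F n : set Omega := fst @^-1` cell n.
have mF n : measurable (F n) by exact: measurable_fst_preimage.
have FT : \bigcup_n F n = [set: Omega].
  by apply/seteqP; split => // w _; exists (least (fun n => `|p w.1 - rat_rV R d n| < e)).
have tF : trivIset [set: nat] F.
  by move=> i j _ _ [w [/= <- <-]].
pose D (w : Omega) : R := \sum_i `|(w.2 - w.1) 0 i|.
pose H (w : Omega) : \bar R := ((f w.2)%:E - (f w.1)%:E + e%:E * (D w)%:E)%E.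
have iH : P.-integrable [set: Omega] H.
  apply: integrableD => //; first exact: integrableB.
  by apply: integrableZl => //; exact: coupling_displacement.
have <- : (\int[P]_w H w = \int[nu]_x (f x)%:E - \int[mu]_x (f x)%:E +
    e%:E * \int[P]_w (D w)%:E)%E.
  rewrite integralD//; [|exact: integrableB|].
    by rewrite integralB// e1 e2 integralZl//; exact: coupling_displacement.
  by apply: integrableZl => //; exact: coupling_displacement.
have T0 w : (0 <= tangent_Tp f p w)%E by exact: tangent_Tp_ge0.
have mT := measurable_tangent_Tp fp.
rewrite -FT [leRHS]integral_bigcup//; last by rewrite FT.
rewrite ge0_integral_bigcup//; last by rewrite FT.
apply: lee_nneseries => [n _ _|n _]; first exact: integral_ge0.
have [iK K0] := coupling_increment (rat_rV R d n) (mcell n).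
have iHn : P.-integrable (F n) H by apply: integrableS iH.
have iKn : P.-integrable (F n) (fun w => (dotp (rat_rV R d n) (w.2 - w.1))%:E).
  by apply: integrableS iK.
rewrite -[leRHS]sube0 -K0 -integralB//.
apply: ge0_le_integral => //.
- exact: measurable_funTS.
- by apply: measurable_int (integrableB _ iHn iKn).
move=> [x y] /= /cellP /ltW px.
rewrite /H /tangent_Tp /= lee_fin.
have := @dotp_bound R d (- (p x - rat_rV R d n)) (y - x) e.
rewrite normrN dotpNl dotpBl => /(_ px); rewrite -/(D (x, y)); lra.
Qed.

End Coupling.

(** Under the convention [oo - oo = oo], a cost at most one rules out that the
    larger of the two integrals is infinite. *)
Lemma convex_fun_integrable (mu nu : probability V R) (f : V -> R) (p : V -> V) :
  finite_first_moment mu -> finite_first_moment nu -> convex_order mu nu ->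
  convex_fun mu nu 1 f -> is_subgradient f p ->
  [/\ mu.-integrable [set: V] (EFin \o f), nu.-integrable [set: V] (EFin \o f) &
   (\int[nu]_x (f x)%:E - \int[mu]_x (f x)%:E <= 1)%E].
Proof.
move=> hmu hnu hord [cf cost] fp.
have mf := subgradient_measurable fp.
have low y : f 0 + dotp (p 0) y <= f y by have [_ /(_ 0 y)] := fp; rewrite subr0.
have nufin : (\int[nu]_x (f x)%:E < +oo)%E.
  rewrite ltNge leye_eq; apply/negP => /eqP nuy; move: cost.
  by rewrite /sub_inf nuy; case: (\int[mu]_x _)%E.
have mufin := le_lt_trans (hord f cf) nufin.
have inu := integrable_affine_minorant hnu mf low nufin.
have imu := integrable_affine_minorant hmu mf low mufin.
split => //; move: cost; rewrite /sub_inf.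
have : (\int[nu]_x (f x)%:E)%E \is a fin_num by exact: integrable_fin_num inu.
have : (\int[mu]_x (f x)%:E)%E \is a fin_num by exact: integrable_fin_num imu.
by case: (\int[nu]_x _)%E => //; case: (\int[mu]_x _)%E.
Qed.

Lemma tangent_cost_le1 (mu nu : probability V R) (f : V -> R) (p : V -> V)
    (P : probability Omega R) :
  finite_first_moment mu -> finite_first_moment nu -> convex_order mu nu ->
  convex_fun mu nu 1 f -> is_subgradient f p -> mart_couplings mu nu P ->
  (\int[P]_w tangent_Tp f p w <= 1)%E.
Proof.
move=> hmu hnu hord cf fp PM.
have [imu inu c1] := convex_fun_integrable hmu hnu hord cf fp.
set D := (\int[P]_w (\sum_i `|(w.2 - w.1) 0 i|)%:E)%E.
have Dfin : D \is a fin_num by exact: integrable_fin_num (coupling_displacement PM).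
have D0 : 0 <= fine D.
  by apply/fine_ge0/integral_ge0 => w _; rewrite lee_fin; apply: sumr_ge0.
apply/lee_addgt0Pr => e e0.
have e1 : 0 < e / (1 + fine D) by rewrite divr_gt0// ltr_pwDl.
apply: le_trans (tangent_cost PM e1 fp imu inu) _.
apply: leeD => //; rewrite -/D -(fineK Dfin) -EFinM lee_fin.
rewrite mulrAC ler_pdivrMr ?ltr_pwDl// ler_wpM2l ?(ltW e0)// lerDr//.
Qed.

End TangentCost.

(** * Medial limits of tangent convex functions *)

Section Compactness.
Context (R : realType) (d : nat).
Local Notation V := 'rV[R]_d.
Local Notation Omega := (V * V)%type.

Section NullSections.
Variables (mu : probability V R) (P : probability Omega R) (k : R.-pker V ~> V).
Hypothesis hk : disintegrates P mu k.

(** The measure of a section is a measurable function of the base point, so a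
    vanishing integral makes it vanish almost everywhere. *)
Lemma null_sections (Z : set Omega) : measurable Z -> P Z = 0%E ->
  {ae mu, forall x, k x (xsection Z x) = 0%E}.
Proof.
move=> mZ Z0; have := hk mZ; rewrite Z0 => /esym int0.
have mx : measurable_fun [set: V] (fun x => k x (xsection Z x)).
  by apply: measurable_fun_xsection_finite_kernel; rewrite inE.
have := (ae_eq_integral_abs mu measurableT mx).1.
under eq_integral do rewrite gee0_abs//.
by move=> /(_ int0); apply: filterS => x /= /(_ Logic.I).
Qed.

(** A subset of full measure is dense in the support, so its convex hull
    contains the relative interior of the hull of the support. *)
Lemma ri_hull_full_measure x (Z : set V) : measurable Z -> k x Z = 0%E ->
  ri (convex_hull (supp (k x))) `<=` convex_hull (supp (k x) `&` ~` Z).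
Proof.
move=> mZ Z0; set S := supp (k x); set S' := S `&` ~` Z.
apply: ri_sub_dense; first exact: convex_hull_convex.
  by apply: smallest_sub; [exact: convex_hull_convex|move=> y [Sy _]; exact: sub_convex_hull].
apply: smallest_sub; first by apply: closure_convex; exact: convex_hull_convex.
move=> y Sy; apply: contrapT => nclS'.
have : ~ closure S' y by move=> h; apply: nclS'; apply: closure_subset h; exact: sub_convex_hull.
move=> ncl; apply: ncl; apply: Sy; split; first exact: closed_closure.
have mcl : measurable (~` closure S').
  by apply: open_measurable_rV; apply: closed_openC; exact: closed_closure.
apply: (measure_negligible mcl).
have nZ : (k x).-negligible Z by exists Z; split.
apply: negligibleS (negligibleU (negligible_supp_rV (k x)) nZ) => z ncz.
have [Zz|nZz] := pselect (Z z); [by right|left => Sz].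
by apply: ncz; apply: subset_closure.
Qed.

End NullSections.

Variables (mu nu : probability V R) (I : V -> set V).
Hypothesis hI : irreducible_components mu nu I.
Variables (m : (nat -> R) -> R) (hm : medial_limit m).
Variable thetas : nat -> Omega -> \bar R.
Variable N : nat -> set Omega.
Hypothesis tcN : forall n, tangent_convex mu nu I (N n) (thetas n).
Hypothesis cost : forall n P, mart_couplings mu nu P -> (\int[P]_w thetas n w <= 1)%E.

Let theta w := mhat m (thetas ^~ w).
Let NN := \bigcup_n N n.

Lemma thetas_ge0 n w : (0 <= thetas n w)%E.
Proof. exact: (tc_ge0 (tcN n)). Qed.

Lemma thetas_almost_borel n (P : probability Omega R) : almost_borel P (thetas n).
Proof.
apply: completion_almost_borel; first exact: thetas_ge0.
by move=> B mB; exact: (tc_univ_measurable (tcN n)).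
Qed.

Lemma limit_almost_borel (P : probability Omega R) : almost_borel P theta.
Proof.
by apply: (almost_borel_mhat hm thetas_ge0) => n; exact: thetas_almost_borel.
Qed.

Lemma limit_ge0 w : (0 <= theta w)%E.
Proof. by apply: (mhat_ge0 hm) => n; exact: thetas_ge0. Qed.

Lemma limit_fatou (P : probability Omega R) :
  (\int[P]_w theta w <= limn_esup (fun n => \int[P]_w thetas n w))%E.
Proof.
apply: le_trans (integral_mhat_le hm thetas_ge0 (fun n => thetas_almost_borel n P)) _.
by apply: (mhat_limn_esup hm) => n; apply: integral_ge0 => w _; exact: thetas_ge0.
Qed.

Lemma limit_cost (P : probability Omega R) : mart_couplings mu nu P ->
  (\int[P]_w theta w <= 1)%E.
Proof.
move=> PM; apply: le_trans (limit_fatou P) _.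
rewrite limn_esup_lim; apply: lime_le; first exact: is_cvg_esups.
apply: nearW => n; apply: ge_ereal_sup => _ [k _ <-]; exact: cost.
Qed.

Lemma limit_convex x : convex_on [set y | ~ NN (x, y)] (fun y => theta (x, y)).
Proof.
move=> n y t ny t0 t1 nz; rewrite /theta.
have -> : (\sum_i (t i)%:E * mhat m (thetas ^~ (x, y i)) =
    mhat m (fun j => \sum_i (t i)%:E * thetas j (x, y i)))%E.
  by rewrite (mhat_sum hm _ (c := t) (F := fun i j => thetas j (x, y i)))// => i j; exact: thetas_ge0.
apply: (mhat_le hm) => j; first exact: thetas_ge0.
apply: (tc_convex (tcN j)) => //.
  by move=> i /= h; apply: (ny i); exists j.
by move=> /= h; apply: nz; exists j.
Qed.

(** The optimal coupling charges no point where the limit is infinite; convexity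
    spreads finiteness from its support to the whole component. *)
Lemma limit_finite_component : exists N0 : set V,
  [/\ measurable N0, mu N0 = 0%E &
      forall x, ~ N0 x -> forall y, I x y -> ~ NN (x, y) /\ theta (x, y) \is a fin_num].
Proof.
have [Phat [PM [[k dk kI] _]]] := comp_max hI.
have [g [mg g0 ng]] := almost_borel_ge0 limit_ge0 (limit_almost_borel Phat).
have ig : Phat.-integrable [set: Omega] g.
  apply/integrableP; split => //.
  under eq_integral do rewrite gee0_abs//.
  rewrite -(ge0_eq_integral_negligible limit_ge0 g0 ng).
  exact: le_lt_trans (limit_cost PM) (ltry _).
have nNN : Phat.-negligible NN.
  by apply: negligible_bigcup => n; exact: (tc_polar (tcN n)).
have gfin : Phat.-negligible [set w | ~ (g w \is a fin_num)].
  have := integrable_ae measurableT ig => -[Z [mZ Z0 hZ]]; exists Z; split => //.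
  by move=> w /= ngw; apply: hZ => /= h; apply: ngw; exact: h.
(* Off [Z] the limit agrees with its Borel version, is finite, and the point
   is outside the polar sets. *)
have [Z [mZ Z0 hZ]] := negligibleU (negligibleU ng gfin) nNN.
have /choice[Nn hNn] n : exists Nn : set V, mu.-negligible Nn /\
    [set w : Omega | ~ Nn w.1 /\ I w.1 w.2] `<=` ~` N n.
  by have [Nn nNn [sub _ _]] := tc_restriction (tcN n); exists Nn.
have nNn : mu.-negligible (\bigcup_n Nn n).
  by apply: negligible_bigcup => n; have [] := hNn n.
have [N0 [mN0 N00 hN0]] := negligibleU (negligibleU nNn kI) (null_sections dk mZ Z0).
exists N0; split => // x nx y Ixy.
have nN n : ~ Nn n x by move=> h; apply: nx; apply: hN0; left; left; exists n.
have kIx : ri (convex_hull (supp (k x))) = I x.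
  by apply: contrapT => h; apply: nx; apply: hN0; left; right.
have kZ : k x (xsection Z x) = 0%E.
  by apply: contrapT => h; apply: nx; apply: hN0; right.
have nNNxy : ~ NN (x, y).
  by move=> [n _]; have [_ sub] := hNn n; apply: sub; split => //; exact: nN.
split => //.
move: (Ixy); rewrite -kIx => /(ri_hull_full_measure (measurable_xsection x mZ) kZ).
move=> /convex_hull_combinations[n [a [t [Sa t0 t1 yE]]]].
have nZ i : ~ Z (x, a i).
  by have [_ h] := Sa i; move=> Zi; apply: h; rewrite /xsection /= inE.
have afin i : theta (x, a i) \is a fin_num.
  have /not_orP[/not_orP[/contrapT e /contrapT f] _] : ~ (([set w | theta w <> g w] `|`
     [set w | ~ (g w \is a fin_num)]) `|` NN) (x, a i) by move=> h; apply: (nZ i); exact: hZ.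
  by rewrite e.
have na i : ~ NN (x, a i) by move=> h; apply: (nZ i); apply: hZ; right.
rewrite ge0_fin_numE ?limit_ge0// yE.
have := @limit_convex x n a t na t0 t1; rewrite -yE => /(_ nNNxy) h.
rewrite yE -yE; apply: le_lt_trans h _.
rewrite (eq_bigr (fun i => (t i * fine (theta (x, a i)))%:E)) => [|i _].
  by rewrite sumEFin ltry.
by rewrite EFinM fineK.
Qed.

(** The exceptional set of the fibrewise condition is enlarged twice: to make
    the limit finite on the components, then to make it Borel there. *)
Lemma limit_tangent_convex : tangent_convex mu nu I NN theta.
Proof.
split.
- exact: limit_ge0.
- move=> B mB P; apply: almost_borel_completion => //; exact: limit_almost_borel.
- by apply: bigcupT_measurable => n; exact: (tc_borel (tcN n)).
- by move=> P PM; apply: negligible_bigcup => n; exact: (tc_polar (tcN n)).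
- by move=> w ww [n _]; exact: (tc_diag (tcN n)).
- move=> x; rewrite /theta -[RHS](mhat0 hm); congr mhat; apply/funext => n.
  exact: (tc_diag0 (tcN n)).
- exact: limit_convex.
- apply: (mhat_monotone hm thetas_ge0) => n; exact: (tc_monotone (tcN n)).
- apply: singleton_bigcup => n; first exact: (tc_borel (tcN n)).
  exact: (tc_singleton (tcN n)).
have [N0 [mN0 N00 hN0]] := limit_finite_component.
have Ic := comp_convex hI.
have [||Nmu [mNmu Nmu0 sub mrestr]] := borel_restriction (comp_borel hI)
  (comp_refl hI) Ic (comp_ri hI) mN0 N00 limit_almost_borel.
- by move=> x y nx Ixy; have [] := hN0 x nx y Ixy.
- move=> x nx n a t Ia t0 t1; apply: limit_convex => //.
    by move=> i; have [] := hN0 x nx _ (Ia i).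
  have Isum : I x (\sum_i t i *: a i) by exact: convex_comb.
  by have [] := hN0 x nx _ Isum.
exists Nmu; first by exists Nmu; split.
have n0 x : ~ Nmu x -> ~ N0 x by move=> h /sub.
split => // -[x y] [/= /n0 nx Ixy]; have [] := hN0 x nx y Ixy => //.
Qed.

Lemma limit_generates : generates mu nu I thetas theta.
Proof.
split.
- by move=> n; exists (N n).
- by exists NN; exact: limit_tangent_convex.
- by move=> w; apply: (limn_einf_mhat hm) => n; exact: thetas_ge0.
- exact: limit_fatou.
Qed.

End Compactness.

(** * The semi-closure and the components *)

Section Closing.
Context (R : realType) (d : nat).
Local Notation V := 'rV[R]_d.
Local Notation Omega := (V * V)%type.
Variables (mu nu : probability V R) (I : V -> set V).
Hypothesis hI : irreducible_components mu nu I.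

(** The tangent convex functions of cost at most one for every coupling form a
    semi-closed set, by the second requirement in the definition of generation.
    Exhibiting such a set also shows that the semi-closure is an intersection
    over a nonempty family, hence made of tangent convex functions. *)
Lemma T_tilde_cost (theta : Omega -> \bar R) :
  finite_first_moment mu -> finite_first_moment nu -> convex_order mu nu ->
  T_tilde mu nu I 1 theta ->
  Theta mu nu I theta /\
  forall P, mart_couplings mu nu P -> (\int[P]_w theta w <= 1)%E.
Proof.
move=> hmu hnu hord.
pose S : set (Omega -> \bar R) := [set theta | Theta mu nu I theta /\
  forall P, mart_couplings mu nu P -> (\int[P]_w theta w <= 1)%E].
move=> /(_ S); apply; split; first split.
- by move=> t [].
- move=> ts t hts [_ Tt _ fatou]; split => // P PM.
  apply: le_trans (fatou P) _.
  rewrite limn_esup_lim; apply: lime_le; first exact: is_cvg_esups.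
  by apply: nearW => n; apply: ge_ereal_sup => _ [k _ <-]; have [_] := hts k; apply.
- move=> _ [f [p [cf fp ->]]]; split.
    apply: tangent_Tp_Theta => //.
    exact: (measurable_graph (comp_borel hI) (comp_refl hI) (comp_convex hI) (comp_ri hI)).
  by move=> P PM; exact: (tangent_cost_le1 hmu hnu hord cf fp PM).
Qed.

(** A component is the relative interior of its own closure. *)
Lemma component_Kri x : @Kri R d (I x).
Proof.
exists (closure (I x)); split.
- by exists x; apply: subset_closure; exact: comp_refl hI x.
- exact: closed_closure.
- by apply: closure_convex; exact: comp_convex hI x.
- by rewrite ri_closure//; [exact: comp_convex hI x|exact: comp_ri hI x].
Qed.

End Closing.

Theorem proposition3p14 (R : realType) (d : nat) (hd : (1 <= d)%N)
    (mu nu : probability 'rV[R]_d R) (I : 'rV[R]_d -> set 'rV[R]_d)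
    (hmu : finite_first_moment mu) (hnu : finite_first_moment nu)
    (hord : convex_order mu nu) (hI : irreducible_components mu nu I)
    (hmedial : exists m : (nat -> R) -> R, medial_limit m)
    (hchoice : choice_on R) :
  assumption_D mu nu I.
Proof.
have [m hm] := hmedial; split.
  move=> thetas hthetas.
  have hTc n := T_tilde_cost hI hmu hnu hord (hthetas n).
  have /choice[N tcN] n : exists N, tangent_convex mu nu I N (thetas n) by have [] := hTc n.
  have cost n P : mart_couplings mu nu P -> (\int[P]_w thetas n w <= 1)%E.
    by have [_] := hTc n; exact.
  have gen := limit_generates hI hm tcN cost.
  exists (fun w => mhat m (thetas ^~ w)) => //.
  move=> S [Ssc gens]; apply: (Ssc.2 thetas) => // n.
  exact: hthetas.
(* All the components go into the well-ordered class. *)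
exists (@Kri R d), set0, set0; split.
- by split=> //; split.
- by apply: aeW => x; left; left; exact: component_Kri hI x.
- have [le wo] := @well_ordering_principle {eclassic (set 'rV[R]_d)}.
  exists le => A _; exact: wo.
- by [].
- move=> P _; rewrite (_ : [set w | _] = set0); first exact: negligible_set0.
  by apply/seteqP; split => // w /= [K [K' []]].
Qed.
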